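(* Let $n\ge 2$ be finite and let $B\subseteq O_n=C^*(G_n)$ be a norm closed bimodule over $A(D_0)$. Then the following are equivalent: (1) $B$ is reflexive, i.e. $B=A(\sigma(B))$. (2) $B$ is generated (as a norm closed $A(D_0)$-bimodule) by the Cuntz partial isometries which it contains. (3) $B$ is invariant under all the gauge automorphisms $\eta_\lambda$, $\lambda\in\mathbb{C}$, $|\lambda|=1$.
   Context: Fix a finite $n\ge 2$. $X=\prod_{1}^{\infty}\{1,\dots,n\}$ with the product topology. For a (possibly empty) finite string $\alpha$ in $\{1,\dots,n\}$, $\ell(\alpha)$ is its length, and $\alpha\gamma$ ($\gamma\in X$) is the concatenation. The Cuntz groupoid is $G_n=\{(\alpha\gamma,\ell(\alpha)-\ell(\beta),\beta\gamma)\mid \alpha,\beta \text{ finite strings},\ \gamma\in X\}$ with $(x,k,y)(y,j,z)=(x,k+j,z)$, $(x,k,y)^{-1}=(y,-k,x)$, and topology with basis the (compact open) sets $U_{\alpha,\beta}=\{(\alpha\gamma,\ell(\alpha)-\ell(\beta),\beta\gamma)\mid\gamma\in X\}$. The groupoid C*-algebra $C^*(G_n)$ is the completion of $C_c(G_n)$ (with convolution $f*g(x,k,y)=\sum f(x,k_1,z)g(z,k_2,y)$, the sum over $k_1+k_2=k$ and $z$ with both factors in $G_n$, and $f^*(x,k,y)=\overline{f(y,-k,x)}$) in the groupoid C*-norm. The Cuntz algebra $O_n$, generated by isometries $S_1,\dots,S_n$ with $\sum S_iS_i^*=I$, is identified with $C^*(G_n)$ so that $S_\alpha S_\beta^*$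 (where $S_\alpha=S_{\alpha_1}\cdots S_{\alpha_k}$, $S_\emptyset=I$) corresponds to the characteristic function $\chi_{\alpha,\beta}$ of $U_{\alpha,\beta}$. The elements $S_\alpha S_\beta^*$ are called Cuntz partial isometries. Since the sup norm is dominated by the C*-norm, elements of $C^*(G_n)$ are viewed as continuous functions on $G_n$ vanishing at infinity. $D_0=\{(x,0,x)\mid x\in X\}$ is the (open) unit space. For an open $P\subseteq G_n$, $A(P)=\{f\in C^*(G_n)\mid f \text{ vanishes on } G_n\setminus P\}$; $A(D_0)$ is an abelian subalgebra and each $A(P)$ is an $A(D_0)$-bimodule. For an $A(D_0)$-bimodule $B\subseteq O_n$, $\sigma(B)=\{(x,k,y)\in G_n\mid f(x,k,y)\neq0\text{ for some }f\in B\}$, an open set. The gauge automorphism $\eta_\lambda$ of $O_n$ is determined by $\eta_\lambda(S_i)=\lambda S_i$ for $i=1,\dots,n$. *)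

(* Defs.v *)
From HB Require Import structures.
From mathcomp Require Import all_boot all_order all_algebra.
From mathcomp Require Import complex zify.
From mathcomp Require Import all_classical all_reals all_analysis.

Set Implicit Arguments.
Unset Strict Implicit.
Unset Printing Implicit Defensive.

Import Order.TTheory GRing.Theory Num.Theory.
Import numFieldNormedType.Exports.

Local Open Scope classical_set_scope.
Local Open Scope ring_scope.

(* The complex numbers are packed as a [numClosedFieldType] so that the
   library's topology and norm on such fields apply to them. *)
Definition Cplx (R : realType) : numClosedFieldType := complex R.

(* Norms of modules over [Cplx R] take values in [Cplx R]; this is the same
   norm seen in [R]. *)
Definition rnorm (R : realType) (V : normedModType (Cplx R)) (x : V) : R :=
  complex.Re `|x|.

(* Unital C*-algebras, on top of Banach spaces; C*(G_n) is unital since the unit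
   space is compact.  The product is not the one of a ring structure because the
   join of [algType] and [normedModType] is not available in the hierarchy. *)
HB.mixin Record isCStarAlgebra (K : numClosedFieldType) A
    & CompleteNormedModule K A := {
  cmul : A -> A -> A;
  cunit : A;
  star : A -> A;
  cmulA : associative cmul;
  cmul1x : left_id cunit cmul;
  cmulx1 : right_id cunit cmul;
  cmulDl : left_distributive cmul +%R;
  cmulDr : right_distributive cmul +%R;
  cmulZl : forall (c : K) (x y : A), cmul (c *: x) y = c *: cmul x y;
  cmulZr : forall (c : K) (x y : A), cmul x (c *: y) = c *: cmul x y;
  starD : {morph star : x y / x + y};
  starZ : forall (c : K) (x : A), star (c *: x) = c^* *: star x;
  starM : forall x y : A, star (cmul x y) = cmul (star y) (star x);
  starK : involutive star;
  cnormM : forall x y : A, `|cmul x y| <= `|x| * `|y|;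
  cnorm_starM : forall x : A, `|cmul (star x) x| = `|x| ^+ 2
}.

#[short(type="cstarAlgType")]
HB.structure Definition CStarAlgebra (K : numClosedFieldType) :=
  {A of CompleteNormedModule K A & isCStarAlgebra K A}.

Notation "x ** y" := (cmul x y) (at level 40, left associativity) : ring_scope.

Section CuntzGroupoid.
Variable n : nat.

(* The alphabet {1, ..., n} is rendered as 'I_n = {0, ..., n-1}. *)
Definition infinite_word := nat -> 'I_n.

Definition wcat (a : seq 'I_n) (w : infinite_word) : infinite_word :=
  fun i => nth (w (i - size a)%N) a i.

Definition arrow_of (a b : seq 'I_n) (w : infinite_word) :
    infinite_word * int * infinite_word :=
  (wcat a w, (size a)%:Z - (size b)%:Z, wcat b w).

Definition cuntz_arrows : set (infinite_word * int * infinite_word) :=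
  [set p | exists a b w, p = arrow_of a b w].

Definition cuntz_groupoid := {p : infinite_word * int * infinite_word | p \in cuntz_arrows}.

HB.instance Definition _ := Choice.on infinite_word.
HB.instance Definition _ := SubChoice.on cuntz_groupoid.

(* The arrow (x, k, y) has range x, degree k and source y. *)
Definition grange (g : cuntz_groupoid) : infinite_word := (val g).1.1.
Definition gdegree (g : cuntz_groupoid) : int := (val g).1.2.
Definition gsource (g : cuntz_groupoid) : infinite_word := (val g).2.

Lemma ginv_subproof (g : cuntz_groupoid) :
  (gsource g, - gdegree g, grange g) \in cuntz_arrows.
Proof.
case: g => -[[x k] y] /= /[dup] /set_mem[a [b [w [-> -> ->]]]] ?.
by apply/mem_set; exists b, a, w; rewrite /arrow_of /gdegree /= opprB.
Qed.

Definition ginv (g : cuntz_groupoid) : cuntz_groupoid :=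
  exist (fun p => p \in cuntz_arrows) _ (ginv_subproof g).

(* The pairs (g1, g2) of composable arrows with g1 g2 = g. *)
Definition factorizations (g : cuntz_groupoid) :
    set (cuntz_groupoid * cuntz_groupoid) :=
  [set p | [/\ grange p.1 = grange g, gsource p.1 = grange p.2,
               gsource p.2 = gsource g
             & gdegree p.1 + gdegree p.2 = gdegree g]].

Definition basic_open (a b : seq 'I_n) : set cuntz_groupoid :=
  [set g | exists w, val g = arrow_of a b w].

Let base : set (set cuntz_groupoid) :=
  [set U | exists a b, U = basic_open a b].

Let base_cover : \bigcup_(U in base) U = setT.
Proof.
apply/seteqP; split=> // g _.
have [a [b [w gE]]] := set_mem (valP g).
by exists (basic_open a b); [exists a, b | exists w].
Qed.

Let wcat_take (a a' : seq 'I_n) w w' : (size a <= size a')%N ->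
  wcat a w = wcat a' w' -> a' = a ++ drop (size a) a' /\
  w = wcat (drop (size a) a') w'.
Proof.
move=> le_aa' eq_w; have eq_i i : wcat a w i = wcat a' w' i by rewrite eq_w.
split.
  have eq_take : take (size a) a' = a.
    apply: (@eq_from_nth _ (w 0%N)); first by rewrite size_takel.
    move=> i; rewrite size_takel // => lt_i; rewrite nth_take //.
    have := eq_i i; rewrite /wcat (set_nth_default (w 0%N)) // => ->.
    by rewrite (set_nth_default (w 0%N)) // (leq_trans lt_i).
  by rewrite -[in LHS](cat_take_drop (size a) a') eq_take.
apply/funext => i; have := eq_i (size a + i)%N.
rewrite /wcat nth_default ?leq_addr // addKn => ->.
by rewrite nth_drop size_drop subnBA // addnC.
Qed.

Let base_nested (a b a' b' : seq 'I_n) g : (size a <= size a')%N ->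
  basic_open a b g -> basic_open a' b' g ->
  basic_open a' b' `<=` basic_open a b.
Proof.
move=> le_a [w gE] [w' gE']; move: (gE'); rewrite gE => -[ea ek eb].
have ek' : (size a + size b' = size a' + size b)%N by lia.
have le_b : (size b <= size b')%N by lia.
have [a'E wE] := wcat_take le_a ea; have [b'E wE'] := wcat_take le_b eb.
set d := drop _ a' in a'E wE; set d' := drop _ b' in b'E wE'.
have size_d : size d = size d' by rewrite !size_drop; lia.
have dd' : d = d'.
  have [e _] := wcat_take (eq_leq size_d) (etrans (esym wE) wE').
  by rewrite e size_d drop_size cats0.
have catA u v z : wcat (u ++ v) z = wcat u (wcat v z).
  apply/funext => i; rewrite /wcat nth_cat size_cat.
  case: ltnP => [lt_i|le_i]; first exact: set_nth_default.
  by rewrite [RHS]nth_default // subnDA.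
move=> h [z hE]; exists (wcat d z).
by rewrite hE a'E b'E -dd' /arrow_of !catA !size_cat !PoszD; congr (_, _, _); lia.
Qed.

Let base_join (U V : set cuntz_groupoid) g : base U -> base V -> U g -> V g ->
  exists W, [/\ base W, W g & W `<=` U `&` V].
Proof.
move=> [a [b ->]] [a' [b' ->]] Ug Vg.
have [le_a|/ltnW le_a] := leqP (size a) (size a').
- exists (basic_open a' b'); split=> //; first by exists a', b'.
  by rewrite subsetI; split=> //; apply: base_nested le_a Ug Vg.
- exists (basic_open a b); split=> //; first by exists a, b.
  by rewrite subsetI; split=> //; apply: base_nested le_a Vg Ug.
Qed.

HB.instance Definition _ :=
  @isBaseTopological.Build cuntz_groupoid (set cuntz_groupoid) base id
    base_cover base_join.

Definition unit_space : set cuntz_groupoid :=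
  [set g | gdegree g = 0 /\ grange g = gsource g].

End CuntzGroupoid.

Section GroupoidCStarAlgebra.
Variables (R : realType) (n : nat).
Local Notation C := (Cplx R).
Local Notation G := (cuntz_groupoid n).

Definition Cc : set (G -> C) :=
  [set f | continuous f /\ compact (closure [set g | f g != 0])].

(* On C_c(G_n) the sum has finite support. *)
Definition convolution (f1 f2 : G -> C) : G -> C :=
  fun g => \sum_(p \in factorizations g) (f1 p.1 * f2 p.2).

Definition involution (f : G -> C) : G -> C := fun g => (f (ginv g))^*.

Definition is_inner_product (H : normedModType C)
    (ip : {dot H for (@Num.conj C)}) :=
  forall x : H, ip x x = `|x| ^+ 2.

(* *-representations of C_c(G_n) by bounded operators on the Hilbert space
   (H, ip); [pi] is only meaningful on C_c(G_n). *)
Definition star_representation (H : completeNormedModType C)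
    (ip : {dot H for (@Num.conj C)}) (pi : (G -> C) -> H -> H) :=
  [/\ forall f, Cc f -> linear (pi f) /\ continuous (pi f),
      forall (c : C) f1 f2, Cc f1 -> Cc f2 ->
        forall x, pi (c *: f1 + f2) x = c *: pi f1 x + pi f2 x,
      forall f1 f2, Cc f1 -> Cc f2 ->
        forall x, pi (convolution f1 f2) x = pi f1 (pi f2 x)
    & forall f, Cc f -> forall x y, ip (pi f x) y = ip x (pi (involution f) y)].

Definition operator_norm (H : normedModType C) (T : H -> H) : \bar R :=
  ereal_sup [set (rnorm (T x))%:E | x in [set x : H | rnorm x <= 1]].

(* The full groupoid C*-norm.  Boundedness with respect to the I-norm need not be
   imposed on the representations: it is automatic since the bisections
   U_{alpha,beta} form a basis of compact open sets. *)
Definition groupoid_norm (f : G -> C) : \bar R :=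
  ereal_sup [set r | exists (H : completeNormedModType C)
    (ip : {dot H for (@Num.conj C)}) (pi : (G -> C) -> H -> H),
    [/\ is_inner_product ip, star_representation ip pi
      & r = operator_norm (pi f)]].

(* [iota] exhibits the C*-algebra [A] as the completion of C_c(G_n) in the
   groupoid C*-norm; [iota] is only meaningful on C_c(G_n). *)
Definition is_groupoid_cstar_algebra (A : cstarAlgType C)
    (iota : (G -> C) -> A) :=
  [/\ forall (c : C) f1 f2, Cc f1 -> Cc f2 ->
        iota (c *: f1 + f2) = c *: iota f1 + iota f2,
      forall f1 f2, Cc f1 -> Cc f2 ->
        iota (convolution f1 f2) = iota f1 ** iota f2,
      forall f, Cc f -> iota (involution f) = star (iota f),
      forall f, Cc f -> (rnorm (iota f))%:E = groupoid_norm f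
    & dense (iota @` Cc)].

Section Bimodules.
Variables (A : cstarAlgType C) (iota : (G -> C) -> A).

(* The value at g of an element a of C*(G_n), seen as a function on G_n: the
   common limit of f_j(g) over all sequences (f_j) of C_c(G_n) converging to a
   in norm. It exists because the groupoid C*-norm dominates the sup norm. *)
Definition value (a : A) (g : G) : C :=
  xget 0 [set c : C | forall f : nat -> (G -> C), (forall j, Cc (f j)) ->
    (fun j => iota (f j)) @ \oo --> a -> (fun j => f j g) @ \oo --> c].

Definition A_ (P : set G) : set A :=
  [set a | forall g, ~ P g -> value a g = 0].

Definition diagonal : set A := A_ (@unit_space n).

Definition is_bimodule (B : set A) :=
  [/\ B 0, forall x y, B x -> B y -> B (x + y),
      forall (c : C) x, B x -> B (c *: x),
      forall a x, diagonal a -> B x -> B (a ** x)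
    & forall a x, diagonal a -> B x -> B (x ** a)].

Definition is_closed_bimodule (B : set A) := closed B /\ is_bimodule B.

Definition sigma (B : set A) : set G :=
  [set g | exists2 a, B a & value a g != 0].

Definition reflexive_bimodule (B : set A) := B = A_ (sigma B).

(* S_i corresponds to the characteristic function of U_{i,empty}. *)
Definition S_gen (i : 'I_n) : A := iota (\1_(basic_open [:: i] [::])).
Definition S_word (a : seq 'I_n) : A := \big[cmul/cunit]_(i <- a) S_gen i.

Definition cuntz_partial_isometries : set A :=
  [set x | exists a b, x = S_word a ** star (S_word b)].

Definition generated_by_cuntz_partial_isometries (B : set A) :=
  B = smallest is_closed_bimodule (B `&` cuntz_partial_isometries).

Definition star_automorphism (phi : A -> A) :=
  [/\ linear phi, {morph phi : x y / x ** y}, phi cunit = cunit,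
      {morph phi : x / star x} & bijective phi].

(* eta_lambda is the unique *-automorphism with S_i |-> lambda S_i; for
   |lambda| <> 1 there is none and the value is junk. *)
Definition gauge (lambda : C) : A -> A :=
  @xget (A -> A) idfun [set phi : A -> A | star_automorphism phi /\
    forall i, phi (S_gen i) = lambda *: S_gen i].

Definition gauge_invariant (B : set A) :=
  forall lambda : C, `|lambda| = 1 -> forall x, B x -> B (gauge lambda x).

End Bimodules.
End GroupoidCStarAlgebra.

(* Main.v *)
Require Import Defs.
From HB Require Import structures.
From mathcomp Require Import all_boot all_order all_algebra.
From mathcomp Require Import cyclic separable cyclotomic.
From mathcomp Require Import complex zify ring lra finmap.
From mathcomp Require Import all_classical all_reals all_analysis.

Set Implicit Arguments.
Unset Strict Implicit.
Unset Printing Implicit Defensive.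

Import Order.TTheory GRing.Theory Num.Theory.
Import numFieldNormedType.Exports.

Local Open Scope classical_set_scope.
Local Open Scope ring_scope.

(** Elements of the algebra are handled through functions on the groupoid G.
    Evaluation at an arrow is bounded by the C*-norm, because f g is a matrix
    coefficient of the regular representation on l2 ([le_groupoid_norm],
    [value_le]). In the other direction, on functions carried by one bisection
    U_(a,b) the C*-norm is at most the sup norm ([iota_glift_le]). The partial
    isometry S_a S_b^* is the indicator function [chi a b] of U_(a,b).

    Two facts carry the equivalence.

    Spectral synthesis ([synthesis]): every element x of the algebra belongs to
    the closed linear span of those [chi a b] for which x vanishes nowhere on
    U_(a,b). Indeed the Fejer means of x for the gauge action converge to x, and
    they are combinations of homogeneous parts of x; these are limits of finite
    sums of restrictions of x to bisections; and on one bisection x is a uniform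
    limit of locally constant functions supported where x is large.

    Localization: a closed bimodule B that is invariant under the gauge action
    contains [chi a b] as soon as U_(a,b) lies in sigma B ([chi_mem]). The
    pointwise multiplications that preserve B include the functions of the range
    and of the source (bimodule action) and z ^ degree (gauge action), hence, by
    averages over roots of unity, products and limits, the indicator functions
    of all bisections ([preserves_basic]). So B contains the restriction of each
    of its elements f to any U_(a,b). Near an arrow where f does not vanish,
    such a restriction is close to a multiple k of [chi a b], and a Neumann
    series with coefficients in the diagonal algebra recovers [chi a b] from it
    ([near_chi_mem]). Koenig's lemma passes from small bisections to U_(a,b).

    If B = A(sigma B), synthesis expresses each element of B through partial
    isometries that B contains. If B is generated by partial isometries, it is
    gauge-invariant, because a gauge automorphism multiplies each partial
    isometry by a scalar and preserves the diagonal algebra. If B is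
    gauge-invariant, synthesis and localization together give A(sigma B) inside
    B; the other inclusion is immediate.

    The gauge automorphism is specified by its values on the generators. It is
    identified with the extension of multiplication by z ^ degree ([gaugeE]):
    the latter is an automorphism with these values, and there is only one,
    since *-homomorphisms are contractive ([star_hom_contractive]) and the
    partial isometries span a dense subspace. *)

(** * Real-valued norms *)

Section RealNorms.
Variable R : realType.
Local Notation C := (Cplx R).

(** The embedding of R into C. Norms are read in R through [nrm] and [rnorm],
    because the order of C is only partial. *)
Definition rc (x : R) : C := real_complex R x.
Definition nrm (z : C) : R := complex.Re `|z|.

Lemma rcD x y : rc (x + y) = rc x + rc y. Proof. exact: (rmorphD (real_complex R)). Qed.
Lemma rcB x y : rc (x - y) = rc x - rc y. Proof. exact: (rmorphB (real_complex R)). Qed.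
Lemma rcM x y : rc (x * y) = rc x * rc y. Proof. exact: (rmorphM (real_complex R)). Qed.
Lemma rcX x k : rc (x ^+ k) = rc x ^+ k. Proof. exact: (rmorphXn (real_complex R)). Qed.
Lemma rc0 : rc 0 = 0. Proof. by []. Qed.
Lemma rc_nat k : rc k%:R = k%:R. Proof. exact: (rmorph_nat (real_complex R) k). Qed.
Lemma rcV x : rc x^-1 = (rc x)^-1. Proof. exact: (fmorphV (real_complex R) x). Qed.
Lemma rc_inj : injective rc. Proof. by move=> x y []. Qed.
Lemma rc_le x y : (rc x <= rc y) = (x <= y). Proof. exact: lecR. Qed.
Lemma rc_lt x y : (rc x < rc y) = (x < y). Proof. exact: ltcR. Qed.
Lemma rc_Re (z : C) : 0 <= z -> z = rc (complex.Re z).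
Proof. by case: z => a b; rewrite lecE /= => /andP[/eqP -> _]. Qed.

(** A positive complex number is real: this turns the epsilons of the complex
    norms into real ones. *)
Lemma rc_gt0P (e : C) : 0 < e -> exists2 d : R, 0 < d & e = rc d.
Proof.
move=> e0; exists (complex.Re e); last exact/rc_Re/ltW.
by rewrite -rc_lt -rc_Re // ltW.
Qed.

Lemma nrmE (z : C) : `|z| = rc (nrm z). Proof. exact/rc_Re/normr_ge0. Qed.
Lemma nrm_ge0 z : 0 <= nrm z. Proof. by rewrite -rc_le rc0 -nrmE normr_ge0. Qed.
Lemma nrmD y z : nrm (y + z) <= nrm y + nrm z.
Proof. by rewrite -rc_le rcD -!nrmE ler_normD. Qed.
Lemma nrmM y z : nrm (y * z) = nrm y * nrm z.
Proof. by apply: rc_inj; rewrite rcM -!nrmE normrM. Qed.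
Lemma nrmN z : nrm (- z) = nrm z.
Proof. by apply: rc_inj; rewrite -!nrmE normrN. Qed.
Lemma nrm0 : nrm 0 = 0. Proof. by apply: rc_inj; rewrite -!nrmE normr0. Qed.
Lemma nrm1 : nrm 1 = 1. Proof. by apply: rc_inj; rewrite -!nrmE normr1. Qed.
Lemma nrm_eq0 z : (nrm z == 0) = (z == 0).
Proof. by rewrite -(inj_eq rc_inj) -nrmE rc0 normr_eq0. Qed.
Lemma nrmV z : nrm z^-1 = (nrm z)^-1.
Proof. by apply: rc_inj; rewrite rcV -!nrmE normfV. Qed.
Lemma nrm_conj z : nrm z^* = nrm z.
Proof. by apply: rc_inj; rewrite -!nrmE norm_conjC. Qed.
Lemma nrm_rc x : nrm (rc x) = `|x|.
Proof. by rewrite /nrm (normc_def (real_complex R x)) /= expr0n addr0 sqrtr_sqr. Qed.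
Lemma nrm_sqE (z : C) : nrm z ^+ 2 = complex.Re z ^+ 2 + complex.Im z ^+ 2.
Proof. by apply: rc_inj; rewrite rcX -nrmE; symmetry; exact: add_Re2_Im2. Qed.
Lemma mul_conj z : z * z^* = rc (nrm z ^+ 2).
Proof. by rewrite -normCK nrmE rcX. Qed.
Lemma rc_conj x : (rc x)^* = rc x.
Proof. exact: conjc_real. Qed.
Lemma nrm_dist y z : nrm (y - z) = nrm (z - y).
Proof. by rewrite -nrmN opprB. Qed.
Lemma nrm_tri z x y : nrm (x - y) <= nrm (x - z) + nrm (z - y).
Proof. by apply: le_trans (nrmD _ _); rewrite subrKA. Qed.

Section Normed.
Variable V : normedModType C.
Implicit Types x y z : V.

Lemma rnormE x : `|x| = rc (rnorm x). Proof. exact/rc_Re/normr_ge0. Qed.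
Lemma rnorm_ge0 x : 0 <= rnorm x. Proof. by rewrite -rc_le rc0 -rnormE normr_ge0. Qed.
Lemma rnormD x y : rnorm (x + y) <= rnorm x + rnorm y.
Proof. by rewrite -rc_le rcD -!rnormE ler_normD. Qed.
Lemma rnormZ c x : rnorm (c *: x) = nrm c * rnorm x.
Proof. by apply: rc_inj; rewrite rcM -nrmE -!rnormE normrZ. Qed.
Lemma rnormN x : rnorm (- x) = rnorm x.
Proof. by apply: rc_inj; rewrite -!rnormE normrN. Qed.
Lemma rnorm0 : rnorm (0 : V) = 0.
Proof. by apply: rc_inj; rewrite -!rnormE normr0. Qed.
Lemma rnorm0_eq0 x : rnorm x = 0 -> x = 0.
Proof. by move=> x0; apply/normr0_eq0; rewrite rnormE x0. Qed.
Lemma rnorm_dist x y : rnorm (x - y) = rnorm (y - x).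
Proof. by rewrite -rnormN opprB. Qed.
Lemma rnorm_tri z x y : rnorm (x - y) <= rnorm (x - z) + rnorm (z - y).
Proof. by apply: le_trans (rnormD _ _); rewrite subrKA. Qed.
Lemma rnorm_sum (I : Type) (r : seq I) (F : I -> V) :
  rnorm (\sum_(i <- r) F i) <= \sum_(i <- r) rnorm (F i).
Proof.
elim/big_rec2: _ => [|i y x _ le_xy]; first by rewrite rnorm0.
by apply: le_trans (rnormD _ _) _; rewrite lerD2l.
Qed.

(** The form in which equalities are obtained by approximation: the error is a
    fixed multiple of an arbitrary e. *)
Lemma eq_le_dist x y (K : R) :
  (forall e, 0 < e -> rnorm (x - y) <= K * e) -> x = y.
Proof.
move=> H; apply/eqP; rewrite -subr_eq0; apply/eqP/rnorm0_eq0/eqP.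
rewrite eq_le rnorm_ge0 andbT leNgt; apply/negP => d0.
have K1 : 0 < `|K| + 1 by rewrite ltr_wpDl.
have := H _ (divr_gt0 (divr_gt0 d0 K1) (ltr0n _ 2)).
apply/negP; rewrite -ltNge; set d := rnorm _ in d0 *.
have : K * (d / (`|K| + 1) / 2) <= (`|K| + 1) * (d / (`|K| + 1) / 2).
  by apply: ler_wpM2r; [rewrite !divr_ge0 ?ltW | rewrite (le_trans (ler_norm _)) ?lerDl].
move/le_lt_trans; apply; rewrite mulrA mulrCA divff ?gt_eqF //; lra.
Qed.

Lemma cvg_rnormP (T : Type) (F : set_system T) {FF : Filter F} (f : T -> V) l :
  f @ F --> l <-> forall e : R, 0 < e -> \forall t \near F, rnorm (l - f t) < e.
Proof.
split=> [/cvgrPdist_lt cf e e0|H].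
  have := cf (rc e); rewrite -[0]/(rc 0) rc_lt => /(_ e0).
  by apply: filterS => t; rewrite rnormE rc_lt.
apply/cvgrPdist_lt => e /rc_gt0P[d d0 ->].
by apply: filterS (H d d0) => t; rewrite rnormE rc_lt.
Qed.

Lemma cvg_seq_rnormP (u : nat -> V) l :
  u @ \oo --> l <-> forall e : R, 0 < e -> exists N, forall k, (N <= k)%N -> rnorm (l - u k) < e.
Proof.
split=> [/cvg_rnormP H e /H [N _ HN]|H]; first by exists N => k /HN.
by apply/cvg_rnormP => e /H [N HN]; exists N => // k; exact: HN.
Qed.

Lemma closed_rnormP (B : set V) : closed B <->
  forall x, (forall e : R, 0 < e -> exists2 y, B y & rnorm (x - y) < e) -> B x.
Proof.
split=> [cB x H|H x clx].
  rewrite ((closure_id B).1 cB) => P /nbhs_ballP[e /rc_gt0P[d d0 ->] Pe].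
  have [y By xy] := H d d0; exists y; split=> //; apply: Pe.
  by rewrite -ball_normE /= rnormE rc_lt.
apply: H => e e0.
have [|y [By yx]] := clx (ball x (rc e)).
  by apply: nbhsx_ballx; rewrite -[0]/(rc 0) rc_lt.
by exists y => //; move: yx; rewrite -ball_normE /= rnormE rc_lt.
Qed.

Lemma dense_rnormP (B : set V) : dense B ->
  forall x (e : R), 0 < e -> exists2 y, B y & rnorm (x - y) < e.
Proof.
move=> dB x e e0.
have e0' : 0 < rc e by rewrite -[0]/(rc 0) rc_lt.
have [||y [xy By]] := dB (ball x (rc e)).
- by exists x; apply: ballxx.
- exact: ball_open.
by exists y => //; move: xy; rewrite -ball_normE /= rnormE rc_lt.
Qed.

End Normed.

Lemma cvg_nrmP (T : Type) (F : set_system T) {FF : Filter F} (f : T -> C) (l : C) :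
  f @ F --> l <-> forall e : R, 0 < e -> \forall t \near F, nrm (l - f t) < e.
Proof. exact: (@cvg_rnormP C^o). Qed.

Lemma cvg_seq_nrmP (u : nat -> C) (l : C) :
  u @ \oo --> l <-> forall e : R, 0 < e -> exists N, forall k, (N <= k)%N -> nrm (l - u k) < e.
Proof. exact: (@cvg_seq_rnormP C^o). Qed.

Lemma eq_le_nrm (x y : C) (K : R) :
  (forall e, 0 < e -> nrm (x - y) <= K * e) -> x = y.
Proof. exact: (@eq_le_dist C^o). Qed.

Lemma nrm_sum (I : Type) (r : seq I) (F : I -> C) :
  nrm (\sum_(i <- r) F i) <= \sum_(i <- r) nrm (F i).
Proof. exact: (@rnorm_sum C^o). Qed.

End RealNorms.

(** * Infinite words, arrows and bisections *)

Section Words.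
Variable n : nat.
Implicit Types (a b c d : seq 'I_n) (w x y : infinite_word n) (k p q : nat).
Local Notation X := (infinite_word n).
Local Notation G := (cuntz_groupoid n).

Definition wshift k x : X := fun i => x (k + i)%N.
Definition wtake k x : seq 'I_n := mkseq x k.

Lemma size_wtake k x : size (wtake k x) = k. Proof. exact: size_mkseq. Qed.

Lemma nth_wtake k x (l : 'I_n) i : (i < k)%N -> nth l (wtake k x) i = x i.
Proof. by move=> ik; rewrite nth_mkseq. Qed.

Lemma wcat_nil w : wcat [::] w = w.
Proof. by apply/funext => i; rewrite /wcat nth_nil subn0. Qed.

Lemma wcat_cat a b w : wcat (a ++ b) w = wcat a (wcat b w).
Proof.
apply/funext => i; rewrite /wcat nth_cat size_cat.
case: ltnP => [lt_i|le_i]; first exact: set_nth_default.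
by rewrite [RHS]nth_default // subnDA.
Qed.

Lemma wshift0 x : wshift 0 x = x. Proof. by []. Qed.

Lemma wshift_add p q x : wshift p (wshift q x) = wshift (q + p) x.
Proof. by apply/funext => i; rewrite /wshift addnA. Qed.

Lemma wshift_wcat a w : wshift (size a) (wcat a w) = w.
Proof. by apply/funext => i; rewrite /wshift /wcat nth_default ?leq_addr // addKn. Qed.

Lemma wtake_wcat a w : wtake (size a) (wcat a w) = a.
Proof.
apply: (@eq_from_nth _ (w 0%N)); first by rewrite size_wtake.
move=> i; rewrite size_wtake => lt_i; rewrite nth_wtake // /wcat.
exact: set_nth_default.
Qed.

Lemma wcat_wtake k x : wcat (wtake k x) (wshift k x) = x.
Proof.
apply/funext => i; rewrite /wcat; have [lt_i|le_i] := ltnP i k.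
  by rewrite nth_wtake.
by rewrite nth_default ?size_wtake // /wshift subnKC.
Qed.

Lemma wcat_eqP a x : wtake (size a) x = a -> x = wcat a (wshift (size a) x).
Proof. by move=> e; rewrite -[in RHS]e size_wtake wcat_wtake. Qed.

Lemma wcat_inj a : injective (wcat a).
Proof. by move=> w w' e; rewrite -(wshift_wcat a w) e wshift_wcat. Qed.

Lemma wtake_add p q x : wtake (p + q) x = wtake p x ++ wtake q (wshift p x).
Proof.
rewrite /wtake /mkseq iotaD map_cat add0n; congr (_ ++ _).
by rewrite -[p in iota p]addn0 iotaDl -map_comp.
Qed.

Lemma wtakeS k x : wtake k.+1 x = rcons (wtake k x) (x k).
Proof. by rewrite -addn1 wtake_add cats1 /wshift addn0. Qed.

Lemma wtake_le p q x y : (p <= q)%N -> wtake q x = wtake q y -> wtake p x = wtake p y.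
Proof.
move=> le_pq e; have:= congr1 (take p) e.
by rewrite -(subnKC le_pq) !wtake_add !take_size_cat ?size_wtake.
Qed.

Lemma wtakeP k x y : wtake k x = wtake k y <-> (forall i, (i < k)%N -> x i = y i).
Proof.
split=> [e i ik|H]; first by rewrite -(nth_wtake x (x 0%N) ik) e nth_wtake.
apply: (@eq_from_nth _ (x 0%N)); rewrite !size_wtake // => i ik.
by rewrite !nth_wtake ?H.
Qed.

(** Koenig's lemma in contrapositive form: a word where Q fails has a successor
    where Q fails, and following such successors from a gives an infinite word
    that Q never meets. The compactness of the word space is always used in this
    form below. *)
Lemma bar_induction (Q : seq 'I_n -> Prop) a :
  (forall b, (forall i, Q (rcons b i)) -> Q b) ->
  (forall w, exists k, Q (a ++ wtake k w)) -> Q a.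
Proof.
move=> Qstep Qbar; apply: contrapT => nQa.
have ex b : exists i, ~ Q b -> ~ Q (rcons b i).
  have [Qb|nQb] := pselect (Q b).
    have [i _] : exists i : 'I_n, True.
      apply: contrapT => nI; apply: nQa; apply: Qstep => i.
      by exfalso; apply: nI; exists i.
    by exists i.
  apply: contrapT => nex; apply: nQb; apply: Qstep => i.
  by apply: contrapT => nQi; apply: nex; exists i.
have [f Hf] := choice ex.
pose s := fix s k := if k is j.+1 then rcons (s j) (f (s j)) else a.
have nQs k : ~ Q (s k) by elim: k => //= k; exact: Hf.
pose w : X := fun k => f (s k).
have sE k : s k = a ++ wtake k w.
  by elim: k => [|k IH]; rewrite ?cats0 //= wtakeS -rcons_cat -IH.
by have [k] := Qbar w; rewrite -sE; exact: nQs.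
Qed.

(** Arrows are pairs of words with a common tail, k being the difference between
    the positions where the tail starts. *)
Lemma cuntz_arrowsP x (k : int) y : cuntz_arrows (x, k, y) <->
  exists p q, k = p%:Z - q%:Z /\ wshift p x = wshift q y.
Proof.
split=> [[a [b [w [-> -> ->]]]]|[p [q [-> e]]]].
  by exists (size a), (size b); rewrite !wshift_wcat.
exists (wtake p x), (wtake q y), (wshift p x).
by rewrite /arrow_of !size_wtake wcat_wtake e wcat_wtake.
Qed.

Lemma arr_subproof a b w : arrow_of a b w \in @cuntz_arrows n.
Proof. by apply/mem_set; exists a, b, w. Qed.

Definition arr a b w : G := exist (fun t => t \in @cuntz_arrows n) _ (arr_subproof a b w).

Lemma grange_arr a b w : grange (arr a b w) = wcat a w. Proof. by []. Qed.
Lemma gsource_arr a b w : gsource (arr a b w) = wcat b w. Proof. by []. Qed.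
Lemma gdegree_arr a b w : gdegree (arr a b w) = (size a)%:Z - (size b)%:Z. Proof. by []. Qed.

Lemma arrow_eq (g h : G) : grange g = grange h -> gdegree g = gdegree h ->
  gsource g = gsource h -> g = h.
Proof.
rewrite /grange /gdegree /gsource => e1 e2 e3; apply: val_inj.
by case: (val g) (val h) e1 e2 e3 => [[? ?] ?] [[? ?] ?] /= -> -> ->.
Qed.

Lemma arr_ex (g : G) : exists a b w, g = arr a b w.
Proof.
have [a [b [w e]]] := set_mem (valP g).
by exists a, b, w; apply: val_inj.
Qed.

Lemma basic_openP a b (g : G) : basic_open a b g <-> exists w, g = arr a b w.
Proof.
split=> [[w e]|[w ->]]; exists w => //; exact: val_inj.
Qed.

Lemma basic_open_arr a b w : basic_open a b (arr a b w). Proof. by exists w. Qed.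

Lemma arr_cat a b c w : arr (a ++ c) (b ++ c) w = arr a b (wcat c w).
Proof.
apply: arrow_eq; rewrite ?grange_arr ?gsource_arr ?gdegree_arr ?wcat_cat //.
by rewrite !size_cat; lia.
Qed.

Lemma basic_open_cat a b c : @basic_open n (a ++ c) (b ++ c) `<=` basic_open a b.
Proof. by move=> g /basic_openP[w ->]; rewrite arr_cat; exact: basic_open_arr. Qed.

Lemma basic_open_rangeP a b (g : G) : basic_open a b g <->
  [/\ wtake (size a) (grange g) = a, wtake (size b) (gsource g) = b,
      wshift (size a) (grange g) = wshift (size b) (gsource g)
    & gdegree g = (size a)%:Z - (size b)%:Z].
Proof.
split=> [/basic_openP[w ->]|[ea eb ew ed]].
  by rewrite grange_arr gsource_arr gdegree_arr !wtake_wcat !wshift_wcat.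
apply/basic_openP; exists (wshift (size a) (grange g)); apply: arrow_eq => //.
  by rewrite grange_arr; exact: wcat_eqP.
by rewrite gsource_arr ew; exact: wcat_eqP.
Qed.

Lemma arr_inj a b : injective (arr a b).
Proof. by move=> w w' /(congr1 (@grange n)); exact: wcat_inj. Qed.

(** Bisections that meet are nested: the words of the shared arrow determine how
    the longer prefixes extend the shorter ones. *)
Lemma basic_open_deep a b c d w : (size c <= size a)%N ->
  basic_open c d (arr a b w) -> basic_open a b `<=` @basic_open n c d.
Proof.
move=> sa /basic_openP[u e].
have eR := congr1 (@grange n) e; have eS := congr1 (@gsource n) e.
have eD := congr1 (@gdegree n) e.
rewrite !grange_arr in eR; rewrite !gsource_arr in eS; rewrite !gdegree_arr in eD.
have sb : (size d <= size b)%N by lia.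
have ae : a = c ++ wtake (size a - size c) u.
  rewrite -{1}(wtake_wcat a w) eR -{1}(subnKC sa) wtake_add wtake_wcat.
  by rewrite wshift_wcat.
have be : b = d ++ wtake (size b - size d) u.
  rewrite -{1}(wtake_wcat b w) eS -{1}(subnKC sb) wtake_add wtake_wcat.
  by rewrite wshift_wcat.
rewrite ae be (_ : size b - size d = size a - size c)%N; last by lia.
exact: basic_open_cat.
Qed.

Lemma arr_deepen a b k w :
  arr a b w = arr (a ++ wtake k w) (b ++ wtake k w) (wshift k w).
Proof. by rewrite arr_cat wcat_wtake. Qed.

Lemma basic_open_nested a b c d w : basic_open c d (arr a b w) ->
  let e := wtake (size c) w in basic_open (a ++ e) (b ++ e) `<=` @basic_open n c d.
Proof.
rewrite (arr_deepen a b (size c)) => U e; apply: basic_open_deep U.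
by rewrite size_cat size_wtake leq_addl.
Qed.

(** The neighbourhoods of w in the product topology. Each bisection is a copy of
    the word space under [arr a b], and [nbhs_arr] transports this filter to G. *)
Definition cyl w : set_system X :=
  [set P | exists k, forall y, wtake k y = wtake k w -> P y].

Global Instance cyl_filter w : ProperFilter (cyl w).
Proof.
split; first by move=> [k] /(_ w erefl).
split; first by exists 0%N.
  move=> P Q [p HP] [q HQ]; exists (maxn p q) => y e; split.
    by apply: HP; apply: wtake_le e; rewrite leq_maxl.
  by apply: HQ; apply: wtake_le e; rewrite leq_maxr.
by move=> P Q PQ [k HP]; exists k => y /HP /PQ.
Qed.

Lemma basic_open_open a b : open (@basic_open n a b).
Proof.
exists [set basic_open a b]; first by move=> _ ->; exists a, b.
by rewrite bigcup_set1.
Qed.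

Lemma nbhs_arr a b w (P : set G) :
  nbhs (arr a b w) P <-> cyl w (fun y => P (arr a b y)).
Proof.
split=> [|[k HP]].
  rewrite nbhsE => -[U [[D sD UE] Uw] UP].
  move: Uw; rewrite -UE => -[V DV Vw]; have [c [d Vcd]] := sD _ DV.
  rewrite Vcd in Vw; exists (size c) => y ey.
  apply: UP; rewrite -UE; exists V => //; rewrite Vcd.
  apply: (basic_open_nested Vw); rewrite -ey (arr_deepen _ _ (size c)).
  exact: basic_open_arr.
rewrite nbhsE; exists (basic_open (a ++ wtake k w) (b ++ wtake k w)).
  split; first exact: basic_open_open.
  by apply/basic_openP; exists (wshift k w); rewrite arr_cat wcat_wtake.
move=> _ /basic_openP[u ->]; rewrite arr_cat; apply: HP.
by rewrite -[X in wtake X _](size_wtake k w) wtake_wcat.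
Qed.

Lemma cyl_wcat a w : wcat a @ cyl w --> cyl (wcat a w).
Proof.
move=> P [k HP]; exists k => y e; apply: HP.
apply: (@wtake_le _ (size a + k)); rewrite ?leq_addl //.
by rewrite !wtake_add !wtake_wcat !wshift_wcat e.
Qed.

End Words.

(** * Continuity and compact support on the groupoid *)

Section Continuity.
Variables (R : realType) (n : nat).
Local Notation C := (Cplx R).
Local Notation X := (infinite_word n).
Local Notation G := (cuntz_groupoid n).
Implicit Types (a b c d : seq 'I_n) (F : X -> C) (f : G -> C).

Definition ccont F := forall w, F @ cyl w --> F w.

Lemma continuous_arrP f : continuous f <-> forall a b, ccont (fun w => f (arr a b w)).
Proof.
split=> [cf a b w P /cf /nbhs_arr //|cf g P].
by have [a [b [w ->]]] := arr_ex g => /cf ?; apply/nbhs_arr.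
Qed.

Lemma ccont_cst (z : C) : ccont (fun=> z).
Proof. by move=> w; exact: cvg_cst. Qed.

Lemma ccontM F F' : ccont F -> ccont F' -> ccont (fun w => F w * F' w).
Proof. by move=> cF cF' w; apply: cvgM; [exact: cF | exact: cF']. Qed.

Lemma ccontD F F' : ccont F -> ccont F' -> ccont (fun w => F w + F' w).
Proof. by move=> cF cF' w; apply: cvgD; [exact: cF | exact: cF']. Qed.

Lemma ccont_wcat a F : ccont F -> ccont (fun w => F (wcat a w)).
Proof. by move=> cF w; apply: cvg_comp (@cyl_wcat _ a w) (cF _). Qed.

Lemma ccontP F : ccont F <-> forall w (e : R), 0 < e ->
  exists k, forall y, wtake k y = wtake k w -> nrm (F w - F y) < e.
Proof.
split=> [cF w e e0|cF w]; first by have /cvg_nrmP /(_ e e0) := cF w.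
by apply/cvg_nrmP => e e0; have [k Hk] := cF w e e0; exists k.
Qed.

Lemma ccont_finite k F : (forall x y, wtake k x = wtake k y -> F x = F y) -> ccont F.
Proof.
move=> HF; apply/ccontP => w e e0; exists k => y /HF ->.
by rewrite subrr nrm0.
Qed.

(** Uniform continuity: a prefix has a modulus when all its successors have one,
    as there are finitely many letters, and every word has a prefix on which F
    varies by less than e. *)
Lemma ccont_unif F (e : R) : ccont F -> 0 < e ->
  exists k, forall x y, wtake k x = wtake k y -> nrm (F x - F y) < e.
Proof.
move=> /ccontP cF e0.
pose Q (a : seq 'I_n) := exists k, forall x y, wtake (size a) x = a ->
  wtake (size a) y = a -> wtake k x = wtake k y -> nrm (F x - F y) < e.
suff [k Hk] : Q [::] by exists k => x y; exact: Hk.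
apply: bar_induction => [b Hb|w].
  have [K HK] := choice Hb.
  exists (maxn (size b).+1 (\max_i K i)) => x y xb yb e1.
  have eS := wtake_le (leq_maxl _ _) e1.
  have [ex ey] : wtake (size b).+1 x = rcons b (x (size b)) /\
                 wtake (size b).+1 y = rcons b (x (size b)).
    by rewrite -eS wtakeS xb.
  apply: (HK (x (size b))); rewrite ?size_rcons //.
  by apply: wtake_le e1; rewrite leq_max leq_bigmax orbT.
have e20 : 0 < e / 2 by rewrite divr_gt0.
have [k Hk] := cF w _ e20; exists k; rewrite /Q size_wtake; exists 0%N => x y ex ey _.
have := nrm_tri (F w) (F x) (F y); have := Hk _ ex; have := Hk _ ey.
by rewrite (nrm_dist (F x) (F w)); lra.
Qed.

Lemma ccont_bounded F : ccont F -> exists2 M : R, 0 <= M & forall w, nrm (F w) <= M.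
Proof.
move=> cF.
have [[z _]|nX] := pselect (exists z : X, True); last first.
  by exists 0 => // w; exfalso; apply: nX; exists w.
have [k Hk] := ccont_unif cF (@ltr01 R).
exists (1 + \sum_(t : k.-tuple 'I_n) nrm (F (wcat t z))).
  by rewrite addr_ge0 // sumr_ge0 // => t _; exact: nrm_ge0.
move=> w; have st : size (wtake k w) == k by rewrite size_wtake.
have lt1 : nrm (F w - F (wcat (Tuple st) z)) < 1.
  by apply: Hk => /=; rewrite -[X in _ = wtake X _](size_wtake k w) wtake_wcat.
apply: (@le_trans _ _ (1 + nrm (F (wcat (Tuple st) z)))).
  have := nrmD (F w - F (wcat (Tuple st) z)) (F (wcat (Tuple st) z)).
  by rewrite subrK; lra.
rewrite lerD2l (bigD1 (Tuple st)) //= lerDl sumr_ge0 // => t _.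
exact: nrm_ge0.
Qed.

(** The function on U_(a,b) that corresponds to F under [arr a b], that is, the
    element S_a F S_b^*. Such functions span C_c(G) ([Cc_ind]), and convolution
    and involution act on them by simple formulas. *)
Definition glift a b F : G -> C :=
  fun g => if `[< basic_open a b g >] then F (wshift (size a) (grange g)) else 0.

Lemma glift_arr a b F w : glift a b F (arr a b w) = F w.
Proof. by rewrite /glift asboolT ?grange_arr ?wshift_wcat //; exact: basic_open_arr. Qed.

Lemma glift_out a b F g : ~ basic_open a b g -> glift a b F g = 0.
Proof. by move=> nU; rewrite /glift asboolF. Qed.

Lemma glift_supp a b F g : glift a b F g != 0 -> basic_open a b g.
Proof. by move=> nz; apply: contrapT => /(glift_out F) e; rewrite e eqxx in nz. Qed.

Lemma glift_eq a b F f : (forall w, f (arr a b w) = F w) ->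
  (forall g, ~ basic_open a b g -> f g = 0) -> f = glift a b F.
Proof.
move=> fF f0; apply/funext => g.
have [/basic_openP[w ->]|nU] := pselect (basic_open a b g).
  by rewrite glift_arr.
by rewrite glift_out // f0.
Qed.

Lemma basic_open_locally_constant a b c d w : exists k, forall y,
  wtake k y = wtake k w -> basic_open c d (arr a b y) <-> basic_open c d (arr a b w).
Proof.
exists (size c) => y e; have E u v : wtake (size c) u = wtake (size c) v ->
    basic_open c d (arr a b u) -> basic_open c d (arr a b v).
  move=> euv /basic_open_nested; apply; rewrite euv (arr_deepen _ _ (size c)).
  exact: basic_open_arr.
by split; apply: E.
Qed.

Lemma continuous_glift a b F : ccont F -> continuous (glift a b F).
Proof.
move=> cF; apply/continuous_arrP => c d w.
have [/basic_openP[u e]|nU] := pselect (basic_open a b (arr c d w)).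
  suff : continuous_at (arr c d w) (glift a b F) by move=> H P /H /nbhs_arr.
  rewrite e => P; rewrite glift_arr => /cF HP; apply/nbhs_arr.
  by rewrite [X in cyl u X](_ : _ = F @^-1` P) //; apply/funext => y; rewrite /= glift_arr.
have [k Hk] := basic_open_locally_constant c d a b w.
move=> P /nbhs_singleton; rewrite glift_out // => P0; exists k => y /Hk e.
by rewrite /= glift_out // e.
Qed.

Lemma continuous_indic a b : continuous (\1_(basic_open a b) : G -> C).
Proof.
have -> : (\1_(basic_open a b) : G -> C) = glift a b (fun=> 1).
  apply: glift_eq => [w|g nU]; rewrite indicE.
    by rewrite mem_set //; exact: basic_open_arr.
  by rewrite memNset.
exact/continuous_glift/ccont_cst.
Qed.

Definition covered (s : seq (seq 'I_n * seq 'I_n)) f :=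
  forall g, f g != 0 -> exists2 p, p \in s & basic_open p.1 p.2 g.

(** If a proper filter on U_(a,b) had no cluster point, each arrow would have a
    neighbourhood U_(ac,bc) that the filter avoids; these prefixes c form a bar,
    so the filter would avoid U_(a,b). *)
Lemma compact_basic_open a b : compact (@basic_open n a b).
Proof.
move=> F FF FU; apply: contrapT => nclus.
pose Q (c : seq 'I_n) := F (~` @basic_open n (a ++ c) (b ++ c)).
suff : Q [::].
  rewrite /Q !cats0 => FnU; apply: (@filter_not_empty _ F FF).
  by rewrite -(setICr (basic_open a b)); exact: filterI.
apply: bar_induction => [c Hc|w].
  have HF : \forall g \near F, forall i, ~ basic_open (a ++ rcons c i) (b ++ rcons c i) g.
    by apply: filter_forall => i; exact: Hc.
  apply: filterS HF => g ng /basic_openP[u eu].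
  apply: (ng (u 0%N)); apply/basic_openP; exists (wshift 1 u).
  by rewrite eu (arr_deepen _ _ 1) -!cats1 !catA.
have [P [V [nP FV PV]]] : exists P V, [/\ nbhs (arr a b w) P, F V & P `&` V = set0].
  apply: contrapT => nPV; apply: nclus; exists (arr a b w).
  split; first exact: basic_open_arr.
  move=> V P FV nP; apply: contrapT => /nonemptyPn VP0.
  by apply: nPV; exists P, V; split=> //; rewrite setIC.
have [k Hk] := (nbhs_arr _ _ _ _).1 nP; exists k; rewrite /Q.
apply: filterS FV => g Vg /basic_openP[u eu].
have : (P `&` V) g; last by rewrite PV.
split=> //; rewrite eu arr_cat; apply: Hk.
by rewrite -[Y in wtake Y _](size_wtake k w) wtake_wcat.
Qed.

Lemma closed_basic_open a b : closed (@basic_open n a b).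
Proof.
move=> g; have [c [d [w ->]]] := arr_ex g => cl.
have [k Hk] := basic_open_locally_constant c d a b w.
have [|h [Uh [y ey]]] := cl [set h | exists2 y, wtake k y = wtake k w & h = arr c d y].
  by apply/nbhs_arr; exists k => y e; exists y.
by move=> eh; move: Uh; rewrite eh => /(Hk y ey).
Qed.

Lemma covered_closed (s : seq (seq 'I_n * seq 'I_n)) :
  closed [set g : G | exists2 p, p \in s & basic_open p.1 p.2 g].
Proof.
have -> : [set g : G | exists2 p, p \in s & basic_open p.1 p.2 g] =
    \big[setU/set0]_(p <- s) basic_open p.1 p.2.
  rewrite -bigcup_seq; apply/seteqP; split=> g [p /= ps Up]; by exists p.
elim/big_ind: _ => [|A B cA cB|p _]; [exact: closed0|exact: closedU|].
exact: closed_basic_open.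
Qed.

Lemma covered_compact (s : seq (seq 'I_n * seq 'I_n)) :
  compact [set g : G | exists2 p, p \in s & basic_open p.1 p.2 g].
Proof.
have -> : [set g : G | exists2 p, p \in s & basic_open p.1 p.2 g] =
    \big[setU/set0]_(p <- s) basic_open p.1 p.2.
  rewrite -bigcup_seq; apply/seteqP; split=> g [p /= ps Up]; by exists p.
elim/big_ind: _ => [|A B cA cB|p _]; [exact: compact0|exact: compactU|].
exact: compact_basic_open.
Qed.

(** Compact support is support in a finite union of bisections, because these are
    compact and clopen and cover G. *)
Lemma CcP f : Cc f <-> continuous f /\ exists s, covered s f.
Proof.
split=> -[cf].
  move=> kf; split=> //; apply: contrapT => ncov.
  set K := closure _ in kf.
  (* If no finite family of bisections covers the support, the complements of
     such families form a proper filter on it; a cluster point lies in a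
     bisection, which this filter avoids. *)
  pose F : set_system G := [set P | exists s : seq (seq 'I_n * seq 'I_n), forall g, K g ->
    (forall p, p \in s -> ~ basic_open p.1 p.2 g) -> P g].
  have FF : ProperFilter F.
    split; first move=> [s Hs].
      apply: ncov; exists s => g gf; apply: contrapT => ng.
      apply: (Hs g); first exact: subset_closure.
      by move=> p ps Up; apply: ng; exists p.
    split; first by exists [::].
      move=> P Q [s Hs] [t Ht]; exists (s ++ t) => g Kg ng.
      by split; [apply: Hs | apply: Ht] => // p ps; apply: ng; rewrite mem_cat ps ?orbT.
    by move=> P Q PQ [s Hs]; exists s => g Kg /(Hs g Kg) /PQ.
  have FK : F K by exists [::].
  have [g [Kg]] := kf F FF FK; have [a [b [w ->]]] := arr_ex g.
  move=> /(_ (~` basic_open a b) (basic_open a b)); case.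
  - by exists [:: (a, b)] => h _ /(_ (a, b)); rewrite inE eqxx; apply.
  - by apply: open_nbhs_nbhs; split; [exact: basic_open_open | exact: basic_open_arr].
  - by move=> h [].
move=> [s cov]; split=> //; apply: (subclosed_compact _ (@covered_compact s)).
  exact: closed_closure.
move=> g clg; apply: (@covered_closed s); apply: (closureS _ clg) => h /= /cov.
by [].
Qed.

End Continuity.

(** * The convolution algebra *)

Section CcAlgebra.
Variables (R : realType) (n : nat).
Local Notation C := (Cplx R).
Local Notation X := (infinite_word n).
Local Notation G := (cuntz_groupoid n).
Implicit Types (a b c d : seq 'I_n) (F : X -> C) (f : G -> C).

Lemma Cc_glift a b F : ccont F -> Cc (glift a b F).
Proof.
move=> cF; apply/CcP; split; first exact: continuous_glift.
by exists [:: (a, b)] => g /glift_supp U; exists (a, b); rewrite ?inE.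
Qed.

Lemma continuousM_G f1 f2 : continuous f1 -> continuous f2 ->
  continuous (fun g => f1 g * f2 g).
Proof.
by move=> /continuous_arrP c1 /continuous_arrP c2; apply/continuous_arrP => a b; exact: ccontM.
Qed.

Lemma continuousD_G f1 f2 : continuous f1 -> continuous f2 -> continuous (f1 + f2).
Proof.
by move=> /continuous_arrP c1 /continuous_arrP c2; apply/continuous_arrP => a b; exact: ccontD.
Qed.

Lemma continuous_cst_G (z : C) : continuous (fun _ : G => z).
Proof. by apply/continuous_arrP => a b; exact: ccont_cst. Qed.

Lemma Cc_mul (m f : G -> C) : continuous m -> Cc f -> Cc (fun g => m g * f g).
Proof.
move=> cm /CcP[cf [s cov]]; apply/CcP; split.
  exact: continuousM_G.
by exists s => g; rewrite mulf_eq0 negb_or => /andP[_ /cov].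
Qed.

Lemma Cc_comb (c : C) f1 f2 : Cc f1 -> Cc f2 -> Cc (c *: f1 + f2).
Proof.
move=> /CcP[c1 [s1 cov1]] /CcP[c2 [s2 cov2]]; apply/CcP; split.
  have -> : c *: f1 = (fun g => c * f1 g) by [].
  exact: continuousD_G (continuousM_G (@continuous_cst_G c) c1) c2.
exists (s1 ++ s2) => g; have [e1|/cov1[p ps Up]] := eqVneq (f1 g) 0.
  have [e2|/cov2[p ps Up] _] := eqVneq (f2 g) 0.
    have -> : (c *: f1 + f2) g = c * f1 g + f2 g by [].
    by rewrite e1 e2 mulr0 addr0 eqxx.
  by exists p; rewrite ?mem_cat ?ps ?orbT.
by move=> _; exists p; rewrite ?mem_cat ?ps ?orbT.
Qed.

Lemma Cc0 : Cc (0 : G -> C).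
Proof.
apply/CcP; split; first exact: continuous_cst_G.
by exists [::] => g; rewrite eqxx.
Qed.

Lemma Cc_add f1 f2 : Cc f1 -> Cc f2 -> Cc (f1 + f2).
Proof. by move=> h1 h2; rewrite -[f1]scale1r; exact: Cc_comb. Qed.

Lemma Cc_scale (c : C) f : Cc f -> Cc (c *: f).
Proof. by move=> h; rewrite -[_ *: _]addr0; apply: Cc_comb h Cc0. Qed.

Lemma Cc_sub f1 f2 : Cc f1 -> Cc f2 -> Cc (f1 - f2).
Proof. by move=> h1 h2; rewrite addrC -scaleN1r; exact: Cc_comb. Qed.

Lemma Cc_sum (I : Type) (r : seq I) (Q : pred I) (f : I -> G -> C) :
  (forall i, Q i -> Cc (f i)) -> Cc (\sum_(i <- r | Q i) f i).
Proof. by move=> H; elim/big_ind: _ => //; [exact: Cc0 | exact: Cc_add]. Qed.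

Lemma indic_glift a b f :
  (fun g => \1_(basic_open a b) g * f g) = glift a b (fun w => f (arr a b w)).
Proof.
apply: glift_eq => [w|g nU]; rewrite indicE.
  by rewrite mem_set ?mul1r //; exact: basic_open_arr.
by rewrite memNset ?mul0r.
Qed.

(** Induction on the number of bisections covering the support, splitting off the
    restriction of f to one of them. Identities additive in f thus need checking
    only on functions carried by one bisection. *)
Lemma Cc_ind (Q : (G -> C) -> Prop) : Q 0 ->
  (forall a b F f, ccont F -> Cc f -> Q f -> Q (glift a b F + f)) ->
  forall f, Cc f -> Q f.
Proof.
move=> Q0 Qstep f /CcP[cf [s]]; elim: s f cf => [|[a b] s IH] f cf cov.
  suff -> : f = 0 by [].
  by apply/funext => g; apply/eqP; apply: contraT => /cov[].
pose r := fun g => (1 - \1_(basic_open a b) g) * f g.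
have -> : f = glift a b (fun w => f (arr a b w)) + r.
  by apply/funext => g; rewrite -indic_glift /= /r fctE; ring.
have cr : continuous r.
  have -> : r = fun g => ((fun=> 1) + (fun g => (-1) * \1_(basic_open a b) g)) g * f g.
    by apply/funext => g; rewrite /r fctE mulN1r.
  apply: continuousM_G cf; apply: continuousD_G; first exact: continuous_cst_G.
  by apply: continuousM_G; [exact: continuous_cst_G | exact: continuous_indic].
have covr : covered s r.
  move=> g; rewrite mulf_eq0 negb_or => /andP[ng /cov[p]].
  rewrite inE => /orP[/eqP ->|ps Up]; last by exists p.
  by move=> U; move: ng; rewrite indicE mem_set // subrr eqxx.
apply: Qstep; first by move: cf => /continuous_arrP.
  by apply/CcP; split=> //; exists s.
exact: IH.
Qed.

(** A bisection contains at most one arrow with a given range. *)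
Lemma finite_range_fiber f x : Cc f -> finite_set [set g | grange g = x /\ f g != 0].
Proof.
move=> /CcP[_ [s cov]].
apply: (@sub_finite_set _ _ ((fun p => arr p.1 p.2 (wshift (size p.1) x)) @` [set` s])).
  move=> g [gx /cov[p ps /basic_openP[w ew]]]; exists p => //.
  by rewrite ew -gx ew grange_arr wshift_wcat.
by apply: finite_image; exact: finite_seq.
Qed.

Lemma gswap_subproof a b (g : G) :
  (wcat b (wshift (size a) (grange g)), gdegree g - (size a)%:Z + (size b)%:Z, gsource g)
  \in @cuntz_arrows n.
Proof.
have [c [d [w ->]]] := arr_ex g.
rewrite grange_arr gsource_arr gdegree_arr; apply/mem_set/cuntz_arrowsP.
exists (size b + size c)%N, (size a + size d)%N; split; first by lia.
rewrite -wshift_add wshift_wcat wshift_add addnC -wshift_add wshift_wcat.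
by rewrite addnC -wshift_add wshift_wcat.
Qed.

(** Left translation of g by the arrow from a w to b w, where a w is the range of
    g; it is total, so that the prefix a need not be known beforehand. *)
Definition gswap a b (g : G) : G :=
  exist (fun t => t \in @cuntz_arrows n) _ (gswap_subproof a b g).

Lemma grange_swap a b g : grange (gswap a b g) = wcat b (wshift (size a) (grange g)).
Proof. by []. Qed.
Lemma gsource_swap a b g : gsource (gswap a b g) = gsource g.
Proof. by []. Qed.
Lemma gdegree_swap a b g : gdegree (gswap a b g) = gdegree g - (size a)%:Z + (size b)%:Z.
Proof. by []. Qed.

Lemma gswapK a b g : wtake (size a) (grange g) = a -> gswap b a (gswap a b g) = g.
Proof.
move=> ga; apply: arrow_eq => //; rewrite ?grange_swap ?gdegree_swap; last by lia.
by rewrite wshift_wcat -(wcat_eqP ga).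
Qed.

Lemma gswap_arr a b c d w : gswap a b (arr (a ++ c) d w) = arr (b ++ c) d w.
Proof.
apply: arrow_eq => //; rewrite ?grange_swap ?gdegree_swap.
  by rewrite !grange_arr !wcat_cat wshift_wcat.
by rewrite !gdegree_arr !size_cat; lia.
Qed.

Lemma gswap_arr0 a b d w : gswap a b (arr a d w) = arr b d w.
Proof. by rewrite -[X in arr X]cats0 gswap_arr cats0. Qed.

(** The bisection U_(a,b) has at most one arrow with the range of g, so the
    convolution has at most one term. *)
Lemma conv_glift a b F f g : convolution (glift a b F) f g =
  if wtake (size a) (grange g) == a then F (wshift (size a) (grange g)) * f (gswap a b g)
  else 0.
Proof.
set w := wshift _ _; pose p0 := (arr a b w, gswap a b g).
have only p : factorizations g p -> glift a b F p.1 * f p.2 != 0 ->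
    wtake (size a) (grange g) = a /\ p = p0.
  move=> [e1 e2 e3 e4]; rewrite mulf_eq0 negb_or => /andP[/glift_supp /basic_openP[u eu] _].
  rewrite eu grange_arr in e1; rewrite eu gsource_arr in e2.
  rewrite eu gdegree_arr in e4.
  rewrite -e1 wtake_wcat; split=> //.
  have wu : w = u by rewrite /w -e1 wshift_wcat.
  rewrite [p]surjective_pairing eu /p0 wu; congr (_, _).
  apply: arrow_eq => //; rewrite ?grange_swap ?gdegree_swap -/w ?wu //.
  by rewrite -e4; lia.
case: ifPn => [/eqP ga|/eqP na]; last first.
  rewrite /convolution fsbig1 // => p pg; apply/eqP; apply: contraT.
  by move=> /(only _ pg)[].
rewrite -[LHS](@fsbig_widen _ _ _ _ [set p0]).
- by rewrite fsbig_set1 glift_arr.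
- move=> _ ->; split; rewrite ?grange_arr //.
  + by rewrite -(wcat_eqP ga).
  + by rewrite gdegree_swap gdegree_arr; lia.
- move=> p [pg /= np]; apply/eqP; apply: contraT => /(only _ pg)[_ ep].
  by case: np.
Qed.

Lemma conv_glift_glift a b c F F' :
  convolution (glift a b F) (glift b c F') = glift a c (fun w => F w * F' w).
Proof.
apply: glift_eq => [w|g nU]; rewrite conv_glift.
  rewrite grange_arr wtake_wcat eqxx wshift_wcat; congr (_ * _).
  by rewrite gswap_arr0 glift_arr.
case: eqP => // ga; rewrite glift_out ?mulr0 // => /basic_openP[w ew].
apply: nU; rewrite -(gswapK b ga) ew gswap_arr0.
exact: basic_open_arr.
Qed.

Definition diag F : G -> C := glift [::] [::] F.

Lemma conv_diagl F f : convolution (diag F) f = (fun g => F (grange g) * f g).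
Proof.
apply/funext => g; rewrite conv_glift /= wshift0; congr (_ * f _).
apply: arrow_eq => //; rewrite ?grange_swap ?gdegree_swap ?wcat_nil //=; lia.
Qed.

Lemma conv_diagr F f : convolution f (diag F) = (fun g => f g * F (gsource g)).
Proof.
apply/funext => g; set u := arr [::] [::] (gsource g).
rewrite -[LHS](@fsbig_widen _ _ _ _ [set (g, u)]).
- by rewrite fsbig_set1 /diag glift_arr.
- move=> _ ->; split=> //; rewrite /u ?grange_arr ?gsource_arr ?wcat_nil //.
  by rewrite gdegree_arr /=; lia.
- move=> [h k] [[e1 e2 e3 e4] /= np]; apply/eqP; rewrite mulf_eq0; apply/norP.
  move=> [_ /glift_supp/basic_openP[w ew]]; apply: np.
  rewrite /= ew !gsource_arr !grange_arr !gdegree_arr in e1 e2 e3 e4 *.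
  rewrite /u -e3; rewrite !wcat_nil /= in e2 e3 e4 *; congr (_, _).
  by apply: arrow_eq => //; rewrite ?e2 // -e4; lia.
Qed.

Lemma involution_glift a b F : involution (glift a b F) = glift b a (fun w => (F w)^*).
Proof.
have inv_arr c d w : ginv (arr c d w) = arr d c w.
  by apply: arrow_eq => //; rewrite [LHS]/gdegree /= opprB.
apply: glift_eq => [w|g nU]; first by rewrite /involution inv_arr glift_arr.
rewrite /involution glift_out ?conjC0 // => /basic_openP[w ew]; apply: nU.
have -> : g = ginv (ginv g) by apply: arrow_eq => //; rewrite [RHS]/gdegree /= opprK.
by rewrite ew inv_arr; exact: basic_open_arr.
Qed.

(** Finite supports are needed to add the two sums: both are restricted to the
    factorizations whose first factor is in the support of f1 or f2. *)
Lemma convDl f1 f2 f : Cc f1 -> Cc f2 ->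
  convolution (f1 + f2) f = convolution f1 f + convolution f2 f.
Proof.
move=> h1 h2; apply/funext => g.
have -> : (convolution f1 f + convolution f2 f) g =
  convolution f1 f g + convolution f2 f g by [].
rewrite /convolution.
pose D f' := factorizations g `&` [set p | f' p.1 != 0].
have finD f' : Cc f' -> finite_set (D f').
  move=> h.
  pose ofl (h : G) : G * G := (h, xget h [set k | factorizations g (h, k)]).
  apply: (@sub_finite_set _ _ (ofl @` [set h | grange h = grange g /\ f' h != 0])).
    move=> [k l] [[/= e1 e2 e3 e4] nz]; exists k => //; congr (_, _).
    case: xgetP => [l' -> [/= _ e2' e3' e4']|/(_ l)/=]; last by case.
    by apply: arrow_eq; rewrite -?e2 -?e2' ?e3 ?e3' //; lia.
  exact/finite_image/finite_range_fiber.
have E f' : Cc f' -> (f' = f1 \/ f' = f2 \/ f' = f1 + f2) ->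
    \sum_(p \in factorizations g) f' p.1 * f p.2 =
    \sum_(p \in D f1 `|` D f2) f' p.1 * f p.2.
  move=> _ ef'; symmetry; apply: fsbig_widen; first by move=> p [[]|[]].
  move=> p [pg np] /=; apply/eqP; rewrite mulf_eq0; apply/orP; left.
  have z1 : f1 p.1 = 0 by apply/eqP; apply: contraT => nz; case: np; left.
  have z2 : f2 p.1 = 0 by apply/eqP; apply: contraT => nz; case: np; right.
  by case: ef' => [->|[->|->]]; rewrite ?fctE ?z1 ?z2 ?addr0.
rewrite !E; try by [|exact: Cc_add|left|right; left|right; right].
rewrite -fsbig_split; last by rewrite finite_setU; split; exact: finD.
by apply: eq_fsbigr => p _; exact: mulrDl.
Qed.

Lemma conv0l f : convolution 0 f = 0.
Proof.
apply/funext => g; rewrite /convolution fsbig1 // => p _.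
by rewrite [X in X * _](_ : _ = 0) ?mul0r.
Qed.

(** The bisections with long prefixes already form a basis of the topology. *)
Lemma continuous_deep k f :
  (forall a b, (k <= size a)%N -> ccont (fun w => f (arr a b w))) -> continuous f.
Proof.
move=> H g; have [a [b [w ->]]] := arr_ex g; rewrite (arr_deepen a b k) => P.
move=> /H HP; apply/nbhs_arr; apply: HP.
by rewrite size_cat size_wtake leq_addl.
Qed.

(** By [Cc_ind] the first factor lives on one bisection U_(a,b); the product is
    then a translate of f2, weighted by F. *)
Lemma Cc_conv f1 f2 : Cc f1 -> Cc f2 -> Cc (convolution f1 f2).
Proof.
move=> h1 h2; move: f1 h1; apply: Cc_ind => [|a b F f cF cf IH].
  by rewrite conv0l; exact: Cc0.
rewrite convDl //; last exact: Cc_glift.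
apply: Cc_add IH; move: h2 => /CcP[c2 [s cov]]; apply/CcP; split.
  apply: (@continuous_deep (size a)) => c d sc.
  rewrite (_ : (fun w => _) = fun w => if take (size a) c == a then
    F (wcat (drop (size a) c) w) * f2 (arr (b ++ drop (size a) c) d w) else 0).
    case: eqP => _; last exact: ccont_cst.
    exact: (ccontM (@ccont_wcat _ _ _ F cF) ((continuous_arrP f2).1 c2 (b ++ drop (size a) c) d)).
  apply/funext => w; rewrite conv_glift grange_arr.
  have ec : wcat c w = wcat (take (size a) c) (wcat (drop (size a) c) w).
    by rewrite -wcat_cat cat_take_drop.
  have st : size (take (size a) c) = size a by rewrite size_takel.
  rewrite ec -[X in wtake X _]st wtake_wcat; case: eqP => // ea.
  rewrite -[X in wshift X _]st wshift_wcat -[X in arr X](cat_take_drop (size a) c).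
  by rewrite ea gswap_arr.
(* The translate of U_(c,d) is U_(ae,d) if c = be, and U_(a,de) if b = ce. *)
exists (flatten [seq [:: (a ++ drop (size b) p.1, p.2);
   (a, p.2 ++ drop (size p.1) b)] | p <- s]) => g.
rewrite conv_glift; case: (wtake _ _ =P a) => [ea|_]; last by rewrite eqxx.
rewrite mulf_eq0 negb_or => /andP[_ /cov[[c d] ps /= /basic_openP[u eu]]].
have eg := gswapK b ea.
have eb : wcat b (wshift (size a) (grange g)) = wcat c u.
  by rewrite -grange_swap eu grange_arr.
set w := wshift _ _ in eb; have [le_bc|/ltnW le_cb] := leqP (size b) (size c).
  exists (a ++ drop (size b) c, d).
    by apply/flatten_mapP; exists (c, d); rewrite ?inE ?eqxx.
  have ec : c = b ++ drop (size b) c.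
    rewrite -[LHS](cat_take_drop (size b)); congr (_ ++ _).
    rewrite -[RHS](wtake_wcat b w) eb -{2}[c](cat_take_drop (size b)) wcat_cat.
    by rewrite -[X in wtake X](size_takel le_bc) wtake_wcat.
  by rewrite /= -eg eu [X in arr X d u]ec gswap_arr; exact: basic_open_arr.
exists (a, d ++ drop (size c) b).
  by apply/flatten_mapP; exists (c, d); rewrite ?inE ?eqxx ?orbT.
have eu' : u = wcat (drop (size c) b) w.
  rewrite -(wshift_wcat c u) -eb -{1}[b](cat_take_drop (size c)) wcat_cat.
  by rewrite -[X in wshift X](size_takel le_cb) wshift_wcat.
have ebc : b = c ++ drop (size c) b.
  rewrite -[LHS](cat_take_drop (size c)); congr (_ ++ _).
  rewrite -[RHS](wtake_wcat c u) -eb -{2}[b](cat_take_drop (size c)) wcat_cat.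
  by rewrite -[X in wtake X](size_takel le_cb) wtake_wcat.
by rewrite /= -eg eu eu' -arr_cat -ebc gswap_arr0; exact: basic_open_arr.
Qed.

Lemma continuous_degree (h : int -> C) : continuous (fun g : G => h (gdegree g)).
Proof.
apply/continuous_arrP => a b.
exact: (@ccont_cst _ _ (h ((size a)%:Z - (size b)%:Z))).
Qed.

Lemma continuous_range F : ccont F -> continuous (fun g : G => F (grange g)).
Proof. by move=> cF; apply/continuous_arrP => a b; exact: ccont_wcat. Qed.

Lemma continuous_source F : ccont F -> continuous (fun g : G => F (gsource g)).
Proof. by move=> cF; apply/continuous_arrP => a b; exact: ccont_wcat. Qed.

(** The gauge action on functions: S_i has degree 1, hence is multiplied by z. *)
Definition twist (z : C) f : G -> C := fun g => z ^ gdegree g * f g.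

Lemma Cc_twist z f : Cc f -> Cc (twist z f).
Proof. by apply: Cc_mul; exact: (@continuous_degree (fun k => z ^ k)). Qed.

Lemma twist_comb z (c : C) f1 f2 : twist z (c *: f1 + f2) = c *: twist z f1 + twist z f2.
Proof.
apply/funext => g; have -> : (c *: twist z f1 + twist z f2) g =
  c * (z ^ gdegree g * f1 g) + z ^ gdegree g * f2 g by [].
have -> : twist z (c *: f1 + f2) g = z ^ gdegree g * (c * f1 g + f2 g) by [].
by ring.
Qed.

Lemma twist_conv z f1 f2 : z != 0 ->
  convolution (twist z f1) (twist z f2) = twist z (convolution f1 f2).
Proof.
move=> z0; apply/funext => g; rewrite /convolution /twist mulr_fsumr.
apply: eq_fsbigr => p /set_mem[_ _ _ ed].
by rewrite mulrACA -exprzDr ?unitfE // ed.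
Qed.

Lemma norm_unimod (z : C) (k : int) : `|z| = 1 -> `|z ^ k| = 1.
Proof.
move=> z1; case: k => k; first by rewrite -exprnP normrX z1 expr1n.
by rewrite NegzE -invr_expz normfV -exprnP normrX z1 expr1n invr1.
Qed.

Lemma conj_unimod (z : C) (k : int) : `|z| = 1 -> (z ^ (- k))^* = z ^ k.
Proof.
move=> z1; set u := z ^ (- k).
have u1 : `|u| = 1 by exact: norm_unimod.
have : u^-1 = u^* by rewrite invC_norm u1 expr1n invr1 mul1r.
by rewrite {1}/u invr_expz opprK => <-.
Qed.

Lemma twist_involution z f : `|z| = 1 -> involution (twist z f) = twist z (involution f).
Proof.
move=> z1; apply/funext => g; rewrite /involution /twist rmorphM; congr (_ * _).
exact: conj_unimod.
Qed.

End CcAlgebra.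

(** * The Hilbert space of square-summable families *)

Section L2.
Variables (R : realType) (I : choiceType).
Local Notation C := (Cplx R).
Implicit Types (f g h : I -> C) (s t : {fset I}).

Definition l2sum s f : R := \sum_(i <- s) nrm (f i) ^+ 2.

Lemma fsum_split (V : nmodType) s t (F : I -> V) : (s `<=` t)%fset ->
  \sum_(i <- t) F i = \sum_(i <- s) F i + \sum_(i <- t | i \notin s) F i.
Proof.
move=> st; rewrite (bigID (fun i => i \in s)) /=; congr (_ + _).
rewrite -big_filter; apply: perm_big; apply: uniq_perm; rewrite ?filter_uniq //.
by move=> i; rewrite mem_filter; case: (boolP (i \in s)) => // /(fsubsetP st) ->.
Qed.

Lemma l2sum_ge0 s f : 0 <= l2sum s f.
Proof. by apply: sumr_ge0 => i _; rewrite exprn_ge0 ?nrm_ge0. Qed.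

Lemma l2sum_mono s t f : (s `<=` t)%fset -> l2sum s f <= l2sum t f.
Proof.
move=> st; rewrite /l2sum (fsum_split _ st) lerDl.
by apply: sumr_ge0 => i _; rewrite exprn_ge0 ?nrm_ge0.
Qed.

(** The weight e is chosen at the end: this gives the triangle inequality for the
    l2 norm without the Cauchy-Schwarz inequality. *)
Lemma young (x y e : R) : 0 < e -> (x + y) ^+ 2 <= (1 + e) * x ^+ 2 + (1 + e^-1) * y ^+ 2.
Proof.
move=> e0; have : 0 <= e^-1 * (e * x - y) ^+ 2.
  by rewrite mulr_ge0 ?sqr_ge0 // invr_ge0 ltW.
have -> : e^-1 * (e * x - y) ^+ 2 = e * x ^+ 2 - 2 * x * y + e^-1 * y ^+ 2.
  by field; rewrite gt_eqF.
nra.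
Qed.

Lemma l2sumD s f g (e : R) : 0 < e ->
  l2sum s (f + g) <= (1 + e) * l2sum s f + (1 + e^-1) * l2sum s g.
Proof.
move=> e0; rewrite /l2sum !mulr_sumr -big_split; apply: ler_sum => i _.
apply: le_trans (young _ _ e0); rewrite ler_sqr ?nnegrE ?addr_ge0 ?nrm_ge0 //.
exact: nrmD.
Qed.

Lemma l2sumZ s (c : C) f : l2sum s (c *: f) = nrm c ^+ 2 * l2sum s f.
Proof.
by rewrite /l2sum mulr_sumr; apply: eq_bigr => i _; rewrite -exprMn -nrmM.
Qed.

Definition is_l2 f := exists M : R, forall s, l2sum s f <= M.

Definition l2_pred : pred (I -> C) := fun f => `[< is_l2 f >].

Lemma is_l2_submod : GRing.subsemimod_closed l2_pred.
Proof.
split; first split.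
- apply/asboolP; exists 0 => s; rewrite /l2sum big1 // => i _.
  by rewrite nrm0 expr0n.
- move=> f g /asboolP[M HM] /asboolP[N HN]; apply/asboolP.
  exists ((1 + 1) * M + (1 + 1^-1) * N) => s; apply: le_trans (l2sumD _ _ _ ltr01) _.
  by rewrite invr1; have := HM s; have := HN s; lra.
- move=> c f /asboolP[M HM]; apply/asboolP; exists (nrm c ^+ 2 * M) => s.
  by rewrite l2sumZ ler_wpM2l ?exprn_ge0 ?nrm_ge0.
Qed.

(** A submodule of all families, from which the linear structure is inherited. *)
Record l2 := L2 { l2fun :> I -> C; l2funP : l2_pred l2fun }.
HB.instance Definition _ := [isSub for l2fun].
HB.instance Definition _ := [Choice of l2 by <:].
HB.instance Definition _ :=
  GRing.SubChoice_isSubLmodule.Build C (I -> C) l2_pred l2 is_l2_submod.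

Implicit Types x y z : l2.

Lemma l2P x y : (forall i, x i = y i) -> x = y.
Proof. by move=> H; apply: val_inj; apply/funext. Qed.

Lemma l2E x : is_l2 x. Proof. by apply/asboolP; exact: l2funP. Qed.

Lemma l2_addE x y i : (x + y) i = x i + y i. Proof. by []. Qed.
Lemma l2_scaleE (c : C) x i : (c *: x) i = c * x i. Proof. by []. Qed.
Lemma l2_oppE x i : (- x) i = - x i. Proof. by []. Qed.

Definition l2sq x : R := sup [set l2sum s x | s in setT].

Lemma l2sq_has_sup x : has_sup [set l2sum s x | s in setT].
Proof.
split; first by exists (l2sum fset0 x); exists fset0.
by have [M HM] := l2E x; exists M => _ [s _ <-].
Qed.

Lemma l2sum_le x s : l2sum s x <= l2sq x.
Proof. by apply: ub_le_sup; [exact: (l2sq_has_sup x).2 | exists s]. Qed.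

Lemma l2sq_le x (M : R) : (forall s, l2sum s x <= M) -> l2sq x <= M.
Proof.
move=> H; apply: ge_sup; first exact: (l2sq_has_sup x).1.
by move=> _ [s _ <-].
Qed.

Lemma l2sq_ge0 x : 0 <= l2sq x.
Proof. by apply: le_trans (l2sum_le x fset0); exact: l2sum_ge0. Qed.

Lemma l2sq_coord x i : nrm (x i) ^+ 2 <= l2sq x.
Proof.
by apply: le_trans (l2sum_le x [fset i]%fset); rewrite /l2sum big_seq_fset1.
Qed.

Lemma l2sq_eq0 x : l2sq x = 0 -> x = 0.
Proof.
move=> x0; apply: l2P => i; apply/eqP; rewrite -nrm_eq0 -sqrf_eq0 eq_le.
by rewrite exprn_ge0 ?nrm_ge0 // andbT -x0 l2sq_coord.
Qed.

Lemma l2sqD x y (e : R) : 0 < e ->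
  l2sq (x + y) <= (1 + e) * l2sq x + (1 + e^-1) * l2sq y.
Proof.
move=> e0; apply: l2sq_le => s; apply: le_trans (l2sumD _ _ _ e0) _.
have e1 : 0 <= e^-1 by rewrite invr_ge0 ltW.
by apply: lerD; apply: ler_wpM2l; rewrite ?l2sum_le ?addr_ge0 // ltW.
Qed.

Lemma l2sqZ (c : C) x : l2sq (c *: x) = nrm c ^+ 2 * l2sq x.
Proof.
have le k z : l2sq (k *: z) <= nrm k ^+ 2 * l2sq z.
  by apply: l2sq_le => s; rewrite l2sumZ ler_wpM2l ?exprn_ge0 ?nrm_ge0 // l2sum_le.
have [->|c0] := eqVneq c 0.
  apply/eqP; rewrite eq_le le nrm0 expr0n mul0r /=; exact: l2sq_ge0.
apply/eqP; rewrite eq_le le /=.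
have nc : 0 < nrm c by rewrite lt_neqAle eq_sym nrm_eq0 c0 nrm_ge0.
rewrite -ler_pdivlMl ?exprn_gt0 // -exprVn -nrmV.
by apply: le_trans (le _ _); rewrite scalerA mulVf // scale1r.
Qed.

Definition l2norm x : R := Num.sqrt (l2sq x).

Lemma l2norm_ge0 x : 0 <= l2norm x. Proof. exact: sqrtr_ge0. Qed.
Lemma l2norm_sq x : l2norm x ^+ 2 = l2sq x.
Proof. by rewrite sqr_sqrtr ?l2sq_ge0. Qed.

Lemma l2norm_eq0 x : l2norm x = 0 -> x = 0.
Proof. by move=> x0; apply: l2sq_eq0; rewrite -l2norm_sq x0 expr0n. Qed.

Lemma l2normZ (c : C) x : l2norm (c *: x) = nrm c * l2norm x.
Proof.
by rewrite /l2norm l2sqZ sqrtrM ?exprn_ge0 ?nrm_ge0 // sqrtr_sqr ger0_norm ?nrm_ge0.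
Qed.

Lemma l2normD x y : l2norm (x + y) <= l2norm x + l2norm y.
Proof.
have pos z : z <> 0 -> 0 < l2norm z.
  by move=> z0; rewrite lt_neqAle l2norm_ge0 andbT eq_sym; apply/eqP => /l2norm_eq0.
have [->|/pos x0] := pselect (x = 0); first by rewrite add0r lerDr l2norm_ge0.
have [->|/pos y0] := pselect (y = 0); first by rewrite addr0 lerDl l2norm_ge0.
(* The ratio of the norms is the optimal weight in [l2sqD]. *)
rewrite -ler_sqr ?nnegrE ?addr_ge0 ?l2norm_ge0 // l2norm_sq.
apply: le_trans (l2sqD _ _ (divr_gt0 y0 x0)) _; rewrite -!l2norm_sq le_eqVlt.
by apply/orP; left; apply/eqP; field; rewrite !gt_eqF.
Qed.

HB.instance Definition _ := isPointed.Build l2 0.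

Lemma l2_rnormD x y : rc (l2norm (x + y)) <= rc (l2norm x) + rc (l2norm y).
Proof. by rewrite -rcD rc_le l2normD. Qed.
Lemma l2_rnormZ (c : C) x : rc (l2norm (c *: x)) = `|c| * rc (l2norm x).
Proof. by rewrite nrmE -rcM l2normZ. Qed.
Lemma l2_rnorm0 x : rc (l2norm x) = 0 -> x = 0.
Proof. by rewrite -[0](rc0) => /rc_inj /l2norm_eq0. Qed.

HB.instance Definition _ :=
  @Lmodule_isNormed.Build C l2 (fun x => rc (l2norm x)) l2_rnormD l2_rnormZ l2_rnorm0.

Lemma l2_rnormE x : rnorm x = l2norm x. Proof. by []. Qed.

Lemma Re_le_nrm (z : C) : `|complex.Re z| <= nrm z.
Proof.
rewrite -ler_sqr ?nnegrE ?nrm_ge0 // nrm_sqE real_normK ?num_real //.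
by rewrite lerDl sqr_ge0.
Qed.

Lemma Im_le_nrm (z : C) : `|complex.Im z| <= nrm z.
Proof.
rewrite -ler_sqr ?nnegrE ?nrm_ge0 // nrm_sqE real_normK ?num_real //.
by rewrite lerDr sqr_ge0.
Qed.

Lemma l2norm_coord x i : nrm (x i) <= l2norm x.
Proof.
by rewrite -ler_sqr ?nnegrE ?nrm_ge0 ?l2norm_ge0 // l2norm_sq l2sq_coord.
Qed.

(** Real and imaginary parts of the coordinates converge by completeness of R.
    Finite partial sums depend continuously on finitely many coordinates, so the
    Cauchy bounds on them pass to the limit family L. *)
Lemma l2_complete (F : set_system l2) : ProperFilter F -> cauchy F -> cvg F.
Proof.
move=> FF /cauchyP cF.
have H (e : R) : 0 < e -> exists x, F [set y | l2norm (x - y) < e].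
  move=> e0; have [|x Fx] := cF (rc e); first by rewrite -[0](rc0 R) rc_lt.
  by exists x; apply: filterS Fx => y; rewrite -ball_normE /= rnormE rc_lt.
have coord (p : C -> R) : {morph p : u v / u - v} -> (forall u : C, `|p u| <= nrm u) ->
    forall i, exists l : R, (fun y : l2 => p (y i)) @ F --> l.
  move=> pB ple i; suff : cvg ((fun y : l2 => p (y i)) @ F).
    by move=> cp; exists (lim ((fun y : l2 => p (y i)) @ F)).
  apply: R_complete; apply/cauchyP => e e0; have [x Fx] := H e e0.
  exists (p (x i)); apply: (@filterS _ F _ [set y | l2norm (x - y) < e] _ _ Fx) => y /= xy.
  rewrite -ball_normE /= -pB; apply: le_lt_trans (ple _) _; rewrite -l2_oppE -l2_addE.
  by apply: le_lt_trans xy; exact: l2norm_coord.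
have ReB : {morph (@complex.Re R : C -> R) : u v / u - v} by move=> [? ?] [? ?].
have ImB : {morph (@complex.Im R : C -> R) : u v / u - v} by move=> [? ?] [? ?].
have [a Ha] := choice (coord _ ReB Re_le_nrm).
have [b Hb] := choice (coord _ ImB Im_le_nrm).
have cq (u : l2 -> R) (l k : R) : u @ F --> l ->
    (fun y => (k - u y) ^+ 2) @ F --> (k - l) ^+ 2.
  move=> ul; have uk : (fun y => k - u y) @ F --> k - l by apply: cvgB ul; exact: cvg_cst.
  exact: (cvgM uk uk).
pose L i : C := Complex (a i) (b i).
have key x (e : R) : 0 < e -> F [set y | l2norm (x - y) < e] ->
    forall s, l2sum s ((x : I -> C) - L) <= e ^+ 2.
  move=> e0 Fx s.
  have cs : (fun y : l2 => l2sum s (x - y)) @ F --> l2sum s ((x : I -> C) - L).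
    rewrite /l2sum; elim: (enum_fset s) => [|i r IH].
      rewrite big_nil (_ : (fun _ => _) = fun=> 0); first exact: cvg_cst.
      by apply/funext => y; rewrite big_nil.
    rewrite big_cons (_ : (fun _ => _) = (fun y : l2 => nrm ((x - y) i) ^+ 2) \+
      (fun y : l2 => \sum_(j <- r) nrm ((x - y) j) ^+ 2)); last first.
      by apply/funext => y; rewrite big_cons.
    apply: cvgD IH.
    rewrite (_ : (fun _ => _) = fun y : l2 =>
      (complex.Re (x i) - complex.Re (y i)) ^+ 2 + (complex.Im (x i) - complex.Im (y i)) ^+ 2).
      have -> : nrm (((x : I -> C) - L) i) ^+ 2 =
          (complex.Re (x i) - a i) ^+ 2 + (complex.Im (x i) - b i) ^+ 2.
        by rewrite nrm_sqE; congr (_ ^+ 2 + _ ^+ 2); [exact: ReB | exact: ImB].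
      exact: cvgD (cq _ _ _ (Ha i)) (cq _ _ _ (Hb i)).
    by apply/funext => y; rewrite nrm_sqE -ReB -ImB.
  apply: (closed_cvg (fun t : R => t <= e ^+ 2) (@closed_le R (e ^+ 2)) _ _ cs).
  apply: filterS Fx => y /= xy; apply: (le_trans (l2sum_le (x - y) s)).
  by rewrite -l2norm_sq ler_sqr ?nnegrE ?l2norm_ge0 // ltW.
have L2L : l2_pred L.
  have [x Fx] := H _ ltr01; apply/asboolP.
  exists ((1 + 1) * l2sq x + (1 + 1^-1) * 1) => s.
  have -> : L = (x : I -> C) - ((x : I -> C) - L) by rewrite opprB addrC subrK.
  apply: le_trans (l2sumD _ _ _ ltr01) _; rewrite -scaleN1r l2sumZ nrmN nrm1 expr1n mul1r.
  apply: lerD; rewrite ler_wpM2l ?l2sum_le ?invr1 ?addr_ge0 //.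
  by have := key x 1 ltr01 Fx s; rewrite expr1n.
apply/cvg_ex; exists (L2 L2L); apply/(cvg_rnormP (fun y : l2 => y) (L2 L2L)) => e e0.
have e20 : 0 < e / 2 by rewrite divr_gt0.
have [x Fx] := H _ e20; apply: filterS (Fx) => y /= xy.
apply: le_lt_trans (rnorm_tri x _ _) _; rewrite !l2_rnormE.
have : l2norm (L2 L2L - x) <= e / 2.
  rewrite -[l2norm _]l2_rnormE rnorm_dist l2_rnormE.
  rewrite -ler_sqr ?nnegrE ?l2norm_ge0 ?(ltW e20) // l2norm_sq.
  by apply: l2sq_le => s; exact: key.
by move: xy; rewrite -!l2_rnormE; lra.
Qed.

HB.instance Definition _ := Uniform_isComplete.Build l2 l2_complete.

(** Unordered summation: convergence along the finite subsets of I. *)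
Definition tot : set_system {fset I} := [set P | exists s, forall t, (s `<=` t)%fset -> P t].

Global Instance tot_filter : ProperFilter tot.
Proof.
split; first by move=> [s /(_ s (fsubset_refl _))].
split; first by exists fset0.
  move=> P Q [s Hs] [t Ht]; exists (s `|` t)%fset => u.
  by rewrite fsubUset => /andP[/Hs ? /Ht].
by move=> P Q PQ [s Hs]; exists s => t /Hs /PQ.
Qed.

Lemma cvg_l2sum x : (fun s => rc (l2sum s x)) @ tot --> rc (l2sq x).
Proof.
apply/cvg_nrmP => e e0.
have [_ [s _ <-] Hs] := sup_adherent e0 (l2sq_has_sup x).
exists s => t st; rewrite -rcB nrm_rc ger0_norm ?subr_ge0 ?l2sum_le //.
by have := l2sum_mono x st; rewrite -/(l2sq x) in Hs; lra.
Qed.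

Arguments cvg_l2sum : clear implicits.

Lemma polarization (u v : C) : u * v^* =
  4^-1 * (rc (nrm (u + v) ^+ 2) - rc (nrm (u - v) ^+ 2)
     + 'i * rc (nrm (u + 'i * v) ^+ 2) - 'i * rc (nrm (u - 'i * v) ^+ 2)).
Proof.
rewrite -!mul_conj !(rmorphD, rmorphN, rmorphM) /= conjCi.
have i2 : 'i * 'i = -1 :> C by rewrite -expr2 sqrCi.
set a := u^*; set b := v^*; set j := 'i in i2 *.
transitivity (4^-1 * (2 * u * b + 2 * v * a + 2 * (- (j * j)) * u * b + 2 * (j * j) * v * a)).
  by rewrite i2; field.
by ring.
Qed.

Definition ipsum s x y : C := \sum_(i <- s) x i * (y i)^*.

(** By polarization the partial inner products are combinations of partial sums of
    squares, which converge because they are monotone and bounded. *)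
Lemma cvg_ipsum x y : exists l : C, (fun s => ipsum s x y) @ tot --> l.
Proof.
exists (4^-1 * (rc (l2sq (x + y)) - rc (l2sq (x - y))
     + 'i * rc (l2sq (x + 'i *: y)) - 'i * rc (l2sq (x - 'i *: y)))).
rewrite (_ : (fun _ => _) = fun s => 4^-1 * (rc (l2sum s (x + y)) - rc (l2sum s (x - y))
     + 'i * rc (l2sum s (x + 'i *: y)) - 'i * rc (l2sum s (x - 'i *: y)))); last first.
  apply/funext => s; rewrite /ipsum /l2sum.
  have rs (z : l2) : rc (\sum_(i <- s) nrm (z i) ^+ 2) = \sum_(i <- s) rc (nrm (z i) ^+ 2).
    exact: (raddf_sum (real_complex R)).
  rewrite !rs !mulr_sumr -!sumrB -big_split /= -sumrB mulr_sumr.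
  apply: eq_bigr => i _; exact: polarization.
have cc (k : C) (f : {fset I} -> C) (l : C) : f @ tot --> l -> (fun s => k * f s) @ tot --> k * l.
  by move=> fl; apply: cvgM fl; exact: cvg_cst.
exact: (cc _ _ _ (cvgB (cvgD (cvgB (cvg_l2sum (x + y)) (cvg_l2sum (x - y)))
  (cc _ _ _ (cvg_l2sum (x + 'i *: y)))) (cc _ _ _ (cvg_l2sum (x - 'i *: y))))).
Qed.

Definition ip x y : C := xget 0 [set l | (fun s => ipsum s x y) @ tot --> l].

Lemma ipP x y : (fun s => ipsum s x y) @ tot --> ip x y.
Proof.
by have [l Hl] := cvg_ipsum x y; exact: (@xgetPex _ (0 : C) [set l : C | _] (ex_intro _ l Hl)).
Qed.

Arguments ipP : clear implicits.

Lemma cvg_tot_unique (f : {fset I} -> C) (l m : C) : f @ tot --> l -> f @ tot --> m -> l = m.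
Proof. exact: (@cvg_unique _ (@norm_hausdorff _ C^o)). Qed.

Lemma ip_linear x : forall (c : C) y z, ip (c *: y + z) x = c * ip y x + ip z x.
Proof.
move=> c y z; apply: (cvg_tot_unique (ipP (c *: y + z) x)).
rewrite (_ : (fun _ => _) = fun s => c * ipsum s y x + ipsum s z x); last first.
  apply/funext => s; rewrite /ipsum mulr_sumr -big_split; apply: eq_bigr => i _ /=.
  transitivity ((c * y i + z i) * (x i)^*); first by [].
  by rewrite mulrDl mulrA.
exact: (cvgD (cvgM (cvg_cst c) (ipP y x)) (ipP z x)).
Qed.

Lemma ip_herm x y : ip x y = (ip y x)^*.
Proof.
apply: (cvg_tot_unique (ipP x y)).
rewrite (_ : (fun _ => _) = fun s => (ipsum s y x)^*); last first.
  apply/funext => s; rewrite /ipsum rmorph_sum; apply: eq_bigr => i _ /=.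
  by rewrite rmorphM /= conjCK mulrC.
apply/cvg_nrmP => e e0; have /cvg_nrmP /(_ e e0) := ipP y x.
by apply: filterS => s; rewrite -rmorphB nrm_conj.
Qed.

Lemma ip_sq x : ip x x = rc (l2sq x).
Proof.
apply: (cvg_tot_unique (ipP x x)).
rewrite (_ : (fun _ => _) = fun s => rc (l2sum s x)); first exact: cvg_l2sum.
apply/funext => s; rewrite /l2sum [RHS](raddf_sum (real_complex R)).
by apply: eq_bigr => i _; exact: mul_conj.
Qed.

Lemma ip_bilinear : bilinear_for *%R (Num.conj \; *%R) ip.
Proof.
split=> [x c y z|x c y z]; first exact: ip_linear.
by rewrite ip_herm ip_linear rmorphD rmorphM /= -!ip_herm.
Qed.

Lemma ip_gt0 x : x != 0 -> 0 < ip x x.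
Proof.
move=> x0; rewrite ip_sq -[0](rc0 R) rc_lt lt_neqAle l2sq_ge0 andbT eq_sym.
by apply: contra x0 => /eqP /l2sq_eq0 ->.
Qed.

Lemma ip_hermitian x y : ip x y = (-1) ^+ false * (ip y x)^*.
Proof. by rewrite expr0 mul1r ip_herm. Qed.

HB.instance Definition _ :=
  bilinear_isBilinear.Build C l2 l2 C *%R (Num.conj \; *%R) ip ip_bilinear.
HB.instance Definition _ :=
  isHermitianSesquilinear.Build C l2 false (@Num.conj C) ip ip_hermitian.
HB.instance Definition _ := isDotProduct.Build C l2 ip ip_gt0.

Definition l2dot : {dot l2 for (@Num.conj C)} := ip.

Lemma l2dotP : is_inner_product l2dot.
Proof. by move=> x; rewrite [LHS]ip_sq -l2norm_sq rcX. Qed.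

Lemma ip_le x y (e : R) : 0 < e -> nrm (ip x y) <= e * l2sq x + e^-1 * l2sq y.
Proof.
move=> e0; rewrite leNgt; apply/negP => lt_ip.
set M := _ + _ in lt_ip; have d0 : 0 < nrm (ip x y) - M by rewrite subr_gt0.
have /cvg_nrmP /(_ _ d0) [s /(_ s (fsubset_refl _))] := ipP x y.
apply/negP; rewrite -leNgt.
have : nrm (ipsum s x y) <= M.
  apply: le_trans (nrm_sum _ _) _.
  apply: (@le_trans _ _ (e * l2sum s x + e^-1 * l2sum s y)).
    rewrite /l2sum !mulr_sumr -big_split; apply: ler_sum => i _.
    rewrite nrmM nrm_conj /=; set p := nrm _; set q := nrm _.
    have : 0 <= e^-1 * (e * p - q) ^+ 2 by rewrite mulr_ge0 ?sqr_ge0 // invr_ge0 ltW.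
    have -> : e^-1 * (e * p - q) ^+ 2 = e * p ^+ 2 - 2 * (p * q) + e^-1 * q ^+ 2.
      by field; rewrite gt_eqF.
    have : 0 <= p * q by rewrite mulr_ge0 ?nrm_ge0.
    by lra.
  have e1 : 0 < e^-1 by rewrite invr_gt0.
  by apply: lerD; rewrite ler_pM2l // l2sum_le.
have := nrmD (ip x y - ipsum s x y) (ipsum s x y); rewrite subrK; lra.
Qed.

Lemma l2_supp_fset i (u : C) : l2_pred (fun j => if j == i then u else 0).
Proof.
apply/asboolP; exists (nrm u ^+ 2) => s; rewrite /l2sum.
have [si|si] := boolP (i \in s).
  rewrite (big_fsetD1 i) //= eqxx big1_fset ?addr0 // => j.
  by rewrite !inE => /andP[/negPf -> _] _; rewrite nrm0 expr0n.
rewrite big1_fset ?exprn_ge0 ?nrm_ge0 // => j js _; case: eqP => [e|_].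
  by rewrite -e js in si.
by rewrite nrm0 expr0n.
Qed.

Definition delta i : l2 := L2 (l2_supp_fset i 1).

Lemma l2norm_delta i : l2norm (delta i) = 1.
Proof.
apply/eqP; rewrite -(@eqrXn2 _ 2) ?l2norm_ge0 // expr1n l2norm_sq; apply/eqP/le_anti/andP; split.
  apply: l2sq_le => s; rewrite /l2sum.
  have [si|si] := boolP (i \in s).
    rewrite (big_fsetD1 i) //= eqxx nrm1 expr1n big1_fset ?addr0 // => j.
    by rewrite !inE => /andP[/negPf -> _] _; rewrite nrm0 expr0n.
  rewrite big1_fset ?ler01 // => j js _ /=; case: eqP => [e|_].
    by rewrite -e js in si.
  by rewrite nrm0 expr0n.
by apply: le_trans (l2sq_coord _ i); rewrite /= eqxx nrm1 expr1n.
Qed.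

Lemma ip_delta x i : ip x (delta i) = x i.
Proof.
apply: (cvg_tot_unique (ipP x (delta i))).
apply/cvg_nrmP => e e0; exists [fset i]%fset => s si.
rewrite /ipsum (big_fsetD1 i) /=; last by rewrite -fsub1set.
rewrite eqxx conjC1 mulr1 big1_fset ?addr0 ?subrr ?nrm0 // => j.
by rewrite !inE => /andP[/negPf -> _] _; rewrite conjC0 mulr0.
Qed.

Lemma l2_truncate x (e : R) : 0 < e ->
  exists s, l2sq (x - \sum_(i <- s) x i *: delta i) <= e.
Proof.
move=> e0; have [_ [s _ <-] Hs] := sup_adherent e0 (l2sq_has_sup x).
exists s; set r := x - _.
have rE i : r i = if i \in s then 0 else x i.
  have -> : r i = x i - (\sum_(j <- s) x j *: delta j) i by [].
  have -> : (\sum_(j <- s) x j *: delta j) i = \sum_(j <- s) x j * (if i == j then 1 else 0).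
    elim/big_ind2: _ => [|y1 z1 y2 z2 <- <- |] //.
  case: ifPn => si.
    rewrite (big_fsetD1 i) //= eqxx big1_fset ?addr0 ?mulr1 ?subrr // => j.
    by rewrite !inE eq_sym => /andP[/negPf -> _] _; rewrite mulr0.
  rewrite big1_fset ?subr0 // => j js _; case: eqP => [ej|_]; last by rewrite mulr0.
  by rewrite ej js in si.
apply: l2sq_le => t.
have : l2sum (s `|` t)%fset x <= l2sq x by exact: l2sum_le.
rewrite /l2sum (fsum_split _ (fsubsetUl s t)) -!/(l2sum _ _) -/(l2sq x) in Hs *.
have : l2sum t r <= \sum_(i <- (s `|` t)%fset | i \notin s) nrm (x i) ^+ 2.
  rewrite [X in _ <= X](_ : _ = l2sum (s `|` t)%fset r).
    exact/l2sum_mono/fsubsetUr.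
  rewrite /l2sum big_mkcond; apply: eq_bigr => i _; rewrite rE.
  by case: (i \in s) => //=; rewrite nrm0 expr0n.
move=> h1 h2; apply: le_trans h1 _; rewrite -(lerD2l (l2sum s x)).
by apply: le_trans h2 _; rewrite -lerBlDr ltW.
Qed.

Lemma ipDr x y z : ip x (y + z) = ip x y + ip x z.
Proof. by rewrite -[y]scale1r (ip_bilinear.2 x) /= conjC1 mul1r scale1r. Qed.

Lemma ip0r x : ip x 0 = 0.
Proof. by apply: (addrI (ip x 0)); rewrite -ipDr !addr0. Qed.

Lemma ipZr x (c : C) y : ip x (c *: y) = c^* * ip x y.
Proof. by rewrite -[c *: y]addr0 (ip_bilinear.2 x) /= ip0r addr0. Qed.

(** Adjointness extends from the basis vectors to l2 by truncation, the bound on T'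
    controlling the error. *)
Lemma ip_adjoint (T T' : l2 -> l2) (K : R) : 0 <= K ->
  linear T' -> (forall x, l2sq (T' x) <= K * l2sq x) ->
  (forall x i, ip (T x) (delta i) = ip x (T' (delta i))) ->
  forall x y, ip (T x) y = ip x (T' y).
Proof.
move=> K0 linT' bT' H x y.
have T'D u v : T' (u + v) = T' u + T' v by rewrite -[u]scale1r linT' !scale1r.
have T'0 : T' 0 = 0 by apply: (addrI (T' 0)); rewrite -T'D !addr0.
have T'Z c u : T' (c *: u) = c *: T' u by rewrite -[c *: u]addr0 linT' T'0 addr0.
have Hs (s : {fset I}) : ip (T x) (\sum_(i <- s) y i *: delta i) =
                  ip x (T' (\sum_(i <- s) y i *: delta i)).
  elim: (enum_fset s) => [|i r IH]; first by rewrite big_nil T'0 !ip0r.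
  by rewrite big_cons ipDr T'D ipDr IH T'Z !ipZr H.
apply: (@eq_le_nrm _ _ _ (l2sq (T x) + l2sq x + 1 + K)) => e e0.
have [s Hr] := l2_truncate y (mulr_gt0 e0 e0); set r := y - _ in Hr.
have -> : y = r + \sum_(i <- s) y i *: delta i by rewrite /r subrK.
clearbody r; rewrite T'D !ipDr Hs opprD addrACA subrr addr0.
apply: le_trans (nrmD _ _) _; rewrite nrmN.
have h1 := ip_le (T x) r e0; have h2 := ip_le x (T' r) e0.
have e1 : 0 < e^-1 by rewrite invr_gt0.
have h3 : e^-1 * l2sq r <= e.
  by rewrite -ler_pdivlMl // invrK.
have h4 : e^-1 * l2sq (T' r) <= K * e.
  apply: (@le_trans _ _ (e^-1 * (K * l2sq r))); first by rewrite ler_pM2l.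
  by rewrite mulrCA ler_wpM2l.
apply: (le_trans (lerD h1 h2)).
apply: le_trans (lerD (lerD (lexx _) h3) (lerD (lexx _) h4)) _.
by rewrite le_eqVlt; apply/orP; left; apply/eqP; ring.
Qed.

End L2.

(** * The regular representation *)

Section RegularRepresentation.
Variables (R : realType) (n : nat).
Local Notation C := (Cplx R).
Local Notation X := (infinite_word n).
Local Notation G := (cuntz_groupoid n).
Local Notation I := (infinite_word n * int)%type.
Implicit Types (a b c d : seq 'I_n) (F : X -> C) (f : G -> C) (u v : I -> C).

(** The regular representation, on functions of a word and an integer. The integer
    keeps track of the degree, so that different arrows with the same range and
    source act differently ([act_value]). *)
Definition act f u : I -> C := fun q =>
  \sum_(h \in [set h | grange h = q.1]) f h * u (gsource h, q.2 - gdegree h).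

Definition gmove a b (q : I) : I :=
  (wcat b (wshift (size a) q.1), q.2 - (size a)%:Z + (size b)%:Z).

Lemma gmoveK a b q : wtake (size a) q.1 = a -> gmove b a (gmove a b q) = q.
Proof.
by case: q => x i /= e; rewrite /gmove /= wshift_wcat -(wcat_eqP e); congr (_, _); lia.
Qed.

Lemma act_glift a b F u q : act (glift a b F) u q =
  if wtake (size a) q.1 == a then F (wshift (size a) q.1) * u (gmove a b q) else 0.
Proof.
case: q => x i; rewrite /act /=; case: eqP => [ea|na]; last first.
  rewrite fsbig1 // => h hx; rewrite glift_out ?mul0r // => /basic_openP[w ew].
  by apply: na; rewrite -hx ew grange_arr wtake_wcat.
set h0 := arr a b (wshift (size a) x).
rewrite -[LHS](@fsbig_widen _ _ _ _ [set h0]).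
- rewrite fsbig_set1 glift_arr gsource_arr gdegree_arr /gmove /=.
  by congr (_ * u (_, _)); lia.
- by move=> _ ->; rewrite /= grange_arr -(wcat_eqP ea).
- move=> h [hx nh]; rewrite /= glift_out ?mul0r // => /basic_openP[w ew]; apply: nh.
  by rewrite /= ew /h0 -hx ew grange_arr wshift_wcat.
Qed.

Lemma act0l u : act 0 u = 0.
Proof. by apply/funext => q; rewrite /act fsbig1 // => h _; exact: mul0r. Qed.

Lemma actDl f1 f2 u : Cc f1 -> Cc f2 -> act (f1 + f2) u = act f1 u + act f2 u.
Proof.
move=> h1 h2; apply/funext => q.
have -> : (act f1 u + act f2 u) q = act f1 u q + act f2 u q by [].
rewrite /act; pose D f := [set h : G | grange h = q.1 /\ f h != 0].
have E f : f = f1 \/ f = f2 \/ f = f1 + f2 ->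
    \sum_(h \in [set h | grange h = q.1]) f h * u (gsource h, q.2 - gdegree h) =
    \sum_(h \in D f1 `|` D f2) f h * u (gsource h, q.2 - gdegree h).
  move=> ef; symmetry; apply: fsbig_widen; first by move=> h [[]|[]].
  move=> h [hx nh] /=; apply/eqP; rewrite mulf_eq0; apply/orP; left.
  have z1 : f1 h = 0 by apply/eqP; apply: contraT => nz; case: nh; left.
  have z2 : f2 h = 0 by apply/eqP; apply: contraT => nz; case: nh; right.
  by case: ef => [->|[->|->]]; rewrite ?fctE ?z1 ?z2 ?addr0.
rewrite !E; try by [left|right; left|right; right].
rewrite -fsbig_split; last by rewrite finite_setU; split; exact: finite_range_fiber.
by apply: eq_fsbigr => h _; exact: mulrDl.
Qed.

Lemma act_linear f : Cc f -> forall (c : C) u v, act f (c *: u + v) = c *: act f u + act f v.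
Proof.
move=> hf c u v; move: f hf; apply: Cc_ind => [|a b F f cF cf IH].
  by rewrite !act0l scaler0 addr0.
have cl := Cc_glift a b cF.
rewrite !actDl // IH scalerDr addrACA; congr (_ + _); apply/funext => q.
have -> : (c *: act (glift a b F) u + act (glift a b F) v) q =
  c * act (glift a b F) u q + act (glift a b F) v q by [].
rewrite !act_glift; case: eqP => _; last by rewrite mulr0 addr0.
have -> : (c *: u + v) (gmove a b q) = c * u (gmove a b q) + v (gmove a b q) by [].
by ring.
Qed.

Lemma act_conv f1 f2 u : Cc f1 -> Cc f2 -> act (convolution f1 f2) u = act f1 (act f2 u).
Proof.
move=> h1 h2; move: f1 h1; apply: Cc_ind => [|a b F f cF cf IH].
  by rewrite conv0l !act0l.
have cl := Cc_glift a b cF.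
rewrite convDl // !actDl //; [|exact: Cc_conv..].
rewrite IH; congr (_ + _); apply/funext => -[x i]; rewrite act_glift.
rewrite {1}/act /=; case: eqP => [ea|na]; last first.
  by rewrite fsbig1 // => h /= hx; rewrite conv_glift hx; case: eqP => // _; rewrite mul0r.
rewrite /act mulr_fsumr.
rewrite [RHS](@reindex_fsbig _ _ _ _ _ (gswap a b) [set h | grange h = x]).
  apply: eq_fsbigr => h /set_mem /= hx; rewrite conv_glift hx ea eqxx.
  rewrite gsource_swap gdegree_swap -mulrA; congr (_ * (_ * u (_, _))); lia.
split=> [h /= hx|h k /set_mem /= hx /set_mem /= kx e|h /= hx].
- by rewrite grange_swap hx.
- by rewrite -[h](@gswapK _ a b) ?hx // e gswapK ?kx.
- exists (gswap b a h); last by rewrite gswapK ?hx // wtake_wcat.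
  by rewrite /= grange_swap hx wshift_wcat -(wcat_eqP ea).
Qed.

(** On one bisection the action is an injective change of variables followed by
    multiplication by F, which is bounded. *)
Lemma act_bounded f : Cc f -> exists2 K : R, 0 <= K &
  forall u (M : R), (forall s : {fset I}, l2sum s u <= M) -> forall s, l2sum s (act f u) <= K * M.
Proof.
move: f; apply: Cc_ind => [|a b F f cF cf [K K0 HK]].
  exists 0 => // u M _ s; rewrite act0l mul0r /l2sum big1 // => i _.
  by rewrite nrm0 expr0n.
have cl := Cc_glift a b cF; have [N N0 HN] := ccont_bounded cF.
exists ((1 + 1) * (N ^+ 2) + (1 + 1^-1) * K).
  by rewrite addr_ge0 // mulr_ge0 ?exprn_ge0 // ?addr_ge0 // invr1.
move=> u M HM s; rewrite actDl //.
apply: (le_trans (l2sumD s (act (glift a b F) u) (act f u) ltr01)).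
have -> : ((1 + 1) * N ^+ 2 + (1 + 1^-1) * K) * M =
    (1 + 1) * (N ^+ 2 * M) + (1 + 1^-1) * (K * M) by rewrite invr1; ring.
apply: lerD; apply: ler_wpM2l; rewrite ?invr1 ?addr_ge0 //; last exact: HK.
pose S : {fset I} := [fset q in s | wtake (size a) q.1 == a]%fset.
apply: (@le_trans _ _ (N ^+ 2 * l2sum [fset gmove a b q | q in S]%fset u)); last first.
  by rewrite ler_wpM2l ?exprn_ge0.
have injS : {in S &, injective (gmove a b)}.
  move=> p q; rewrite !inE => /andP[_ /eqP ep] /andP[_ /eqP eq_] e.
  by rewrite -(gmoveK b ep) e gmoveK.
rewrite /l2sum big_imfset //= mulr_sumr.
rewrite (fsum_split (s := S) (t := s)); last by apply/fsubsetP => q; rewrite !inE => /andP[].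
rewrite [X in _ + X]big1_seq ?addr0; last first.
  move=> q; rewrite !inE => /andP[+ qs]; rewrite qs /= act_glift => /negPf ->.
  by rewrite nrm0 expr0n.
rewrite big_seq [X in _ <= X]big_seq; apply: ler_sum => q; rewrite !inE => /andP[_ eq_].
by rewrite act_glift eq_ nrmM exprMn ler_wpM2r ?exprn_ge0 ?nrm_ge0 // ler_sqr ?nnegrE ?nrm_ge0.
Qed.

(** The default value is reached only outside C_c(G), where square-summability may
    fail. *)
Definition regrep f (x : l2 R I) : l2 R I := insubd 0 (act f x).

Lemma regrepE f (x : l2 R I) : Cc f -> regrep f x = act f x :> (I -> C).
Proof.
move=> cf; rewrite /regrep -[LHS]/(val (insubd 0 (act f x))) insubdK //.
have [K K0 HK] := act_bounded cf; apply/asboolP; exists (K * l2sq x).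
by apply: HK => s; exact: l2sum_le.
Qed.

Lemma regrep_bounded f : Cc f -> exists2 K : R, 0 <= K & forall x, l2sq (regrep f x) <= K * l2sq x.
Proof.
move=> cf; have [K K0 HK] := act_bounded cf; exists K => // x.
apply: l2sq_le => s; rewrite regrepE //; apply: HK => t; exact: l2sum_le.
Qed.

Lemma regrep_linear f : Cc f -> linear (regrep f).
Proof.
move=> cf c x y; apply: val_inj => /=; rewrite regrepE // act_linear //.
by rewrite -!regrepE.
Qed.

Lemma regrep_continuous f : Cc f -> continuous (regrep f).
Proof.
move=> cf x; have [K K0 HK] := regrep_bounded cf.
have lin := regrep_linear cf.
apply/(@cvg_rnormP R _ _ (nbhs (x : l2 R I)) _) => e e0.
have eK : 0 < e / (Num.sqrt K + 1) by rewrite divr_gt0 // ltr_wpDl ?sqrtr_ge0.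
have /cvg_rnormP /(_ _ eK) : (fun y => y) @ x --> x by exact: cvg_id.
apply: filterS => y; rewrite ltr_pdivlMr ?ltr_wpDl ?sqrtr_ge0 // => xy.
have -> : regrep f x - regrep f y = regrep f (x - y).
  by rewrite addrC -scaleN1r -lin scaleN1r addrC.
apply: le_lt_trans xy; rewrite !l2_rnormE /l2norm.
apply: (@le_trans _ _ (Num.sqrt (K * l2sq (x - y)))); first by rewrite ler_wsqrtr.
by rewrite sqrtrM // mulrC ler_wpM2l ?sqrtr_ge0 // lerDl.
Qed.

Lemma involutionD f1 f2 : involution (f1 + f2) = involution f1 + involution f2 :> (G -> C).
Proof. by apply/funext => g; rewrite /involution; exact: rmorphD. Qed.

Lemma involution0 : involution 0 = 0 :> (G -> C).
Proof. by apply/funext => g; rewrite /involution; exact: conjC0. Qed.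

Lemma ccont_conj F : ccont F -> ccont (fun w => (F w)^*).
Proof.
move=> /ccontP cF; apply/ccontP => w e e0; have [k Hk] := cF w e e0.
by exists k => y /Hk; rewrite -rmorphB nrm_conj.
Qed.

Lemma Cc_involution f : Cc f -> Cc (involution f).
Proof.
move: f; apply: Cc_ind => [|a b F f cF cf IH]; first by rewrite involution0; exact: Cc0.
rewrite involutionD; apply: Cc_add IH; rewrite involution_glift.
exact/Cc_glift/ccont_conj.
Qed.

(** On one bisection adjointness holds because [gmove a b] and [gmove b a] are
    mutually inverse. *)
Lemma regrep_delta f (x : l2 R I) q : Cc f ->
  ip (regrep f x) (delta R q) = ip x (regrep (involution f) (delta R q)).
Proof.
move=> cf; rewrite ip_delta regrepE //; move: f cf; apply: Cc_ind => [|a b F f cF cf IH].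
  rewrite act0l involution0 (_ : regrep 0 _ = 0) ?ip0r //.
  by apply: val_inj => /=; rewrite regrepE ?act0l //; exact: Cc0.
have cl := Cc_glift a b cF; have cl' := Cc_glift b a (ccont_conj cF).
rewrite actDl // involutionD involution_glift.
have -> : regrep (glift b a (fun w => (F w)^*) + involution f) (delta R q) =
    regrep (glift b a (fun w => (F w)^*)) (delta R q) + regrep (involution f) (delta R q).
  have ci := Cc_involution cf.
  by apply: val_inj => /=; rewrite !regrepE ?actDl //; exact: Cc_add.
rewrite ipDr -IH; congr (_ + _); rewrite act_glift.
have E p : regrep (glift b a (fun w => (F w)^*)) (delta R q) p =
    if (wtake (size b) p.1 == b) && (gmove b a p == q)
    then (F (wshift (size b) p.1))^* else 0.
  rewrite regrepE // act_glift /=; case: eqP => //= _.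
  by case: eqP => _; rewrite ?mulr1 ?mulr0.
case: eqP => [ea|na].
  rewrite (_ : regrep _ _ = (F (wshift (size a) q.1))^* *: delta R (gmove a b q)).
    by rewrite ipZr conjCK ip_delta.
  apply: l2P => p; rewrite E l2_scaleE /=; have [->|np] := eqVneq p (gmove a b q).
    by rewrite gmoveK // eqxx /= wtake_wcat eqxx wshift_wcat mulr1.
  rewrite mulr0; case: ifP => // /andP[/eqP pb /eqP pq].
  by case/eqP: np; rewrite -pq gmoveK.
rewrite (_ : regrep _ _ = 0) ?ip0r //; apply: l2P => p; rewrite E.
by case: ifP => // /andP[_ /eqP pq]; case: na; rewrite -pq /= wtake_wcat.
Qed.

Lemma regrep_star : star_representation (@l2dot R I) regrep.
Proof.
split.
- by move=> f cf; split; [exact: regrep_linear | exact: regrep_continuous].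
- move=> c f1 f2 h1 h2 x; apply: val_inj => /=.
  have h3 := Cc_comb c h1 h2; rewrite !regrepE //.
  apply/funext => q; rewrite actDl //; last exact: Cc_scale.
  have -> : (act (c *: f1) x + act f2 x) q = act (c *: f1) x q + act f2 x q by [].
  have -> : (c *: act f1 x + act f2 x) q = c * act f1 x q + act f2 x q by [].
  congr (_ + _); rewrite /act mulr_fsumr; apply: eq_fsbigr => h _.
  by rewrite mulrA.
- move=> f1 f2 h1 h2 x; apply: val_inj => /=.
  by rewrite !regrepE ?act_conv //; exact: Cc_conv.
- move=> f cf x y; have ci := Cc_involution cf.
  have [K K0 HK] := regrep_bounded ci.
  apply: (@ip_adjoint _ _ (regrep f) (regrep (involution f)) K K0 _ HK).
    exact: regrep_linear.
  by move=> z q; exact: regrep_delta.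
Qed.

Lemma act_value f g : act f (delta R (gsource g, 0)) (grange g, gdegree g) = f g.
Proof.
rewrite /act -[LHS](@fsbig_widen _ _ _ _ [set g]).
- by rewrite fsbig_set1 /= subrr eqxx mulr1.
- by move=> _ ->.
- move=> h [/= hr nh]; case: eqP => [[es ed]|_]; last by rewrite mulr0.
  by case: nh; apply: arrow_eq => //; lia.
Qed.

(** The value f g is the coefficient of f in the regular representation between the
    basis vectors attached to the source and to the range of g. *)
Lemma le_groupoid_norm f g : Cc f -> ((nrm (f g))%:E <= groupoid_norm f)%E.
Proof.
move=> cf; apply: (@le_trans _ _ (operator_norm (regrep f))); last first.
  apply: ereal_sup_ubound; exists (l2 R I), (@l2dot R I), regrep.
  by split=> //; [exact: l2dotP | exact: regrep_star].
apply: (@le_trans _ _ (rnorm (regrep f (delta R (gsource g, 0))))%:E).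
  rewrite lee_fin l2_rnormE -[f g](act_value f g) -regrepE //.
  exact: l2norm_coord.
apply: ereal_sup_ubound; exists (delta R (gsource g, 0)) => //=.
by rewrite l2_rnormE l2norm_delta.
Qed.

End RegularRepresentation.

(** * Convergence of sequences *)

Section Completeness.
Variable R : realType.
Local Notation C := (Cplx R).

Lemma rnorm_complete (V : completeNormedModType C) (u : nat -> V) :
  (forall e : R, 0 < e -> exists N, forall k, (N <= k)%N -> rnorm (u N - u k) < e) ->
  exists l : V, u @ \oo --> l.
Proof.
move=> H; suff cu : cvg (u @ \oo) by exists (lim (u @ \oo)).
apply: cauchy_cvg; apply: cauchy_exP => _ /rc_gt0P[e e0 ->].
have [N HN] := H e e0; exists (u N); exists N => // k /= /HN.
by rewrite -ball_normE /= rnormE rc_lt.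
Qed.

(** C is isometric to l2 over a one-element set, hence complete. *)
Lemma nrm_complete (u : nat -> C) :
  (forall e : R, 0 < e -> exists N, forall k, (N <= k)%N -> nrm (u N - u k) < e) ->
  exists l : C, u @ \oo --> l.
Proof.
move=> H; pose v j : l2 R unit := u j *: delta R tt.
have [e e0|x /cvg_seq_rnormP Hx] := @rnorm_complete (l2 R unit) v.
  have [N HN] := H e e0; exists N => k /HN.
  by rewrite /v -scalerBl rnormZ l2_rnormE l2norm_delta mulr1.
exists (x tt); apply/cvg_seq_nrmP => e e0; have [N HN] := Hx e e0; exists N => k /HN.
apply: le_lt_trans; apply: le_trans (l2norm_coord (x - v k) tt).
have -> : (x - v k) tt = x tt - u k * (if tt == tt then 1 else 0) by [].
by rewrite eqxx mulr1.
Qed.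

Lemma expr_small (s e : R) : 0 <= s -> s < 1 -> 0 < e -> exists N, s ^+ N < e.
Proof.
move=> s0 s1 e0; have : GRing.exp s @ \oo --> 0 by apply: cvg_expr; rewrite ger0_norm.
move=> /cvgrPdist_lt /(_ e e0) [N _ /(_ N (leqnn N))] /=.
by rewrite sub0r normrN ger0_norm ?exprn_ge0 // => ?; exists N.
Qed.

(** Banach's fixed-point estimate: the increments are bounded by a geometric
    series. *)
Lemma contraction_complete (V : completeNormedModType C) (u : nat -> V) (s : R) :
  0 <= s -> s < 1 ->
  (forall k, rnorm (u k.+2 - u k.+1) <= s * rnorm (u k.+1 - u k)) ->
  exists l : V, u @ \oo --> l.
Proof.
move=> s0 s1 Hs; set c := rnorm (u 1%N - u 0%N).
have step k : rnorm (u k.+1 - u k) <= c * s ^+ k.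
  elim: k => [|k IH]; first by rewrite mulr1.
  by apply: le_trans (Hs k) _; rewrite exprS mulrCA ler_wpM2l.
have tele N j : (1 - s) * rnorm (u (N + j)%N - u N) <= c * (s ^+ N - s ^+ (N + j)).
  elim: j => [|j IH]; first by rewrite addn0 !subrr rnorm0 !mulr0.
  rewrite addnS; apply: (@le_trans _ _ ((1 - s) * (c * s ^+ (N + j) + rnorm (u (N + j)%N - u N)))).
    rewrite ler_pM2l ?subr_gt0 //; apply: le_trans (rnorm_tri (u (N + j)%N) _ _) _.
    by rewrite lerD2r.
  by rewrite mulrDr exprS; nra.
have c0 : 0 <= c by exact: rnorm_ge0.
apply: rnorm_complete => e e0.
have s1' : 0 < 1 - s by rewrite subr_gt0.
have [|N HN] := @expr_small s (e * (1 - s) / (c + 1)) s0 s1.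
  by rewrite divr_gt0 ?mulr_gt0 // ltr_wpDl.
exists N => k Nk; rewrite rnorm_dist -(subnKC Nk).
rewrite -(ltr_pM2l s1'); apply: le_lt_trans (tele _ _) _.
apply: (@le_lt_trans _ _ ((c + 1) * s ^+ N)).
  have : 0 <= s ^+ (N + (k - N)) by rewrite exprn_ge0.
  have : 0 <= s ^+ N by rewrite exprn_ge0.
  by nra.
by rewrite mulrC -ltr_pdivlMr ?ltr_wpDl // [_ * e]mulrC.
Qed.

Lemma cvg_seq_unique (V : normedModType C) (u : nat -> V) (l m : V) :
  u @ \oo --> l -> u @ \oo --> m -> l = m.
Proof. exact: (@cvg_unique _ (@norm_hausdorff _ V)). Qed.

End Completeness.

(** * Unital C*-algebras *)

Section CStar.
Variables (R : realType) (A : cstarAlgType (Cplx R)).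
Local Notation C := (Cplx R).
Implicit Types x y z h : A.

Lemma cmul0x x : 0 ** x = 0.
Proof. by apply: (addrI (0 ** x)); rewrite -cmulDl !addr0. Qed.
Lemma cmulx0 x : x ** 0 = 0.
Proof. by apply: (addrI (x ** 0)); rewrite -cmulDr !addr0. Qed.
Lemma cmulNx x y : (- x) ** y = - (x ** y).
Proof. by rewrite -scaleN1r cmulZl scaleN1r. Qed.
Lemma cmulxN x y : x ** (- y) = - (x ** y).
Proof. by rewrite -scaleN1r cmulZr scaleN1r. Qed.
Lemma cmulBl x y z : (x - y) ** z = x ** z - y ** z.
Proof. by rewrite cmulDl cmulNx. Qed.
Lemma cmulBr x y z : z ** (x - y) = z ** x - z ** y.
Proof. by rewrite cmulDr cmulxN. Qed.
Lemma star0 : star (0 : A) = 0.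
Proof. by apply: (addrI (star 0)); rewrite -starD !addr0. Qed.
Lemma starN x : star (- x) = - star x.
Proof. by rewrite -scaleN1r starZ rmorphN1 scaleN1r. Qed.
Lemma starB x y : star (x - y) = star x - star y.
Proof. by rewrite starD starN. Qed.
Lemma star1 : star (cunit : A) = cunit.
Proof. by rewrite -[LHS]cmul1x -[X in X ** _]starK -starM cmul1x starK. Qed.

Lemma rnorm_mul x y : rnorm (x ** y) <= rnorm x * rnorm y.
Proof. by rewrite -rc_le rcM -!rnormE cnormM. Qed.

Lemma rnorm_starM x : rnorm (star x ** x) = rnorm x ^+ 2.
Proof. by apply: rc_inj; rewrite rcX -!rnormE cnorm_starM. Qed.

Lemma rnorm_star x : rnorm (star x) = rnorm x.
Proof.
have le z : rnorm z <= rnorm (star z).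
  have [->|z0] := eqVneq (rnorm z) 0; first exact: rnorm_ge0.
  have zp : 0 < rnorm z by rewrite lt_neqAle eq_sym z0 rnorm_ge0.
  by rewrite -(ler_pM2r zp) -expr2 -rnorm_starM rnorm_mul.
by apply/le_anti; rewrite le -{2}[x]starK le.
Qed.

Lemma rnorm_proj x : star x ** x = x -> rnorm x <= 1.
Proof.
move=> e; have [->|x0] := eqVneq (rnorm x) 0; first exact: ler01.
have xp : 0 < rnorm x by rewrite lt_neqAle eq_sym x0 rnorm_ge0.
by rewrite -(ler_pM2r xp) mul1r -expr2 -rnorm_starM e.
Qed.

Lemma rnorm_unit_ball x : rnorm (star x ** x) <= 1 -> rnorm x <= 1.
Proof. by rewrite rnorm_starM -[X in _ <= X](expr1n _ 2) ler_sqr ?nnegrE ?rnorm_ge0. Qed.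

Lemma rnorm1 : rnorm (cunit : A) <= 1.
Proof. by apply: rnorm_proj; rewrite cmulx1 star1. Qed.

Lemma sub_squares y z : y ** y - z ** z = y ** (y - z) + (y - z) ** z.
Proof. by rewrite cmulBr cmulBl addrA subrK. Qed.

Lemma cvg_mul (u v : nat -> A) x y : u @ \oo --> x -> v @ \oo --> y ->
  (fun k => u k ** v k) @ \oo --> x ** y.
Proof.
move=> /cvg_seq_rnormP ux /cvg_seq_rnormP vy; apply/cvg_seq_rnormP => e e0.
pose K := rnorm x + rnorm y + 1.
have K1 : 1 <= K by rewrite lerDr addr_ge0 ?rnorm_ge0.
have K0 : 0 < K by exact: lt_le_trans ltr01 K1.
pose d := Num.min 1 (e / (2 * K)).
have d0 : 0 < d by rewrite lt_min ltr01 divr_gt0 // mulr_gt0.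
have [N HN] := ux d d0; have [M HM] := vy d d0.
exists (maxn N M) => k; rewrite geq_max => /andP[/HN hu /HM hv].
have -> : x ** y - u k ** v k = x ** (y - v k) + (x - u k) ** v k.
  by rewrite cmulBr cmulBl addrA subrK.
apply: le_lt_trans (rnormD _ _) _.
have hv' : rnorm (v k) <= rnorm y + 1.
  rewrite -[v k](subKr y); apply: le_trans (rnormD _ _) _; rewrite rnormN lerD2l.
  by apply: le_trans (ltW hv) _; rewrite ge_min lexx.
have dK : d * K <= e / 2.
  have : d <= e / (2 * K) by rewrite ge_min lexx orbT.
  by rewrite -(ler_pM2r K0); congr (_ <= _); field; rewrite gt_eqF.
have h1 := rnorm_mul x (y - v k); have h2 := rnorm_mul (x - u k) (v k).
have x0 := rnorm_ge0 x; have y0 := rnorm_ge0 y; have v0 := rnorm_ge0 (v k).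
have p1 : rnorm x * rnorm (y - v k) <= rnorm x * d by rewrite ler_wpM2l // ltW.
have p2 : rnorm (x - u k) * rnorm (v k) <= d * (rnorm y + 1).
  by apply: ler_pM; rewrite ?rnorm_ge0 // ltW.
rewrite /K in dK; nra.
Qed.

Lemma cvg_star (u : nat -> A) x : u @ \oo --> x -> (fun k => star (u k)) @ \oo --> star x.
Proof.
move=> /cvg_seq_rnormP ux; apply/cvg_seq_rnormP => e /ux[N HN].
by exists N => k /HN; rewrite -starB rnorm_star.
Qed.

(** The element z is the square root of 1 - h^2. It is obtained as 1 - l, where
    l = (h^2 + l^2) / 2 is the fixed point of a contraction of the ball of radius
    rnorm h. Then h + i z is unitary with real part h. *)
Lemma unitary_completion h : star h = h -> rnorm h < 1 ->
  exists2 z, star z = z & h ** z = z ** h /\ h ** h + z ** z = cunit.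
Proof.
move=> sh h1; set s := rnorm h in h1.
have s0 : 0 <= s by exact: rnorm_ge0.
(* The iterates of T from 0 are self-adjoint, commute with h and have norm at
   most s. *)
pose T y : A := 2^-1 *: (h ** h + y ** y).
pose y k := iter k T 0.
have yS k : y k.+1 = T (y k) by [].
have n2 : nrm (2^-1 : C) = 2^-1 by rewrite nrmV -rc_nat nrm_rc ger0_norm.
have hh : rnorm (h ** h) <= s ^+ 2 by rewrite expr2; exact: rnorm_mul.
have ybd k : rnorm (y k) <= s.
  elim: k => [|k IH]; first by rewrite rnorm0.
  rewrite yS /T rnormZ n2; apply: (@le_trans _ _ (2^-1 * (s ^+ 2 + s ^+ 2))).
    rewrite ler_pM2l ?invr_gt0 //; apply: le_trans (rnormD _ _) _; apply: lerD => //.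
    apply: le_trans (rnorm_mul _ _) _; rewrite expr2.
    by apply: ler_pM; rewrite ?rnorm_ge0.
  by nra.
have ysa k : star (y k) = y k.
  elim: k => [|k IH]; first exact: star0.
  rewrite yS /T starZ starD !starM sh IH.
  by rewrite fmorphV /= -rc_nat rc_conj.
have ycomm k : h ** y k = y k ** h.
  elim: k => [|k IH]; first by rewrite cmulx0 cmul0x.
  rewrite yS /T cmulZr cmulZl cmulDr cmulDl; congr (_ *: (_ + _)); first exact: cmulA.
  by rewrite cmulA IH -cmulA IH cmulA.
have TB a b : T a - T b = 2^-1 *: (a ** a - b ** b).
  by rewrite /T -scalerBr opprD addrACA subrr add0r.
have [|l yl] := @contraction_complete R A y s s0 h1.
  move=> k; rewrite [y k.+2]yS [X in _ - X]yS TB sub_squares rnormZ n2.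
  apply: (@le_trans _ _ (2^-1 * (s * rnorm (y k.+1 - y k) + s * rnorm (y k.+1 - y k)))).
    rewrite ler_pM2l ?invr_gt0 //; apply: le_trans (rnormD _ _) _.
    apply: lerD; apply: le_trans (rnorm_mul _ _) _; last rewrite mulrC;
      by rewrite ler_wpM2r ?rnorm_ge0.
  by rewrite le_eqVlt; apply/orP; left; apply/eqP; field.
have step : (fun k => y k.+1) @ \oo --> l by rewrite cvg_shiftS.
have yl2 := cvg_mul yl yl.
have lT : l = T l.
  apply: cvg_seq_unique step _; apply/cvg_seq_rnormP => e e0.
  have [N HN] := (cvg_seq_rnormP _ _).1 yl2 e e0; exists N => k /HN.
  apply: le_lt_trans; rewrite yS TB rnormZ n2 ler_piMl ?rnorm_ge0 //.
  by rewrite invf_le1 // ler1n.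
have lsa : star l = l.
  apply: cvg_seq_unique (cvg_star yl) _; rewrite (_ : (fun k => _) = y) //.
  by apply/funext => k; rewrite ysa.
have lcomm : h ** l = l ** h.
  apply: cvg_seq_unique (cvg_mul (cvg_cst h) yl) _.
  rewrite (_ : (fun k => _) = fun k => y k ** h); last by apply/funext => k.
  exact: cvg_mul yl (cvg_cst h).
exists (cunit - l); first by rewrite starB star1 lsa.
split; first by rewrite cmulBr cmulBl cmulx1 cmul1x lcomm.
have l2 : l + l = h ** h + l ** l.
  by rewrite {1 2}lT /T -scalerDl (_ : 2^-1 + 2^-1 = 1) ?scale1r //; field.
rewrite cmulBr !cmulBl cmulx1 cmulx1 cmul1x.
have -> : h ** h = l + (l - l ** l) by rewrite addrA l2 addrK.
by rewrite addrACA subrr addr0 addrC subrK.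
Qed.

(** A self-adjoint h with norm less than 1 is the mean of the unitaries h + i z and
    h - i z of [unitary_completion]; their images are unitary, of norm at most 1.
    The C*-identity reduces the general case to the self-adjoint one. *)
Lemma star_hom_contractive (phi : A -> A) : linear phi ->
  {morph phi : x y / x ** y} -> phi cunit = cunit -> {morph phi : x / star x} ->
  forall x, rnorm (phi x) <= rnorm x.
Proof.
move=> lin phiM phi1 phiS.
have phiD u v : phi (u + v) = phi u + phi v by rewrite -[u]scale1r lin !scale1r.
have phi0 : phi 0 = 0 by apply: (addrI (phi 0)); rewrite -phiD !addr0.
have phiZ c u : phi (c *: u) = c *: phi u by rewrite -[c *: u]addr0 lin phi0 addr0.
have ball h : star h = h -> rnorm h < 1 -> rnorm (phi h) <= 1.
  move=> sh h1; have [z sz [hz hz1]] := unitary_completion sh h1.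
  pose u := h + 'i *: z.
  have su : star u = h - 'i *: z by rewrite /u starD starZ conjCi sh sz scaleNr.
  have uu : star u ** u = cunit.
    rewrite su /u cmulBl !cmulDr !cmulZr !cmulZl hz opprD scalerA.
    have -> : 'i * 'i = -1 :> C by rewrite -expr2 sqrCi.
    by rewrite scaleN1r opprK addrA addrK.
  have nu : rnorm (phi u) <= 1.
    by apply: rnorm_unit_ball; rewrite -phiS -phiM uu phi1 rnorm1.
  have nu' : rnorm (phi (star u)) <= 1 by rewrite phiS rnorm_star.
  have -> : h = 2^-1 *: (u + star u).
    rewrite su /u addrACA subrr addr0 scalerDr -scalerDl.
    by rewrite (_ : 2^-1 + 2^-1 = 1) ?scale1r //; field.
  rewrite phiZ phiD rnormZ nrmV -rc_nat nrm_rc ger0_norm //.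
  by have := rnormD (phi u) (phi (star u)); lra.
have sa h : star h = h -> rnorm (phi h) <= rnorm h.
  move=> sh; rewrite leNgt; apply/negP => lt_h.
  have p0 : 0 < rnorm (phi h) by apply: le_lt_trans lt_h; exact: rnorm_ge0.
  pose m := (rnorm h + rnorm (phi h)) / 2.
  have m0 : 0 < m by rewrite divr_gt0 // ltr_wpDl ?rnorm_ge0.
  have nm : nrm (rc m^-1) = m^-1 by rewrite nrm_rc ger0_norm // invr_ge0 ltW.
  have := @ball (rc m^-1 *: h); rewrite starZ rc_conj sh phiZ !rnormZ nm => /(_ erefl).
  rewrite mulrC ltr_pdivrMr // mul1r mulrC ler_pdivrMr // mul1r => H.
  have : rnorm h < m by rewrite /m; lra.
  by move=> /H; rewrite /m; lra.
move=> x; rewrite -ler_sqr ?nnegrE ?rnorm_ge0 // -!rnorm_starM -phiS -phiM.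
by apply: sa; rewrite starM starK.
Qed.

End CStar.

(** * Values and norms in the groupoid algebra *)

Section GroupoidAlgebra.
Variables (R : realType) (n : nat).
Local Notation C := (Cplx R).
Local Notation X := (infinite_word n).
Local Notation G := (cuntz_groupoid n).
Variables (A : cstarAlgType C) (iota : (G -> C) -> A).
Hypothesis hA : is_groupoid_cstar_algebra iota.
Implicit Types (a b c d : seq 'I_n) (F : X -> C) (f h m : G -> C) (x y : A) (g : G).

Lemma iota_comb (k : C) f1 f2 : Cc f1 -> Cc f2 ->
  iota (k *: f1 + f2) = k *: iota f1 + iota f2.
Proof. by case: hA => H _ _ _ _; exact: H. Qed.
Lemma iota_conv f1 f2 : Cc f1 -> Cc f2 -> iota (convolution f1 f2) = iota f1 ** iota f2.
Proof. by case: hA => _ H _ _ _; exact: H. Qed.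
Lemma iota_star f : Cc f -> iota (involution f) = star (iota f).
Proof. by case: hA => _ _ H _ _; exact: H. Qed.
Lemma iota_norm f : Cc f -> (rnorm (iota f))%:E = groupoid_norm f.
Proof. by case: hA => _ _ _ H _; exact: H. Qed.

Lemma iota_approx x (e : R) : 0 < e -> exists2 f, Cc f & rnorm (x - iota f) < e.
Proof.
case: hA => _ _ _ _ dA e0; have [_ [f cf <-] xf] := dense_rnormP dA x e0.
by exists f.
Qed.

Lemma iota_add f1 f2 : Cc f1 -> Cc f2 -> iota (f1 + f2) = iota f1 + iota f2.
Proof. by move=> h1 h2; rewrite -{1}[f1]scale1r iota_comb // scale1r. Qed.
Lemma iota0 : iota 0 = 0.
Proof.
by apply: (addrI (iota 0)); rewrite -iota_add ?addr0 //; exact: Cc0.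
Qed.
Lemma iotaZ (k : C) f : Cc f -> iota (k *: f) = k *: iota f.
Proof.
by move=> h1; rewrite -{1}[k *: f]addr0 iota_comb ?iota0 ?addr0 //; exact: Cc0.
Qed.
Lemma iotaB f1 f2 : Cc f1 -> Cc f2 -> iota (f1 - f2) = iota f1 - iota f2.
Proof.
by move=> h1 h2; rewrite addrC -scaleN1r iota_comb // scaleN1r addrC.
Qed.
Lemma iota_sum (I : Type) (r : seq I) (Q : pred I) (f : I -> G -> C) :
  (forall i, Q i -> Cc (f i)) ->
  iota (\sum_(i <- r | Q i) f i) = \sum_(i <- r | Q i) iota (f i).
Proof.
move=> H; elim: r => [|i r IH]; first by rewrite !big_nil iota0.
rewrite !big_cons; case: ifP => Qi //.
by rewrite iota_add ?IH //; [exact: H | exact: Cc_sum].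
Qed.

Lemma iota_sup f g : Cc f -> nrm (f g) <= rnorm (iota f).
Proof. by move=> cf; rewrite -lee_fin iota_norm // le_groupoid_norm. Qed.

(** Precomposition with the gauge action maps representations of C_c(G) to
    representations, so it does not increase the supremum over all of them. *)
Lemma iota_twist_le z f : `|z| = 1 -> Cc f -> rnorm (iota (twist z f)) <= rnorm (iota f).
Proof.
move=> z1 cf; rewrite -lee_fin !iota_norm //; last exact: Cc_twist.
have z0 : z != 0 by rewrite -normr_eq0 z1 oner_eq0.
apply: ge_ereal_sup => _ [H [ip [pi [Hip [p1 p2 p3 p4] ->]]]].
apply: ereal_sup_ubound; exists H, ip, (fun f => pi (twist z f)); split=> //.
split=> [f' c'|k f1 f2 h1 h2 x|f1 f2 h1 h2 x|f' c' x y].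
- exact/p1/Cc_twist.
- by rewrite twist_comb p2 //; exact: Cc_twist.
- by rewrite -twist_conv // p3 //; exact: Cc_twist.
- by rewrite p4 ?twist_involution //; exact: Cc_twist.
Qed.

Lemma iota_seq x : exists2 f : nat -> G -> C, forall j, Cc (f j) &
  forall j, rnorm (x - iota (f j)) < j.+1%:R^-1.
Proof.
have H j : exists f, Cc f /\ rnorm (x - iota f) < j.+1%:R^-1.
  by have [|f cf xf] := @iota_approx x j.+1%:R^-1; [rewrite invr_gt0 | exists f].
by have [f Hf] := choice H; exists f => j; have [] := Hf j.
Qed.

Lemma inv_small (e : R) : 0 < e -> exists N, forall k, (N <= k)%N -> k.+1%:R^-1 < e.
Proof.
move=> e0; exists (Num.trunc e^-1) => k Nk.
rewrite invf_plt ?posrE //; apply: lt_le_trans (truncnS_gt _) _.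
by rewrite ler_nat ltnS.
Qed.

(** Evaluation at g is 1-Lipschitz from C_c(G) with the C*-norm to C. So sequences
    of C_c(G) that converge to x converge at g, to a common limit, and the
    Lipschitz bound survives in the limit. All properties of values follow from
    this estimate by approximation. *)
Lemma value_le x f g : Cc f -> nrm (value iota x g - f g) <= rnorm (x - iota f).
Proof.
move=> cf; set S := [set c : C | forall f : nat -> G -> C, (forall j, Cc (f j)) ->
  (fun j => iota (f j)) @ \oo --> x -> (fun j => f j g) @ \oo --> c].
have [F cF HF] := iota_seq x.
have Fx : (fun j => iota (F j)) @ \oo --> x.
  apply/cvg_seq_rnormP => e /inv_small[N HN]; exists N => k /HN.
  exact: lt_trans.
have S0 : exists k : C, S k.
  have [e e0|c Hc] := @nrm_complete R (fun j => F j g).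
    have e20 : 0 < e / 2 by rewrite divr_gt0.
    have [N HN] := (cvg_seq_rnormP _ _).1 Fx _ e20; exists N => k Nk.
    apply: le_lt_trans (iota_sup g (Cc_sub (cF N) (cF k))) _; rewrite iotaB //.
    apply: le_lt_trans (rnorm_tri x _ _) _; rewrite rnorm_dist.
    by have := HN N (leqnn _); have := HN k Nk; lra.
  exists c => F' cF' F'x; apply/cvg_seq_nrmP => e e0.
  have e30 : 0 < e / 3 by rewrite divr_gt0.
  have [N HN] := (cvg_seq_rnormP _ _).1 Fx _ e30.
  have [N' HN'] := (cvg_seq_rnormP _ _).1 F'x _ e30.
  have [M HM] := (cvg_seq_nrmP _ _).1 Hc _ e30.
  exists (maxn N (maxn N' M)) => k; rewrite !geq_max => /and3P[/HN h1 /HN' h2 /HM h3].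
  apply: le_lt_trans (nrm_tri (F k g) _ _) _.
  have := iota_sup g (Cc_sub (cF k) (cF' k)); rewrite iotaB // => h4.
  have := rnorm_tri x (iota (F k)) (iota (F' k)); rewrite (rnorm_dist _ x) => h5.
  have : nrm (F k g - F' k g) <= rnorm (iota (F k) - iota (F' k)) by exact: h4.
  by lra.
have Sv : S (value iota x g) by have [c Sc] := S0; exact: (xgetPex _ S0).
have /cvg_seq_nrmP Fv := Sv F cF Fx.
rewrite leNgt; apply/negP => lt_v.
have d0 : 0 < nrm (value iota x g - f g) - rnorm (x - iota f) by rewrite subr_gt0.
set d := _ - _ in d0; have d20 : 0 < d / 2 by rewrite divr_gt0.
have [N HN] := Fv _ d20; have [M HM] := (cvg_seq_rnormP _ _).1 Fx _ d20.
pose k := maxn N M; have := HN k (leq_maxl _ _); have := HM k (leq_maxr _ _).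
have := iota_sup g (Cc_sub (cF k) cf); rewrite iotaB // => h4.
have : nrm (F k g - f g) <= rnorm (iota (F k) - iota f) by exact: h4.
have := rnorm_tri x (iota (F k)) (iota f); have := nrm_tri (F k g) (value iota x g) (f g).
by rewrite (rnorm_dist (iota (F k)) x) /d; lra.
Qed.

Lemma value_iota f g : Cc f -> value iota (iota f) g = f g.
Proof.
move=> cf; apply: (@eq_le_nrm _ _ _ 0) => e e0.
by have := value_le (iota f) g cf; rewrite subrr rnorm0 mul0r.
Qed.

Lemma value_comb (k : C) x y g :
  value iota (k *: x + y) g = k * value iota x g + value iota y g.
Proof.
apply: (@eq_le_nrm _ _ _ (2 * (nrm k + 1))) => e e0.
have [f cf xf] := iota_approx x e0; have [h ch yh] := iota_approx y e0.
have h1 := value_le (k *: x + y) g (Cc_comb k cf ch).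
have h2 := value_le x g cf; have h3 := value_le y g ch.
rewrite iota_comb // in h1.
have e1 : (k *: x + y) - (k *: iota f + iota h) = k *: (x - iota f) + (y - iota h).
  by rewrite scalerBr opprD addrACA.
rewrite e1 in h1; have h4 := rnormD (k *: (x - iota f)) (y - iota h).
rewrite rnormZ in h4.
have h5 : nrm (k * value iota x g + value iota y g - (k *: f + h) g) <=
    nrm k * rnorm (x - iota f) + rnorm (y - iota h).
  have -> : k * value iota x g + value iota y g - (k *: f + h) g =
    k * (value iota x g - f g) + (value iota y g - h g).
    have -> : (k *: f + h) g = k * f g + h g by [].
    by ring.
  apply: le_trans (nrmD _ _) _; rewrite nrmM; apply: lerD => //.
  by rewrite ler_wpM2l ?nrm_ge0.
have h6 := nrm_tri ((k *: f + h) g) (value iota (k *: x + y) g)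
   (k * value iota x g + value iota y g).
rewrite (nrm_dist ((k *: f + h) g)) in h6.
have k0 := nrm_ge0 k.
have : nrm k * rnorm (x - iota f) <= nrm k * e by rewrite ler_wpM2l // ltW.
by move: h6 h1 h5 h4; lra.
Qed.

Lemma iota_mul_glift a b F F' : ccont F -> ccont F' ->
  star (iota (glift a b F)) ** iota (glift a b F') =
  iota (glift b b (fun w => (F w)^* * F' w)).
Proof.
move=> cF cF'; have c1 := Cc_glift a b cF; have c2 := Cc_glift a b cF'.
rewrite -iota_star // -iota_conv //; last exact: Cc_involution.
by rewrite involution_glift conv_glift_glift.
Qed.

(** If F has modulus 1, then [glift a b F] is a partial isometry. *)
Lemma iota_glift_unimod a b F : ccont F -> (forall w, nrm (F w) = 1) ->
  rnorm (iota (glift a b F)) <= 1.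
Proof.
have E : forall F', (forall w, nrm (F' w) = 1) -> (fun w => (F' w)^* * F' w) = fun=> 1.
  by move=> F' H; apply/funext => w; rewrite mulrC mul_conj H expr1n.
move=> cF F1; apply: rnorm_unit_ball; rewrite iota_mul_glift // E //.
have c1 := @ccont_cst R n 1.
apply: rnorm_proj; rewrite (iota_mul_glift b b c1 c1) E // => w.
exact: nrm1.
Qed.

Lemma ccont_rc_nrm2 F : ccont F -> ccont (fun w => rc (nrm (F w) ^+ 2)).
Proof.
move=> cF; rewrite (_ : (fun _ => _) = fun w => F w * (F w)^*).
  exact: ccontM cF (ccont_conj cF).
by apply/funext => w; rewrite mul_conj.
Qed.

Lemma ccont_rc_comp (t : X -> R) (p : R -> R) : continuous p ->
  ccont (fun w => rc (t w)) -> ccont (fun w => rc (p (t w))).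
Proof.
move=> cp /ccontP ct; apply/ccontP => w e e0.
have /cvgrPdist_lt /(_ e e0) /nbhs_ballP[d /= d0 Hd] := cp (t w).
have [k Hk] := ct w d d0; exists k => y /Hk; rewrite -!rcB !nrm_rc => H.
by apply: Hd; rewrite -ball_normE.
Qed.

(** A real t with |t| <= 1 is the mean of the two functions
    t + i (1 - t^2)^(1/2) and t - i (1 - t^2)^(1/2) of modulus 1. *)
Lemma iota_glift_real b (t : X -> R) : ccont (fun w => rc (t w)) ->
  (forall w, `|t w| <= 1) -> rnorm (iota (glift b b (fun w => rc (t w)))) <= 1.
Proof.
move=> ct t1; pose s w := Num.sqrt (1 - t w ^+ 2).
have cs : ccont (fun w => rc (s w)).
  apply: (@ccont_rc_comp t (fun z => Num.sqrt (1 - z ^+ 2))) => // z.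
  have H : (fun y : R => 1 - y ^+ 2) @ z --> (1 - z ^+ 2).
    by apply: cvgB; [exact: cvg_cst | exact: exprn_continuous].
  by apply: (cvg_comp _ _ H); exact: (@sqrt_continuous R (1 - z ^+ 2)).
pose u k w : C := rc (t w) + k * rc (s w).
have cu k : ccont (u k) by exact: ccontD ct (ccontM (@ccont_cst _ _ k) cs).
have u1 k : k * k^* = 1 -> k^* = - k -> forall w, nrm (u k w) = 1.
  move=> kk kJ w; apply/eqP; rewrite -(@eqrXn2 _ 2) ?nrm_ge0 // expr1n; apply/eqP/rc_inj.
  rewrite -mul_conj /u rmorphD rmorphM /= !rc_conj kJ.
  transitivity (rc (t w) ^+ 2 + (k * (- k)) * - rc (s w) ^+ 2 * -1 ); first by ring.
  have st : s w ^+ 2 = 1 - t w ^+ 2.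
    by apply: sqr_sqrtr; rewrite subr_ge0 -real_normK ?num_real // expr_le1 // t1.
  by rewrite -kJ kk mul1r mulrN1 opprK -!rcX -rcD st addrC subrK.
have i1 : 'i * 'i^* = 1 :> C by rewrite conjCi mulrN -expr2 sqrCi opprK.
have i2 : (- 'i) * (- 'i)^* = 1 :> C by rewrite rmorphN mulrNN.
have -> : glift b b (fun w => rc (t w)) =
    2^-1 *: (glift b b (u 'i) + glift b b (u (- 'i))).
  symmetry; apply: glift_eq => [w|g nU].
    have -> : (2^-1 *: (glift b b (u 'i) + glift b b (u (- 'i)))) (arr b b w) =
      2^-1 * (glift b b (u 'i) (arr b b w) + glift b b (u (- 'i)) (arr b b w)) by [].
    by rewrite !glift_arr /u; field.
  have -> : (2^-1 *: (glift b b (u 'i) + glift b b (u (- 'i)))) g =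
    2^-1 * (glift b b (u 'i) g + glift b b (u (- 'i)) g) by [].
  by rewrite !glift_out // addr0 mulr0.
have g1 := Cc_glift b b (cu 'i); have g2 := Cc_glift b b (cu (- 'i)).
rewrite (iotaZ _ (Cc_add g1 g2)) (iota_add g1 g2) rnormZ nrmV -rc_nat nrm_rc.
rewrite ger0_norm // ler_pdivrMl // mulr1.
apply: le_trans (rnormD _ _) _; rewrite (natrD _ 1 1).
apply: lerD; apply: iota_glift_unimod; [exact: cu|apply: u1|exact: cu|apply: u1].
- exact: i1.
- exact: conjCi.
- exact: i2.
- by rewrite rmorphN /= conjCi.
Qed.

(** The C*-identity replaces F, scaled by 1/M, with the real function |F|^2 on the
    unit space. *)
Lemma iota_glift_le a b F (M : R) : 0 < M -> ccont F -> (forall w, nrm (F w) <= M) ->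
  rnorm (iota (glift a b F)) <= M.
Proof.
move=> M0 cF FM; pose F' w := rc M^-1 * F w.
have cF' : ccont F' by exact: ccontM (@ccont_cst _ _ (rc M^-1)) cF.
have F'1 w : nrm (F' w) <= 1.
  by rewrite nrmM nrm_rc ger0_norm ?invr_ge0 ?(ltW M0) // ler_pdivrMl // mulr1.
have : rnorm (iota (glift a b F')) <= 1.
  apply: rnorm_unit_ball; rewrite iota_mul_glift //.
  rewrite (_ : (fun w => _) = fun w => rc (nrm (F' w) ^+ 2)); last first.
    by apply/funext => w; rewrite mulrC mul_conj.
  apply: iota_glift_real => [|w]; first exact: ccont_rc_nrm2.
  by rewrite ger0_norm ?exprn_ge0 ?nrm_ge0 // expr_le1 ?nrm_ge0.
have -> : glift a b F' = rc M^-1 *: glift a b F.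
  symmetry; apply: glift_eq => [w|g nU].
    by rewrite -[LHS]/(rc M^-1 * glift a b F (arr a b w)) glift_arr.
  by rewrite -[LHS]/(rc M^-1 * glift a b F g) glift_out ?mulr0.
rewrite iotaZ ?rnormZ; last exact: Cc_glift.
by rewrite nrm_rc ger0_norm ?invr_ge0 ?(ltW M0) // ler_pdivrMl // mulr1.
Qed.

Lemma diag1_unit : iota (diag (fun=> 1)) = cunit.
Proof.
have c1 : Cc (diag (fun=> 1)) := Cc_glift [::] [::] (@ccont_cst _ _ (1 : C)).
have e1 x : iota (diag (fun=> 1)) ** x = x.
  apply: (@eq_le_dist _ _ _ _ 2) => e e0; have [f cf xf] := iota_approx x e0.
  have : iota (diag (fun=> 1)) ** iota f = iota f.
    by rewrite -iota_conv // conv_diagl; congr iota; apply/funext => g; rewrite mul1r.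
  move=> ef; rewrite -[_ - x](subrKA (iota f)) -{1}ef -cmulBr.
  apply: le_trans (rnormD _ _) _; rewrite (rnorm_dist _ x).
  have n1 : rnorm (iota (diag (fun=> 1))) <= 1.
    by apply: iota_glift_unimod => [|w]; [exact: ccont_cst | exact: nrm1].
  have := rnorm_mul (iota (diag (fun=> 1))) (x - iota f).
  have : rnorm (iota (diag (fun=> 1))) * rnorm (x - iota f) <= 1 * rnorm (x - iota f).
    by rewrite ler_wpM2r ?rnorm_ge0.
  by lra.
by rewrite -[LHS]cmulx1 e1.
Qed.

End GroupoidAlgebra.

(** * Pointwise multipliers *)

Section Multipliers.
Variables (R : realType) (n : nat).
Local Notation C := (Cplx R).
Local Notation X := (infinite_word n).
Local Notation G := (cuntz_groupoid n).
Variables (A : cstarAlgType C) (iota : (G -> C) -> A).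
Hypothesis hA : is_groupoid_cstar_algebra iota.
Implicit Types (a b c d : seq 'I_n) (F : X -> C) (f h m : G -> C) (x y : A) (g : G).

Definition fmul m f : G -> C := fun g => m g * f g.

Definition multiplier (r : R) m := forall f, Cc f ->
  Cc (fmul m f) /\ rnorm (iota (fmul m f)) <= r * rnorm (iota f).

(** The continuous extension to A of multiplication by m. It is specified by an
    estimate instead of a limit, so that two such extensions can be compared by
    [mult_by_unique]. *)
Definition mult_by m x : A := xget 0 [set y | exists2 r : R, 0 <= r &
  forall f, Cc f -> rnorm (y - iota (fmul m f)) <= r * rnorm (x - iota f)].

Lemma fmul_sub m f h : fmul m f - fmul m h = fmul m (f - h).
Proof.
apply/funext => g; rewrite -[LHS]/(m g * f g - m g * h g).
by rewrite -[RHS]/(m g * (f g - h g)) mulrBr.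
Qed.

Lemma mult_by_uniq_aux (y z : A) (r s : R) m x : 0 <= r -> 0 <= s ->
  (forall f, Cc f -> rnorm (y - iota (fmul m f)) <= r * rnorm (x - iota f)) ->
  (forall f, Cc f -> rnorm (z - iota (fmul m f)) <= s * rnorm (x - iota f)) -> y = z.
Proof.
move=> r0 s0 Hy Hz; apply: (@eq_le_dist _ _ _ _ (r + s)) => e e0.
have [f cf xf] := iota_approx hA x e0.
have := rnorm_tri (iota (fmul m f)) y z; have := Hy f cf; have := Hz f cf.
rewrite (rnorm_dist z).
have : r * rnorm (x - iota f) <= r * e by rewrite ler_wpM2l // ltW.
have : s * rnorm (x - iota f) <= s * e by rewrite ler_wpM2l // ltW.
by lra.
Qed.

(** Along a sequence of C_c(G) that converges to x, the products with m form a
    Cauchy sequence, whose limit satisfies the estimate. *)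
Lemma mult_by_le r m x f : 0 <= r -> multiplier r m -> Cc f ->
  rnorm (mult_by m x - iota (fmul m f)) <= r * rnorm (x - iota f).
Proof.
move=> r0 mm; move: f; have [F cF HF] := iota_seq hA x.
have Fx : (fun j => iota (F j)) @ \oo --> x.
  apply/cvg_seq_rnormP => e /inv_small[N HN]; exists N => k /HN.
  exact: lt_trans.
have le_m f h : Cc f -> Cc h ->
    rnorm (iota (fmul m f) - iota (fmul m h)) <= r * rnorm (iota f - iota h).
  move=> cf ch; rewrite -!(iotaB hA) ?fmul_sub //; try exact: (mm _ _).1.
  exact: (mm _ (Cc_sub cf ch)).2.
have r1 : 0 < r + 1 by rewrite ltr_wpDl.
have [|y Hy] := @rnorm_complete R A (fun j => iota (fmul m (F j))).
  move=> e e0; have e20 : 0 < e / (r + 1) / 2 by rewrite !divr_gt0.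
  have [N HN] := (cvg_seq_rnormP _ _).1 Fx _ e20; exists N => k Nk.
  apply: le_lt_trans (le_m _ _ (cF N) (cF k)) _.
  have h1 := HN N (leqnn _); have h2 := HN k Nk.
  have := rnorm_tri x (iota (F N)) (iota (F k)); rewrite (rnorm_dist _ x) => h3.
  apply: (@le_lt_trans _ _ ((r + 1) * rnorm (iota (F N) - iota (F k)))).
    by rewrite ler_wpM2r ?rnorm_ge0 // lerDl.
  rewrite -ltr_pdivlMl // mulrC; lra.
have yP f : Cc f -> rnorm (y - iota (fmul m f)) <= r * rnorm (x - iota f).
  move=> cf; rewrite leNgt; apply/negP => lt_y.
  set d := rnorm (y - iota (fmul m f)) - r * rnorm (x - iota f).
  have d0 : 0 < d by rewrite subr_gt0.
  have e0 : 0 < d / (r + 1) / 2 by rewrite !divr_gt0.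
  have d20 : 0 < d / 2 by rewrite divr_gt0.
  have [N HN] := (cvg_seq_rnormP _ _).1 Hy _ d20.
  have [M HM] := (cvg_seq_rnormP _ _).1 Fx _ e0.
  pose k := maxn N M; have h1 := HN k (leq_maxl _ _); have h2 := HM k (leq_maxr _ _).
  have h3 := le_m _ _ (cF k) cf.
  have h4 := rnorm_tri x (iota (F k)) (iota f); rewrite (rnorm_dist _ x) in h4.
  have h5 := rnorm_tri (iota (fmul m (F k))) y (iota (fmul m f)).
  have h6 : r * rnorm (x - iota (F k)) <= d / 2.
    apply: (@le_trans _ _ ((r + 1) * rnorm (x - iota (F k)))).
      by rewrite ler_wpM2r ?rnorm_ge0 // lerDl.
    by rewrite -ler_pdivlMl // mulrC mulrAC ltW.
  have h7 : r * rnorm (iota (F k) - iota f) <=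
      r * rnorm (x - iota (F k)) + r * rnorm (x - iota f).
    by rewrite -mulrDr ler_wpM2l.
  by move: h1 h3 h5 h6 h7; rewrite /d; lra.
have ex : exists y : A, exists2 r : R, 0 <= r &
    forall f, Cc f -> rnorm (y - iota (fmul m f)) <= r * rnorm (x - iota f).
  by exists y, r.
rewrite /mult_by; case: xgetP => [z zE [s s0 Hz]|/(_ y)]; last by case; exists r.
by rewrite (mult_by_uniq_aux s0 r0 Hz yP).
Qed.

Lemma mult_by_unique r s m x y : 0 <= r -> multiplier r m -> 0 <= s ->
  (forall f, Cc f -> rnorm (y - iota (fmul m f)) <= s * rnorm (x - iota f)) ->
  mult_by m x = y.
Proof.
by move=> r0 mm s0 Hy; exact: (mult_by_uniq_aux r0 s0 (fun f cf => mult_by_le x r0 mm cf) Hy).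
Qed.

Lemma mult_by_iota r m f : 0 <= r -> multiplier r m -> Cc f -> mult_by m (iota f) = iota (fmul m f).
Proof.
move=> r0 mm cf; apply: (@eq_le_dist _ _ _ _ 0) => e e0.
by have := mult_by_le (iota f) r0 mm cf; rewrite subrr rnorm0 mulr0 mul0r.
Qed.

Lemma mult_by_value r m x g : 0 <= r -> multiplier r m ->
  value iota (mult_by m x) g = m g * value iota x g.
Proof.
move=> r0 mm; apply: (@eq_le_nrm _ _ _ (r + nrm (m g))) => e e0.
have [f cf xf] := iota_approx hA x e0; have cm := (mm f cf).1.
have h1 := value_le hA (mult_by m x) g cm; have h2 := mult_by_le x r0 mm cf.
have h3 := value_le hA x g cf.
have h4 : nrm (fmul m f g - m g * value iota x g) <= nrm (m g) * e.
  rewrite -[fmul m f g]/(m g * f g) -mulrBr nrmM ler_wpM2l ?nrm_ge0 // nrm_dist.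
  exact: le_trans h3 (ltW xf).
have h5 : r * rnorm (x - iota f) <= r * e by rewrite ler_wpM2l // ltW.
have := nrm_tri (fmul m f g) (value iota (mult_by m x) g) (m g * value iota x g).
by lra.
Qed.

Lemma mult_by_comb r m (k : C) x y : 0 <= r -> multiplier r m ->
  mult_by m (k *: x + y) = k *: mult_by m x + mult_by m y.
Proof.
move=> r0 mm; apply: (@eq_le_dist _ _ _ _ (2 * r * (nrm k + 1))) => e e0.
have [f cf xf] := iota_approx hA x e0; have [h ch yh] := iota_approx hA y e0.
have cfh := Cc_comb k cf ch.
have h1 := mult_by_le (k *: x + y) r0 mm cfh.
have E : fmul m (k *: f + h) = k *: fmul m f + fmul m h.
  apply/funext => g; rewrite -[LHS]/(m g * (k * f g + h g)).
  by rewrite -[RHS]/(k * (m g * f g) + m g * h g); ring.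
rewrite E !(iota_comb hA) // in h1; try exact: (mm _ _).1.
have sp (u v u' v' : A) : (k *: u + v) - (k *: u' + v') = k *: (u - u') + (v - v').
  by rewrite scalerBr opprD addrACA.
rewrite sp in h1.
have h2 := rnormD (k *: (x - iota f)) (y - iota h).
have h3 := rnorm_tri (k *: iota (fmul m f) + iota (fmul m h))
  (mult_by m (k *: x + y)) (k *: mult_by m x + mult_by m y).
rewrite (sp (iota (fmul m f))) in h3.
have h4 := rnormD (k *: (iota (fmul m f) - mult_by m x)) (iota (fmul m h) - mult_by m y).
rewrite !rnormZ in h2 h4.
have h5 := mult_by_le x r0 mm cf; have h6 := mult_by_le y r0 mm ch.
rewrite rnorm_dist in h5; rewrite rnorm_dist in h6.
have k0 := nrm_ge0 k.
have h7 : nrm k * rnorm (iota (fmul m f) - mult_by m x) <= nrm k * (r * e).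
  by rewrite ler_wpM2l //; apply: le_trans h5 _; rewrite ler_wpM2l // ltW.
have h8 : rnorm (iota (fmul m h) - mult_by m y) <= r * e.
  by apply: le_trans h6 _; rewrite ler_wpM2l // ltW.
have h9 : r * rnorm (k *: (x - iota f) + (y - iota h)) <= r * (nrm k * e + e).
  rewrite ler_wpM2l //; apply: le_trans h2 _; apply: lerD; last exact: ltW.
  by rewrite ler_wpM2l // ltW.
by move: h1 h3 h4 h7 h8 h9; lra.
Qed.

Lemma mult_by_close r m1 m2 x f : 0 <= r -> multiplier r m1 -> multiplier r m2 -> Cc f ->
  fmul m1 f = fmul m2 f -> rnorm (mult_by m1 x - mult_by m2 x) <= 2 * r * rnorm (x - iota f).
Proof.
move=> r0 h1 h2 cf E; have := mult_by_le x r0 h1 cf; have := mult_by_le x r0 h2 cf.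
have := rnorm_tri (iota (fmul m1 f)) (mult_by m1 x) (mult_by m2 x).
by rewrite -E (rnorm_dist (mult_by m2 x)); lra.
Qed.

Section Good.
Variable B : set A.
Hypotheses (clB : closed B) (biB : is_bimodule iota B).

Lemma bimodD x y : B x -> B y -> B (x + y). Proof. by case: biB => _ + _ _ _; apply. Qed.
Lemma bimodZ (k : C) x : B x -> B (k *: x). Proof. by case: biB => _ _ + _ _; apply. Qed.

(** The functions m whose multiplication preserves B contain z ^ degree when B is
    gauge-invariant and the functions of range and source when B is a bimodule;
    they are closed under sums, products and, for a fixed r, local agreement
    ([preserves_local]). *)
Definition preserves (r : R) m := [/\ 0 <= r, multiplier r m & forall x, B x -> B (mult_by m x)].

Lemma preserves_le r s m : r <= s -> preserves r m -> preserves s m.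
Proof.
move=> rs [r0 mm Bm]; split=> //; first exact: le_trans rs.
move=> f cf; have [c1 h1] := mm f cf; split=> //; apply: le_trans h1 _.
by rewrite ler_wpM2r ?rnorm_ge0.
Qed.

Lemma fmulDl m1 m2 f : fmul (fun g => m1 g + m2 g) f = fmul m1 f + fmul m2 f.
Proof. by apply/funext => g; exact: mulrDl. Qed.

Lemma multiplierD r1 r2 m1 m2 : multiplier r1 m1 -> multiplier r2 m2 ->
  multiplier (r1 + r2) (fun g => m1 g + m2 g).
Proof.
move=> H1 H2 f cf; have [c1 h1] := H1 f cf; have [c2 h2] := H2 f cf.
rewrite fmulDl; split; first exact: Cc_add.
by rewrite (iota_add hA) // mulrDl; apply: le_trans (rnormD _ _) _; exact: lerD.
Qed.

Lemma mult_byD r1 r2 m1 m2 x : 0 <= r1 -> 0 <= r2 -> multiplier r1 m1 -> multiplier r2 m2 ->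
  mult_by (fun g => m1 g + m2 g) x = mult_by m1 x + mult_by m2 x.
Proof.
move=> r10 r20 H1 H2.
have r0 : 0 <= r1 + r2 by rewrite addr_ge0.
apply: (mult_by_unique r0 (multiplierD H1 H2) r0) => f cf.
rewrite fmulDl (iota_add hA (H1 f cf).1 (H2 f cf).1).
rewrite opprD addrACA mulrDl; apply: le_trans (rnormD _ _) _.
by apply: lerD; exact: mult_by_le.
Qed.

Lemma preservesD r1 r2 m1 m2 : preserves r1 m1 -> preserves r2 m2 ->
  preserves (r1 + r2) (fun g => m1 g + m2 g).
Proof.
move=> [r10 H1 B1] [r20 H2 B2]; split; first exact: addr_ge0.
  exact: multiplierD.
by move=> x Bx; rewrite (mult_byD x r10 r20 H1 H2); apply: bimodD; [exact: B1 | exact: B2].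
Qed.

Lemma preservesM r1 r2 m1 m2 : preserves r1 m1 -> preserves r2 m2 ->
  preserves (r1 * r2) (fun g => m1 g * m2 g).
Proof.
move=> [r10 H1 B1] [r20 H2 B2].
have E f : fmul (fun g => m1 g * m2 g) f = fmul m1 (fmul m2 f).
  by apply/funext => g; rewrite /fmul mulrA.
have r0 : 0 <= r1 * r2 by exact: mulr_ge0.
have mm : multiplier (r1 * r2) (fun g => m1 g * m2 g).
  move=> f cf; rewrite E; have [c2 h2] := H2 f cf; have [c1 h1] := H1 _ c2.
  split=> //; apply: le_trans h1 _; rewrite -mulrA; exact: ler_wpM2l.
split=> // x Bx; rewrite (@mult_by_unique _ (r1 * r2) _ x (mult_by m1 (mult_by m2 x)) r0 mm r0).
  exact/B1/B2.
move=> f cf; rewrite E; have c2 := (H2 f cf).1; apply: le_trans (mult_by_le _ r10 H1 c2) _.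
by rewrite -mulrA ler_wpM2l //; exact: mult_by_le.
Qed.

Lemma preserves_cst (k : C) : preserves (nrm k) (fun=> k).
Proof.
have E f : fmul (fun=> k) f = k *: f by [].
have mm : multiplier (nrm k) (fun=> k).
  move=> f cf; rewrite E; split; first exact: Cc_scale.
  by rewrite (iotaZ hA) // rnormZ.
split=> //; first exact: nrm_ge0.
move=> x Bx; rewrite (@mult_by_unique _ (nrm k) _ x (k *: x) (nrm_ge0 _) mm (nrm_ge0 _)).
  exact: bimodZ.
by move=> f cf; rewrite E (iotaZ hA) // -scalerBr rnormZ.
Qed.

Lemma preserves_sum (I : Type) (s : seq I) (r : I -> R) (m : I -> G -> C) :
  (forall i, preserves (r i) (m i)) -> preserves (\sum_(i <- s) r i) (fun g => \sum_(i <- s) m i g).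
Proof.
move=> H; elim: s => [|i s IH].
  rewrite big_nil (_ : (fun _ => _) = fun=> 0); last by apply/funext => g; rewrite big_nil.
  by have := preserves_cst 0; rewrite nrm0.
rewrite big_cons (_ : (fun _ => _) = fun g => m i g + \sum_(j <- s) m j g).
  exact: preservesD.
by apply/funext => g; rewrite big_cons.
Qed.

Lemma preserves_prod (I : Type) (s : seq I) (m : I -> G -> C) :
  (forall i, preserves 1 (m i)) -> preserves 1 (fun g => \prod_(i <- s) m i g).
Proof.
move=> H; elim: s => [|i s IH].
  rewrite (_ : (fun _ => _) = fun=> 1); last by apply/funext => g; rewrite big_nil.
  by have := preserves_cst 1; rewrite nrm1.
rewrite (_ : (fun _ => _) = fun g => m i g * \prod_(j <- s) m j g).
  by have := preservesM (H i) IH; rewrite mul1r.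
by apply/funext => g; rewrite big_cons.
Qed.

(** The bound r being uniform, m may be replaced near each f of C_c(G) by an m'
    that agrees with it on the support of f; the error tends to 0 and B is closed. *)
Lemma preserves_local r m : 0 <= r ->
  (forall f, Cc f -> exists2 m', preserves r m' & fmul m f = fmul m' f) -> preserves r m.
Proof.
move=> r0 H; have mm : multiplier r m.
  by move=> f cf; have [m' [_ mm' _] ->] := H f cf; exact: mm'.
split=> // x Bx; apply: (closed_rnormP B).1 clB _ _ => e e0.
have d0 : 0 < e / (2 * r + 1) by rewrite divr_gt0 // ltr_wpDl ?mulr_ge0.
have [f cf xf] := iota_approx hA x d0.
have [m' [_ mm' Bm'] E] := H f cf; exists (mult_by m' x); first exact: Bm'.
apply: le_lt_trans (mult_by_close x r0 mm mm' cf E) _.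
apply: (@le_lt_trans _ _ ((2 * r + 1) * rnorm (x - iota f))).
  by rewrite ler_wpM2r ?rnorm_ge0 // lerDl.
by rewrite mulrC -ltr_pdivlMr // ltr_wpDl ?mulr_ge0.
Qed.

Lemma diagonal_diag F : ccont F -> Defs.diagonal iota (iota (diag F)).
Proof.
move=> cF g ng; rewrite (value_iota hA); last exact: Cc_glift.
apply: glift_out => /basic_openP[w ew]; apply: ng; rewrite ew; split=> //.
Qed.

(** Multiplication by a function of the range is the left action of the diagonal
    algebra; [mult_by_source] is the counterpart for the right action. *)
Lemma mult_by_range F x : ccont F -> (forall w, nrm (F w) <= 1) ->
  multiplier 1 (fun g => F (grange g)) /\ mult_by (fun g => F (grange g)) x = iota (diag F) ** x.
Proof.
move=> cF F1; have cd := Cc_glift [::] [::] cF.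
have n1 := iota_glift_le hA [::] [::] ltr01 cF F1.
have E f : Cc f -> iota (fmul (fun g => F (grange g)) f) = iota (diag F) ** iota f.
  by move=> cf; rewrite -(iota_conv hA) // conv_diagl.
have le1 y : rnorm (iota (diag F) ** y) <= 1 * rnorm y.
  by apply: le_trans (rnorm_mul _ _) _; rewrite ler_wpM2r ?rnorm_ge0.
have mm : multiplier 1 (fun g => F (grange g)).
  move=> f cf; rewrite E //; split; last exact: le1.
  by apply: Cc_mul cf; exact: continuous_range.
split=> //; apply: (mult_by_unique ler01 mm ler01) => f cf.
by rewrite E // -cmulBr le1.
Qed.

Lemma mult_by_source F x : ccont F -> (forall w, nrm (F w) <= 1) ->
  multiplier 1 (fun g => F (gsource g)) /\ mult_by (fun g => F (gsource g)) x = x ** iota (diag F).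
Proof.
move=> cF F1; have cd := Cc_glift [::] [::] cF.
have n1 := iota_glift_le hA [::] [::] ltr01 cF F1.
have E f : Cc f -> iota (fmul (fun g => F (gsource g)) f) = iota f ** iota (diag F).
  move=> cf; rewrite -(iota_conv hA) // conv_diagr; congr iota.
  by apply/funext => g; rewrite /fmul mulrC.
have le1 y : rnorm (y ** iota (diag F)) <= 1 * rnorm y.
  by rewrite mulrC; apply: le_trans (rnorm_mul _ _) _; rewrite ler_wpM2l ?rnorm_ge0.
have mm : multiplier 1 (fun g => F (gsource g)).
  move=> f cf; rewrite E //; split; last exact: le1.
  by apply: Cc_mul cf; exact: continuous_source.
split=> //; apply: (mult_by_unique ler01 mm ler01) => f cf.
by rewrite E // -cmulBl le1.
Qed.

Lemma preserves_range F : ccont F -> (forall w, nrm (F w) <= 1) ->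
  preserves 1 (fun g => F (grange g)).
Proof.
move=> cF F1; split; [exact: ler01 | exact: (mult_by_range 0 cF F1).1 |].
move=> x Bx; rewrite (mult_by_range x cF F1).2; case: biB => _ _ _ + _; apply=> //.
exact: diagonal_diag.
Qed.

Lemma preserves_source F : ccont F -> (forall w, nrm (F w) <= 1) ->
  preserves 1 (fun g => F (gsource g)).
Proof.
move=> cF F1; split; [exact: ler01 | exact: (mult_by_source 0 cF F1).1 |].
move=> x Bx; rewrite (mult_by_source x cF F1).2; case: biB => _ _ _ _; apply=> //.
exact: diagonal_diag.
Qed.

End Good.

Lemma multiplier_twist (z : C) : `|z| = 1 -> multiplier 1 (fun g => z ^ gdegree g).
Proof.
move=> z1 f cf; split; first exact: Cc_twist.
by rewrite mul1r; exact: (iota_twist_le hA).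
Qed.

End Multipliers.

(** * Roots of unity *)

Section RootsOfUnity.
Variable C : numClosedFieldType.

Lemma prim_root_exists N : (0 < N)%N -> exists z : C, N.-primitive_root z.
Proof.
move=> N0; have [r] := closed_field_poly_normal ('X^N - 1 : {poly C}).
rewrite (monicP _) ?monicXnsubC // scale1r => Dr.
have unity : all N.-unity_root r by apply/allP => z; rewrite -root_prod_XsubC -Dr.
have sr : (N < (size r).+1)%N by rewrite -(size_prod_XsubC r id) -Dr size_XnsubC.
have [|z _ prz] := hasP (has_prim_root N0 unity _ sr); last by exists z.
by rewrite -separable_prod_XsubC -Dr separable_Xn_sub_1 // pnatr_eq0 -lt0n.
Qed.

(** Orthogonality of the characters of a cyclic group. *)
Lemma sum_prim_root N (z : C) (d : int) : N.-primitive_root z -> (`|d| < N)%N ->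
  \sum_(j < N) (z ^+ j) ^ d = if d == 0 then N%:R else 0.
Proof.
move=> prz dN; have [->|d0] := eqVneq d 0.
  by rewrite (eq_bigr (fun=> 1)) ?sumr_const ?card_ord // => j _; rewrite expr0z.
have zN : z ^ N%:Z = 1 by rewrite -exprnP (prim_expr_order prz).
have E (j : nat) : (z ^+ j) ^ d = (z ^ d) ^+ j by rewrite exprnP exprnP !exprz_exp mulrC.
under eq_bigr do rewrite E.
have zd1 : z ^ d != 1.
  have H (k : nat) : (0 < k < N)%N -> z ^+ k != 1.
    move=> /andP[k0 kN]; apply/negP => /eqP zk.
    have := eq_prim_root_expr prz k 0; rewrite zk expr0 (eqxx 1) mod0n modn_small //.
    by move=> /esym/eqP k00; rewrite k00 in k0.
  move: dN d0; case: d {E} => k; rewrite ?NegzE ?abszN.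
    by move=> kN k0; apply: H; lia.
  by move=> kN _; rewrite -invr_expz invr_eq1; apply: H.
have zdN : (z ^ d) ^+ N = 1 by rewrite exprnP exprz_exp mulrC -exprz_exp zN exp1rz.
have := subrX1 (z ^ d) N; rewrite zdN subrr => /esym/eqP.
by rewrite mulf_eq0 subr_eq0 (negPf zd1) => /eqP.
Qed.

Lemma prim_root_norm N (z : C) : N.-primitive_root z -> `|z| = 1.
Proof.
move=> prz; have N0 := prim_order_gt0 prz.
apply/eqP; rewrite -(pexpr_eq1 N0) ?normr_ge0 //.
by rewrite -normrX (prim_expr_order prz) normr1.
Qed.

End RootsOfUnity.

(** * Restriction to a bisection inside an invariant bimodule *)

Section GoodMultipliers.
Variables (R : realType) (n : nat).
Local Notation C := (Cplx R).
Local Notation X := (infinite_word n).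
Local Notation G := (cuntz_groupoid n).
Variables (A : cstarAlgType C) (iota : (G -> C) -> A).
Hypothesis hA : is_groupoid_cstar_algebra iota.
Implicit Types (a b c d : seq 'I_n) (F : X -> C) (f h m : G -> C) (x y : A) (g : G).

Lemma Cc_prefix_bound f : Cc f -> exists K, forall g, f g != 0 ->
  exists a b w, [/\ g = arr a b w, (size a <= K)%N & (size b <= K)%N].
Proof.
move=> /CcP[_ [s cov]]; exists (\max_(p <- s) (size p.1 + size p.2)) => g /cov[[a b] ps].
move=> /basic_openP[w ->]; exists a, b, w; split=> //.
  by apply: leq_trans (leq_bigmax_seq _ ps isT); rewrite leq_addr.
by apply: leq_trans (leq_bigmax_seq _ ps isT); rewrite leq_addl.
Qed.

Lemma Cc_degree_bound f : Cc f -> exists K, forall g, f g != 0 -> (`|gdegree g| <= K)%N.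
Proof.
move=> /Cc_prefix_bound[K HK]; exists K => g /HK[a [b [w [-> ha hb]]]].
by rewrite gdegree_arr; lia.
Qed.

Lemma fmul_eq m1 m2 f : (forall g, f g != 0 -> m1 g = m2 g) -> fmul m1 f = fmul m2 f.
Proof.
move=> H; apply/funext => g; rewrite /fmul; have [->|/H -> //] := eqVneq (f g) 0.
by rewrite !mulr0.
Qed.

Section Invariant.
Variable B : set A.
Hypotheses (clB : closed B) (biB : is_bimodule iota B).
Hypothesis gaugeB : forall z : C, `|z| = 1 -> preserves iota B 1 (fun g => z ^ gdegree g).
Local Notation preserves := (preserves iota B).

Lemma preserves_ext r m1 m2 : (forall g, m1 g = m2 g) -> preserves r m1 -> preserves r m2.
Proof. by move=> H; have -> : m1 = m2 by apply/funext. Qed.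

Definition deg_indic (k : int) g : C := if gdegree g == k then 1 else 0.

(** The component of degree k is a Fourier coefficient of the gauge action. On a
    function with bounded degrees the integral over the circle is an average over
    roots of unity of large enough order. *)
Lemma preserves_degree k : preserves 1 (deg_indic k).
Proof.
apply: (preserves_local hA clB ler01) => f /Cc_degree_bound[K HK].
pose N := (K + `|k| + 1)%N; have [|z prz] := @prim_root_exists C N; first by rewrite /N addn1.
have z1 := prim_root_norm prz.
pose m' g : C := \sum_(j <- index_enum 'I_N) (N%:R^-1 * (z ^+ j) ^ (- k)) * (z ^+ j) ^ gdegree g.
have zj1 (j : nat) : `|z ^+ j| = 1 by rewrite normrX z1 expr1n.
exists m'; last first.
  apply: fmul_eq => g /HK hg; rewrite /m' /deg_indic.
  transitivity (N%:R^-1 * \sum_(j < N) (z ^+ j) ^ (gdegree g - k)).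
    rewrite (sum_prim_root prz) ?subr_eq0; last by rewrite /N; lia.
    case: eqP => _; last by rewrite mulr0.
    by rewrite mulVf // pnatr_eq0 /N addn1.
  rewrite mulr_sumr; apply: eq_bigr => j _.
  have zj0 : z ^+ j \is a GRing.unit by rewrite unitfE -normr_eq0 zj1 oner_eq0.
  by rewrite -mulrA -(exprzDr zj0) addrC.
have N0 : 0 < N%:R :> R by rewrite ltr0n /N addn1.
have sum1 : \sum_(j <- index_enum 'I_N) N%:R^-1 = 1 :> R.
  by rewrite sumr_const card_ord -[LHS]mulr_natr mulVf // gt_eqF.
rewrite -sum1.
apply: (preserves_sum hA biB) => j.
have nj : nrm (N%:R^-1 * (z ^+ j) ^ (- k)) * 1 = N%:R^-1.
  rewrite mulr1 nrmM nrmV -rc_nat nrm_rc ger0_norm ?ler0n //.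
  by rewrite /nrm (norm_unimod _ (zj1 j)) mulr1.
by rewrite -nj; apply: (preservesM hA (preserves_cst hA biB _)); exact: gaugeB.
Qed.

Definition bool_indic (b : bool) : C := if b then 1 else 0.

(** For a letter l, let s be the sign telling whether a given letter is l. Then
    (1 + s(x_p) s(y_q)) / 2 indicates that x_p and y_q are both l or both different
    from l, and its norm is at most 1. The product over all l indicates equality;
    a sum of indicators over l would only be bounded by n. *)
Lemma preserves_letter p q : preserves 1 (fun g => bool_indic (grange g p == gsource g q)).
Proof.
pose s (l : 'I_n) (k : nat) (x : X) : C := if x k == l then 1 else -1.
have cs l k : ccont (s l k).
  apply: (@ccont_finite _ _ k.+1) => x y e; rewrite /s.
  by rewrite ((wtakeP _ _ _).1 e k (ltnSn k)).
have s1 l k w : nrm (s l k w) <= 1.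
  by rewrite /s; case: eqP => _; rewrite ?nrmN nrm1.
pose m l g : C := 2^-1 * 1 + 2^-1 * (s l p (grange g) * s l q (gsource g)).
have gm l : preserves 1 (m l).
  have H : preserves (nrm (2^-1 : C) * 1) (fun g => 2^-1 * (s l p (grange g) * s l q (gsource g))).
    apply: (preservesM hA (preserves_cst hA biB _)).
    have := preservesM hA (preserves_range hA biB (cs l p) (s1 l p))
      (preserves_source hA biB (cs l q) (s1 l q)).
    by rewrite mulr1.
  have H1 : preserves (nrm (2^-1 * 1 : C)) (fun=> 2^-1 * 1) by exact: preserves_cst.
  apply: preserves_le (preservesD hA biB H1 H).
  by rewrite !mulr1 nrmV -rc_nat nrm_rc ger0_norm //; lra.
apply: preserves_ext (preserves_prod hA biB (index_enum 'I_n) gm) => g; rewrite /bool_indic.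
case: eqP => [e|ne].
  rewrite big1 // => l _; rewrite /m /s e; case: eqP => _; first by field.
  by field.
rewrite (bigD1 (grange g p)) //= {1}/m /s eqxx.
case: eqP => [e|_]; first by rewrite e in ne.
have -> : 2^-1 * 1 + 2^-1 * (1 * -1) = 0 :> C by ring.
by rewrite mul0r.
Qed.

Lemma preserves_agree p q N :
  preserves 1 (fun g => bool_indic
    (wtake N (wshift p (grange g)) == wtake N (wshift q (gsource g)))).
Proof.
apply: preserves_ext (preserves_prod hA biB (index_enum 'I_N)
  (fun i : 'I_N => preserves_letter (p + i) (q + i))) => g; rewrite /bool_indic.
case: eqP => [e|ne].
  rewrite big1 // => i _; have := (wtakeP _ _ _).1 e i (ltn_ord i).
  by rewrite /wshift => ->; rewrite eqxx.
apply/eqP; apply: contraT => nz; case: ne; apply/wtakeP => i iN.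
apply/eqP; apply: contraT => ni; move: nz.
by rewrite (bigD1 (Ordinal iN)) //= (negPf ni) mul0r eqxx.
Qed.

Definition tail_indic p q g : C :=
  bool_indic ((gdegree g == p%:Z - q%:Z) && `[< wshift p (grange g) = wshift q (gsource g) >]).

(** Equality of tails involves infinitely many letters. On the support of a
    function of C_c(G), arrows have prefixes of length at most K, beyond which
    their tails agree by the choice of the degree, so K letters suffice. *)
Lemma preserves_tail p q : preserves 1 (tail_indic p q).
Proof.
apply: (preserves_local hA clB ler01) => f /Cc_prefix_bound[K HK].
pose m' g := deg_indic (p%:Z - q%:Z) g *
  bool_indic (wtake K (wshift p (grange g)) == wtake K (wshift q (gsource g))).
exists m'.
  by have := preservesM hA (preserves_degree (p%:Z - q%:Z)) (preserves_agree p q K); rewrite mulr1.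
apply: fmul_eq => g /HK[a [b [w [eg sa sb]]]].
rewrite /tail_indic /m' /deg_indic; case: eqP => [eD|_]; last by rewrite mul0r.
rewrite mul1r; congr bool_indic; apply/asboolP/eqP => [->//|e].
apply/funext => i; have [iK|Ki] := ltnP i K; first exact: ((wtakeP _ _ _).1 e).
rewrite eg gdegree_arr in eD; rewrite eg grange_arr gsource_arr /wshift /wcat.
rewrite !nth_default; try by lia.
congr (w _); lia.
Qed.

(** An arrow is in U_(a,b) when its range starts with a, its source with b, and the
    rest of the two words agree with the right degree. *)
Lemma preserves_basic a b : preserves 1 (\1_(basic_open a b)).
Proof.
pose F (c : seq 'I_n) (x : X) : C := bool_indic (wtake (size c) x == c).
have cF c : ccont (F c) by apply: (@ccont_finite _ _ (size c)) => x y e; rewrite /F e.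
have F1 c w : nrm (F c w) <= 1.
  by rewrite /F /bool_indic; case: eqP => _; rewrite ?nrm1 ?nrm0.
have := preservesM hA (preservesM hA (preserves_range hA biB (cF a) (F1 a))
  (preserves_tail (size a) (size b)))
  (preserves_source hA biB (cF b) (F1 b)).
rewrite !mulr1; apply: preserves_ext => g; rewrite indicE /F /tail_indic.
have [U|nU] := pselect (basic_open a b g).
  have [-> -> e ->] := (basic_open_rangeP _ _ _).1 U.
  by rewrite mem_set // e asboolT // !eqxx /bool_indic !mulr1.
rewrite memNset // /bool_indic.
case: ifP => [/eqP h1|_]; last by rewrite !mul0r.
case: ifP => [/andP[/eqP h2 /asboolP h3]|_]; last by rewrite mulr0 mul0r.
case: ifP => [/eqP h4|_]; last by rewrite mulr0.
by case: nU; apply/basic_open_rangeP.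
Qed.

End Invariant.

End GoodMultipliers.

(** * Fejer means *)

Section FejerCount.

(** For |k| <= M this is M - |k|, that is, M times the Fejer coefficient at k. *)
Definition diff_count (M : nat) (k : int) : nat :=
  (\sum_(i < M) \sum_(j < M) (k == (j%:Z - i%:Z)%R))%N.

Lemma diff_count_le M k : (diff_count M k <= M)%N.
Proof.
rewrite /diff_count -[X in (_ <= X)%N]card_ord -sum1_card; apply: leq_sum => i _.
have [[j0 /eqP e0]|nj] := pselect (exists j : 'I_M, k == j%:Z - i%:Z); last first.
  by rewrite big1 // => j _; case: eqP => // e; case: nj; exists j; apply/eqP.
rewrite (bigD1 j0) //= e0 eqxx big1 // => j /eqP nj; case: eqP => // e.
by case: nj; apply: val_inj => /=; lia.
Qed.

Lemma diff_count_opp M k : diff_count M (- k) = diff_count M k.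
Proof.
rewrite /diff_count exchange_big; apply: eq_bigr => i _; apply: eq_bigr => j _.
by congr nat_of_bool; lia.
Qed.

Lemma diff_count_ge M (K : nat) : (M - K <= diff_count M K)%N.
Proof.
rewrite -[X in (X <= _)%N](card_ord (M - K)) -sum1_card.
rewrite (big_ord_widen M (fun=> 1%N)) ?leq_subr // /diff_count big_mkcond.
apply: leq_sum => i _; case: ifP => // iMK.
have iK : (i + K < M)%N by lia.
rewrite (bigD1 (Ordinal iK)) //= (_ : (K == (i + K)%N%:Z - i%:Z :> int)) //.
by apply/eqP; lia.
Qed.

Lemma diff_count_near M k : (M <= diff_count M k + `|k|)%N.
Proof.
rewrite addnC -leq_subLR.
have [K] : exists K : nat, k = K \/ k = - K%:Z.
  by case: k => K; [exists K; left | exists K.+1; right; rewrite NegzE].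
by case=> ->; rewrite ?diff_count_opp ?abszN; exact: diff_count_ge.
Qed.

End FejerCount.

Section Synthesis.
Variables (R : realType) (n : nat).
Local Notation C := (Cplx R).
Local Notation X := (infinite_word n).
Local Notation G := (cuntz_groupoid n).
Variables (A : cstarAlgType C) (iota : (G -> C) -> A).
Hypothesis hA : is_groupoid_cstar_algebra iota.
Implicit Types (a b c d : seq 'I_n) (F : X -> C) (f h m : G -> C) (x y : A) (g : G).

Local Notation deg_indic := (@deg_indic R n).
Local Notation tail_indic := (@tail_indic R n).

Let T : set A := setT.
Let clT : closed T. Proof. exact: closedT. Qed.
Let biT : is_bimodule iota T. Proof. by []. Qed.
Let gaugeT (z : C) : `|z| = 1 -> preserves iota T 1 (fun g => z ^ gdegree g).
Proof. by move=> z1; split; [exact: ler01 | exact: (multiplier_twist hA) |]. Qed.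

Lemma multiplier_degree k : multiplier iota 1 (deg_indic k).
Proof. by have [] := preserves_degree hA clT biT gaugeT k. Qed.
Lemma multiplier_tail p q : multiplier iota 1 (tail_indic p q).
Proof. by have [] := preserves_tail hA clT biT gaugeT p q. Qed.
Lemma multiplier_basic a b : multiplier iota 1 (\1_(basic_open a b)).
Proof. by have [] := preserves_basic hA clT biT gaugeT a b. Qed.

Definition fejer (M : nat) g : C := M%:R^-1 * (diff_count M (gdegree g))%:R.

Lemma fejer_sum M g : fejer M g =
  \sum_(i < M) \sum_(j < M) M%:R^-1 * deg_indic (j%:Z - i%:Z) g.
Proof.
rewrite /fejer /diff_count natr_sum mulr_sumr; apply: eq_bigr => i _.
rewrite natr_sum mulr_sumr; apply: eq_bigr => j _; congr (_ * _).
by rewrite /deg_indic; case: eqP.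
Qed.

(** The Fejer kernel is the squared modulus of a sum of characters, so its samples
    w at the N-th roots of unity are nonnegative, and they sum to 1. For N > K + M
    the average of the gauge actions with weights w multiplies the component of
    degree k by the Fejer coefficient, for all |k| <= K. *)
Lemma multiplier_fejer M : (0 < M)%N -> multiplier iota 1 (fejer M).
Proof.
move=> M0; suff : preserves iota T 1 (fejer M) by case.
apply: (preserves_local hA clT ler01) => f /Cc_degree_bound[K HK].
pose N := (K + M + 1)%N; have [|z prz] := @prim_root_exists C N; first by rewrite /N addn1.
have z1 := prim_root_norm prz.
have zl1 (l : nat) : `|z ^+ l| = 1 by rewrite normrX z1 expr1n.
have zl0 (l : nat) : z ^+ l \is a GRing.unit by rewrite unitfE -normr_eq0 zl1 oner_eq0.
have N0 : N%:R != 0 :> C by rewrite pnatr_eq0 /N addn1.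
pose s (l : nat) : C := \sum_(i < M) (z ^+ l) ^ i%:Z.
pose w (l : 'I_N) : C := N%:R^-1 * (M%:R^-1 * (s l * (s l)^*)).
pose m' g : C := \sum_(l <- index_enum 'I_N) w l * (z ^+ l) ^ gdegree g.
have w_sum (k : int) : (`|k| <= K)%N ->
    \sum_(l < N) w l * (z ^+ l) ^ k = M%:R^-1 * (diff_count M k)%:R.
  move=> kK; transitivity (M%:R^-1 * \sum_(i < M) \sum_(j < M)
      (N%:R^-1 * \sum_(l < N) (z ^+ l) ^ (i%:Z - j%:Z + k))).
    transitivity (\sum_(l < N) M%:R^-1 * \sum_(i < M) \sum_(j < M)
        (N%:R^-1 * (z ^+ l) ^ (i%:Z - j%:Z + k))).
      apply: eq_bigr => l _; rewrite /w mulrCA -!mulrA; congr (_ * _).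
      rewrite [in LHS]/s rmorph_sum !mulr_suml mulr_sumr.
      apply: eq_bigr => i _; rewrite mulr_sumr mulr_sumr.
      apply: eq_bigr => j _; congr (_ * _).
      rewrite (exprzDr (zl0 l)) (exprzDr (zl0 l)) mulrA; congr (_ * _ * _).
      by have := conj_unimod (- j%:Z) (zl1 l); rewrite opprK; exact.
    rewrite -mulr_sumr; congr (_ * _); rewrite exchange_big; apply: eq_bigr => i _.
    by rewrite exchange_big; apply: eq_bigr => j _; rewrite mulr_sumr.
  congr (_ * _); rewrite /diff_count natr_sum; apply: eq_bigr => i _.
  rewrite natr_sum; apply: eq_bigr => j _.
  rewrite (sum_prim_root prz); last by rewrite /N; have := ltn_ord i; have := ltn_ord j; lia.
  have -> : (i%:Z - j%:Z + k == 0) = (k == j%:Z - i%:Z) by apply/eqP/eqP; lia.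
  by case: eqP => _; rewrite ?mulr0 // mulVf.
exists m'; last by apply: fmul_eq => g /HK hg; rewrite /m' w_sum.
have w_ge0 l : 0 <= w l.
  by apply: mulr_ge0; last apply: mulr_ge0; rewrite ?invr_ge0 ?ler0n //; exact: mul_conjC_ge0.
have sum1 : \sum_(l <- index_enum 'I_N) nrm (w l) = 1 :> R.
  apply: rc_inj; rewrite [LHS](raddf_sum (real_complex R)).
  transitivity (\sum_(l < N) w l * (z ^+ l) ^ (0 : int)).
    by apply: eq_bigr => l _; rewrite expr0z mulr1 -[RHS](ger0_norm (w_ge0 l)) nrmE.
  rewrite w_sum // (_ : diff_count M 0 = M) ?mulVf // ?pnatr_eq0 -?lt0n //.
  apply/eqP; rewrite eqn_leq diff_count_le.
  by have := diff_count_near M 0; rewrite absz0 addn0.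
rewrite -sum1; apply: (preserves_sum hA biT) => l.
by rewrite -[nrm _]mulr1; apply: (preservesM hA (preserves_cst hA biT _)); exact: gaugeT.
Qed.

(** On one bisection the degree has a constant value k, so the error is at
    most |k| / M times the norm. *)
Lemma fejer_near f : Cc f -> exists2 K : R, 0 <= K & forall M, (0 < M)%N ->
  rnorm (iota f - iota (fmul (fejer M) f)) <= K * M%:R^-1.
Proof.
move: f; apply: Cc_ind => [|a b F f cF cf [K K0 HK]].
  exists 0 => // M _; have -> : fmul (fejer M) 0 = 0.
    by apply/funext => g; exact: mulr0.
  by rewrite subrr rnorm0 mul0r.
pose k : int := (size a)%:Z - (size b)%:Z; have cl := Cc_glift a b cF.
exists (`|k|%N%:R * rnorm (iota (glift a b F)) + K).
  by rewrite addr_ge0 // mulr_ge0 ?ler0n ?rnorm_ge0.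
move=> M M0; pose q : C := M%:R^-1 * (diff_count M k)%:R.
have E : fmul (fejer M) (glift a b F + f) = q *: glift a b F + fmul (fejer M) f.
  apply/funext => g; rewrite -[LHS]/(fejer M g * (glift a b F g + f g)) mulrDr.
  rewrite -[RHS]/(q * glift a b F g + fejer M g * f g); congr (_ + _).
  have [/basic_openP[w ->]|nU] := pselect (basic_open a b g).
    by rewrite /fejer gdegree_arr.
  by rewrite glift_out // !mulr0.
have cm := (multiplier_fejer M0 cf).1.
rewrite E (iota_add hA cl cf) (iota_comb hA q cl cm) opprD addrACA.
apply: le_trans (rnormD _ _) _; rewrite mulrDl; apply: lerD; last exact: HK.
rewrite -[X in X - _]scale1r -scalerBl rnormZ mulrAC; apply: ler_wpM2r; first exact: rnorm_ge0.
have M0' : M%:R != 0 :> R by rewrite pnatr_eq0 -lt0n.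
have -> : 1 - q = rc (M%:R^-1 * (M%:R - (diff_count M k)%:R)).
  by rewrite mulrBr mulVf // rcB rcM rcV !rc_nat.
have le_c := diff_count_le M k.
rewrite nrm_rc ger0_norm; last first.
  by rewrite mulr_ge0 ?invr_ge0 ?ler0n // subr_ge0 ler_nat.
rewrite mulrC ler_wpM2r ?invr_ge0 ?ler0n // lerBlDl -natrD ler_nat.
exact: diff_count_near.
Qed.

Section Subspace.
Variables (W : set A) (x : A).
Hypotheses (clW : closed W) (W0 : W 0) (WD : forall y z, W y -> W z -> W (y + z))
  (WZ : forall (k : C) y, W y -> W (k *: y)).

Lemma absorb_sum (I : Type) (r : seq I) (m : I -> G -> C) :
  (forall i, multiplier iota 1 (m i) /\ W (mult_by iota (m i) x)) ->
  W (mult_by iota (fun g => \sum_(i <- r) m i g) x).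
Proof.
move=> H; suff : multiplier iota (size r)%:R (fun g => \sum_(i <- r) m i g) /\
  W (mult_by iota (fun g => \sum_(i <- r) m i g) x) by case.
elim: r => [|i r [IHm IHW]].
  rewrite (_ : (fun _ => _) = fun=> 0); last by apply/funext => g; rewrite big_nil.
  have E f : fmul (fun=> 0) f = 0 by apply/funext => g; exact: mul0r.
  have mm : multiplier iota 0 (fun=> 0 : C).
    by move=> f cf; rewrite E (iota0 hA) rnorm0 mul0r; split=> //; exact: Cc0.
  split=> //; rewrite (@mult_by_unique _ _ _ _ hA 0 0 _ x 0 (lexx 0) mm (lexx 0)) //.
  by move=> f cf; rewrite E (iota0 hA) subrr rnorm0 mul0r.
rewrite (_ : (fun _ => _) = fun g => m i g + \sum_(j <- r) m j g); last first.
  by apply/funext => g; rewrite big_cons.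
have [mi Wi] := H i; split.
  by rewrite [size _]/= -addn1 addnC natrD; exact: (multiplierD hA mi IHm).
by rewrite (mult_byD hA x ler01 (ler0n _ _) mi IHm); exact: WD.
Qed.

Hypothesis Wbasic : forall a b, W (mult_by iota (\1_(basic_open a b)) x).

(** The arrows that [tail_indic p q] selects are partitioned by their prefixes of
    lengths p and q into finitely many bisections. *)
Lemma absorb_tail p q : W (mult_by iota (tail_indic p q) x).
Proof.
have -> : tail_indic p q = fun g =>
    \sum_(t <- index_enum (p.-tuple 'I_n * q.-tuple 'I_n)%type) \1_(basic_open t.1 t.2) g.
  apply/funext => g; rewrite /tail_indic /bool_indic.
  have sp : size (wtake p (grange g)) == p by rewrite size_wtake.
  have sq : size (wtake q (gsource g)) == q by rewrite size_wtake.
  pose t0 : p.-tuple 'I_n * q.-tuple 'I_n := (Tuple sp, Tuple sq).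
  have only (t : p.-tuple 'I_n * q.-tuple 'I_n) : basic_open t.1 t.2 g -> t = t0.
    move=> /basic_open_rangeP[e1 e2 _ _]; rewrite [t]surjective_pairing; congr (_, _).
      by apply: val_inj; rewrite /= -e1 size_tuple.
    by apply: val_inj; rewrite /= -e2 size_tuple.
  rewrite (bigD1 t0) //= big1 ?addr0; last first.
    move=> t tn; rewrite indicE memNset // => U; move: tn.
    by rewrite (only t U) eqxx.
  rewrite indicE; case: ifP => [/andP[/eqP h1 /asboolP h2]|nU].
    rewrite mem_set //; apply/basic_open_rangeP => /=.
    by rewrite !size_wtake; split.
  rewrite memNset // => /basic_open_rangeP[_ _ /= h1 h2]; move: nU.
  by rewrite !size_wtake in h1 h2; rewrite h1 h2 eqxx asboolT.
apply: absorb_sum => t; split; last exact: Wbasic.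
exact: multiplier_basic.
Qed.

(** On functions with prefixes of length at most K, the arrows of degree k are those
    whose tails agree after p and q letters, for any q >= K and p = k + q. *)
Lemma absorb_degree k : W (mult_by iota (deg_indic k) x).
Proof.
apply: (closed_rnormP W).1 clW _ _ => e e0.
have e20 : 0 < e / 2 by rewrite divr_gt0.
have [f cf xf] := iota_approx hA x e20; have [K HK] := Cc_prefix_bound cf.
have [p [q [kE qK]]] : exists p q : nat, k = p%:Z - q%:Z /\ (K <= q)%N.
  exists `|(k + (K + `|k|)%N%:Z)%R|%N, (K + `|k|)%N; split; first by lia.
  by rewrite leq_addr.
exists (mult_by iota (tail_indic p q) x); first exact: absorb_tail.
have E : fmul (deg_indic k) f = fmul (tail_indic p q) f.
  apply: fmul_eq => g /HK[a [b [w [eg sa sb]]]].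
  rewrite /deg_indic /tail_indic kE; case: eqP => // eD.
  rewrite /bool_indic asboolT //; rewrite eg gdegree_arr in eD; rewrite eg grange_arr gsource_arr.
  have -> : p = (size a + (q - size b))%N by lia.
  have {2}-> : q = (size b + (q - size b))%N by lia.
  by rewrite -!wshift_add !wshift_wcat.
have := mult_by_close hA x ler01 (multiplier_degree k) (multiplier_tail p q) cf E.
by rewrite mulr1; lra.
Qed.

Lemma absorb_fejer M : (0 < M)%N -> W (mult_by iota (fejer M) x).
Proof.
move=> M0; have H k : multiplier iota 1 (fun g => M%:R^-1 * deg_indic k g) /\
    W (mult_by iota (fun g => M%:R^-1 * deg_indic k g) x).
  have E f : Cc f -> fmul (fun g => M%:R^-1 * deg_indic k g) f = M%:R^-1 *: fmul (deg_indic k) f.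
    by move=> cf; apply/funext => g; rewrite /fmul -mulrA.
  have nM : nrm (M%:R^-1 : C) <= 1.
    by rewrite nrmV -rc_nat nrm_rc ger0_norm ?ler0n // invf_le1 ?ltr0n // ler1n.
  have mk := multiplier_degree k.
  have mm : multiplier iota 1 (fun g => M%:R^-1 * deg_indic k g).
    move=> f cf; rewrite E //; have [ck hk] := mk f cf; split; first exact: Cc_scale.
    rewrite (iotaZ hA) // rnormZ; apply: le_trans hk.
    by rewrite ler_piMl ?rnorm_ge0.
  split=> //.
  rewrite (@mult_by_unique _ _ _ _ hA 1 1 _ x (M%:R^-1 *: mult_by iota (deg_indic k) x)
    ler01 mm ler01).
    exact/WZ/absorb_degree.
  move=> f cf; rewrite E // (iotaZ hA); last exact: (mk f cf).1.
  rewrite -scalerBr rnormZ; apply: le_trans (mult_by_le hA x ler01 mk cf).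
  by rewrite ler_piMl ?rnorm_ge0.
have -> : fejer M = fun g => \sum_(t <- index_enum ('I_M * 'I_M)%type)
    M%:R^-1 * deg_indic (t.2%:Z - t.1%:Z) g.
  by apply/funext => g; rewrite fejer_sum pair_bigA.
by apply: absorb_sum => t; exact: H.
Qed.

(** The Fejer means of x are finite combinations of its homogeneous components, and
    they converge to x by [fejer_near] and approximation. *)
Lemma mem_of_basic : W x.
Proof.
apply: (closed_rnormP W).1 clW _ _ => e e0.
have e40 : 0 < e / 4 by rewrite divr_gt0.
have [f cf xf] := iota_approx hA x e40; have [K K0 HK] := fejer_near cf.
have [|M HM] := @inv_small R (e / 4 / (K + 1)); first by rewrite !divr_gt0 // ltr_wpDl.
have {HM} HM := HM M (leqnn M).
exists (mult_by iota (fejer M.+1) x); first exact: absorb_fejer.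
have h1 := mult_by_le hA x ler01 (multiplier_fejer (ltn0Sn M)) cf.
have h2 := HK M.+1 isT.
have h3 : K * M.+1%:R^-1 <= e / 4.
  apply: (@le_trans _ _ ((K + 1) * M.+1%:R^-1)).
    by rewrite ler_wpM2r ?invr_ge0 ?ler0n // lerDl.
  by rewrite mulrC -ler_pdivlMr ?ltr_wpDl // ltW.
have h4 := rnorm_tri (iota f) x (mult_by iota (fejer M.+1) x).
have h5 := rnorm_tri (iota (fmul (fejer M.+1) f)) (iota f) (mult_by iota (fejer M.+1) x).
rewrite (rnorm_dist (iota (fmul _ _))) in h5.
rewrite mul1r in h1; apply: (le_lt_trans h4); have h6 := le_trans h2 h3.
have h7 := le_trans h5 (lerD h6 h1).
by move: (rnorm _) (rnorm (x - _)) h7 xf => u v; lra.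
Qed.

End Subspace.

End Synthesis.

(** * Spectral synthesis *)

Section Chi.
Variables (R : realType) (n : nat).
Local Notation C := (Cplx R).
Local Notation X := (infinite_word n).
Local Notation G := (cuntz_groupoid n).
Implicit Types (a b c d : seq 'I_n) (F : X -> C) (f h m : G -> C) (g : G).

Definition chi a b : G -> C := glift a b (fun=> 1).

Lemma Cc_chi a b : Cc (chi a b).
Proof. exact/Cc_glift/ccont_cst. Qed.

Lemma glift_sum_chi k a b F : (forall x y : X, wtake k x = wtake k y -> F x = F y) ->
  forall w0 : X, glift a b F =
    \sum_(t <- index_enum (k.-tuple 'I_n)) F (wcat t w0) *: chi (a ++ t) (b ++ t).
Proof.
move=> Fk w0; apply/esym/glift_eq => [w|g nU]; rewrite fct_sumE; last first.
  rewrite big1 // => t _; rewrite -[LHS]/(_ * chi (a ++ t) (b ++ t) g).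
  rewrite /chi glift_out ?mulr0 // => /basic_openP[w gE]; apply: nU.
  by rewrite gE arr_cat; exact: basic_open_arr.
have st : size (wtake k w) == k by rewrite size_wtake.
rewrite (bigD1 (Tuple st)) //= big1 ?addr0 => [|t tn].
  rewrite -[LHS]/(_ * chi _ _ _) /chi (arr_deepen a b k w) glift_arr mulr1; apply: Fk.
  by rewrite -{1}(size_wtake k w) wtake_wcat.
rewrite -[LHS]/(_ * chi _ _ _) /chi glift_out ?mulr0 // => /basic_openP[w' ].
rewrite arr_cat => /arr_inj E; case/eqP: tn; apply: val_inj => /=.
by rewrite E -{2}(size_tuple t) wtake_wcat.
Qed.

Lemma chi_split a b : chi a b = \sum_(i <- index_enum 'I_n) chi (rcons a i) (rcons b i).
Proof.
apply/esym/glift_eq => [w|g nU]; rewrite fct_sumE; last first.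
  rewrite big1 // => i _; rewrite /chi glift_out // => /basic_openP[w gE]; apply: nU.
  by rewrite gE -!cats1 arr_cat; exact: basic_open_arr.
rewrite (bigD1 (w 0%N)) //= big1 ?addr0 => [|i tn].
  by rewrite -!cats1 /chi (arr_deepen a b 1 w) glift_arr.
rewrite /chi glift_out // => /basic_openP[w' ].
by rewrite -!cats1 arr_cat => /arr_inj E; case/eqP: tn; rewrite E.
Qed.

End Chi.

Section SynthesisTheorem.
Variables (R : realType) (n : nat).
Local Notation C := (Cplx R).
Local Notation X := (infinite_word n).
Local Notation G := (cuntz_groupoid n).
Variables (A : cstarAlgType C) (iota : (G -> C) -> A).
Hypothesis hA : is_groupoid_cstar_algebra iota.
Variable w0 : X.
Implicit Types (a b c d : seq 'I_n) (F : X -> C) (f h m : G -> C) (x y : A) (g : G).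

(** After [mem_of_basic], only the restriction of x to one bisection is left. There
    an approximation F is replaced by a function F' that depends on finitely many
    letters, and that is set to 0 where F is below a threshold: on the remaining
    pieces x does not vanish, so their indicator functions are in W. *)
Lemma synthesis (W : set A) x : closed W -> W 0 ->
  (forall y z, W y -> W z -> W (y + z)) -> (forall (k : C) y, W y -> W (k *: y)) ->
  (forall a b, (forall g, basic_open a b g -> value iota x g != 0) -> W (iota (chi R a b))) ->
  W x.
Proof.
move=> clW W0 WD WZ Wchi; apply: (mem_of_basic hA) => // a b.
apply: (closed_rnormP W).1 clW _ _ => e e0; pose d := e / 8.
have d0 : 0 < d by rewrite divr_gt0.
have [h ch xh] := iota_approx hA x d0; pose F w := h (arr a b w).
have cF : ccont F by case: ch => [+ _] => /continuous_arrP; apply.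
have [k Hk] := ccont_unif cF d0.
have tk (t : k.-tuple 'I_n) (w : X) : wtake k (wcat t w) = t.
  by rewrite -[k in wtake k](size_tuple t) wtake_wcat.
(* F varies by less than d on a cylinder of length k and x differs from F by
   less than d, so the threshold 3 d keeps x away from 0 where F' is nonzero. *)
pose F' w := let v := F (wcat (wtake k w) w0) in if 3 * d <= nrm v then v else 0.
have F'k (v w : X) : wtake k v = wtake k w -> F' v = F' w by rewrite /F' => ->.
have cF' := ccont_finite F'k.
have FF' w : nrm (F w - F' w) <= 4 * d.
  have : nrm (F w - F (wcat (wtake k w) w0)) < d.
    by apply: Hk; rewrite -{2}(size_wtake k w) wtake_wcat.
  rewrite /F' /=; case: ifP => [_|/negbT]; first by lra.
  rewrite -ltNge subr0; have := nrmD (F w - F (wcat (wtake k w) w0)) (F (wcat (wtake k w) w0)).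
  by rewrite subrK; lra.
exists (iota (glift a b F')).
  rewrite (glift_sum_chi a b F'k w0) (iota_sum hA); last first.
    by move=> t _; exact/Cc_scale/Cc_chi.
  elim/big_ind: _ => // t _; rewrite (iotaZ hA _ (Cc_chi _ _ _)); set v := F' _.
  have [->|v0] := eqVneq v 0; first by rewrite scale0r.
  apply/WZ/Wchi => g /basic_openP[w ->]; move: v0; rewrite /v /F' /= tk.
  case: ifP => [hv _|_]; last by rewrite eqxx.
  have h1 := value_le hA x (arr (a ++ t) (b ++ t) w) ch.
  rewrite [X in nrm (_ - X)](_ : _ = F (wcat t w)) in h1; last by rewrite arr_cat.
  have h2 : nrm (F (wcat t w0) - F (wcat t w)) < d by apply: Hk; rewrite !tk.
  apply/eqP => v0; rewrite v0 sub0r nrmN in h1.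
  have := nrmD (F (wcat t w0) - F (wcat t w)) (F (wcat t w)); rewrite subrK.
  have h3 := le_lt_trans h1 xh; move=> h4; have := le_lt_trans h4 (ltrD h2 h3).
  by lra.
have h1 := mult_by_le hA x ler01 (multiplier_basic hA a b) ch.
rewrite mul1r [fmul _ _](indic_glift a b h) -/F in h1.
have E : glift a b F - glift a b F' = glift a b (fun w => F w - F' w).
  apply: glift_eq => [w|g nU]; first by rewrite -[LHS]/(_ - _) !glift_arr.
  by rewrite -[LHS]/(_ - _) !glift_out // subrr.
have cD : ccont (fun w => F w - F' w).
  have -> : (fun w => F w - F' w) = (fun w => F w + (-1) * F' w).
    by apply/funext => w; rewrite mulN1r.
  exact: (@ccontD R n F _ cF (@ccontM R n _ _ (@ccont_cst R n _) cF')).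
have h2 : rnorm (iota (glift a b F) - iota (glift a b F')) <= 4 * d.
  rewrite -(iotaB hA (Cc_glift a b cF) (Cc_glift a b cF')) E.
  by apply: (iota_glift_le hA _ _ _ cD FF'); rewrite mulr_gt0.
have := rnorm_tri (iota (glift a b F)) (mult_by iota \1_(basic_open a b) x) (iota (glift a b F')).
have d8 : d * 8 = e by rewrite /d divfK.
move: xh h1 h2; move: (rnorm _) (rnorm (_ - _)) (rnorm (_ - iota (glift a b F')))
  (rnorm (_ - iota (glift a b F'))).
by move=> r1 r2 r3 r4; lra.
Qed.

End SynthesisTheorem.

(** * Localization in gauge-invariant bimodules *)

Section Local.
Variables (R : realType) (n : nat).
Local Notation C := (Cplx R).
Local Notation X := (infinite_word n).
Local Notation G := (cuntz_groupoid n).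
Variables (A : cstarAlgType C) (iota : (G -> C) -> A).
Hypothesis hA : is_groupoid_cstar_algebra iota.
Implicit Types (a b c d : seq 'I_n) (F : X -> C) (f h m : G -> C) (x y : A) (g : G).
Local Notation chi := (@chi R n).

Lemma chi_indic a b : \1_(basic_open a b) = chi a b.
Proof.
apply: glift_eq => [w|g nU]; first by rewrite indicE mem_set //; exact: basic_open_arr.
by rewrite indicE memNset.
Qed.

Lemma conv_chi_gen i a : convolution (chi [:: i] [::]) (chi a [::]) = chi (i :: a) [::].
Proof.
apply: glift_eq => [w|g nU]; rewrite conv_glift.
  rewrite grange_arr (_ : wtake _ _ = [:: i]) // eqxx mul1r.
  by rewrite (@gswap_arr _ [:: i] [::] a) /= /chi glift_arr.
case: eqP => // gi; rewrite mul1r /chi glift_out // => /basic_openP[w e]; apply: nU.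
rewrite -(gswapK [::] gi) e (@gswap_arr _ [::] [:: i] a).
exact: basic_open_arr.
Qed.

Lemma S_wordE a : S_word iota a = iota (chi a [::]).
Proof.
elim: a => [|i a IH]; first by rewrite /S_word big_nil -(diag1_unit hA).
rewrite /S_word big_cons -/(S_word iota a) IH /S_gen chi_indic.
by rewrite -(iota_conv hA (Cc_chi _ _ _) (Cc_chi _ _ _)) conv_chi_gen.
Qed.

Lemma star_chi a b : star (iota (chi a b)) = iota (chi b a).
Proof.
rewrite -(iota_star hA (Cc_chi _ _ _)) involution_glift; congr iota.
by rewrite /chi; congr glift; apply/funext => w; exact: conjC1.
Qed.

Lemma mul_chi a b c : iota (chi a b) ** iota (chi b c) = iota (chi a c).
Proof.
rewrite -(iota_conv hA (Cc_chi _ _ _) (Cc_chi _ _ _)) conv_glift_glift; congr iota.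
by rewrite /chi; congr glift; apply/funext => w; exact: mulr1.
Qed.

Lemma cuntz_partial_isometryE a b : S_word iota a ** star (S_word iota b) = iota (chi a b).
Proof. by rewrite !S_wordE star_chi mul_chi. Qed.

Lemma value_eq0 x g : (forall e : R, 0 < e -> exists k,
    [/\ Cc k, k g = 0 & rnorm (x - iota k) < e]) -> value iota x g = 0.
Proof.
move=> H; apply: contrapT => /eqP; rewrite -nrm_eq0 => v0'.
have v0 : 0 < nrm (value iota x g) by rewrite lt_def v0' nrm_ge0.
have [k [ck kg xk]] := H _ v0.
by have := le_lt_trans (value_le hA x g ck) xk; rewrite kg subr0 ltxx.
Qed.

Lemma glift_off_unit a F g : ~ unit_space g -> glift a a F g = 0.
Proof.
move=> nu; apply: glift_out => /basic_openP[w gE]; apply: nu.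
by rewrite gE; split => //; rewrite gdegree_arr subrr.
Qed.

Lemma diagonal_chi a : Defs.diagonal iota (iota (chi a a)).
Proof. by move=> g nu; rewrite (value_iota hA g (Cc_chi _ _ _)); exact: glift_off_unit. Qed.

Lemma rnorm_chi a b : rnorm (iota (chi a b)) <= 1.
Proof. by apply: (iota_glift_le hA _ _ ltr01 (@ccont_cst R n 1)) => w; rewrite nrm1. Qed.

(** U_(a,b) composed with U_(b,a) lies in the unit space. *)
Lemma basic_mul_diagonal a b x :
  Defs.diagonal iota (mult_by iota \1_(basic_open a b) x ** iota (chi b a)).
Proof.
move=> g nu; apply: value_eq0 => e e0; have [h ch xh] := iota_approx hA x e0.
have cF : ccont (fun w => h (arr a b w)).
  by case: ch => [+ _] => /continuous_arrP; apply.
exists (glift a a (fun w => h (arr a b w))); split; first exact: (Cc_glift a a cF).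
  exact: glift_off_unit.
have h1 := mult_by_le hA x ler01 (multiplier_basic hA a b) ch.
rewrite mul1r [fmul _ _](indic_glift a b h) in h1.
have E : iota (glift a a (fun w => h (arr a b w))) =
    iota (glift a b (fun w => h (arr a b w))) ** iota (chi b a).
  rewrite -(iota_conv hA (Cc_glift a b cF) (Cc_chi _ _ _)) conv_glift_glift.
  by congr iota; congr glift; apply/funext => w; rewrite mulr1.
rewrite E -cmulBl; apply: le_lt_trans (rnorm_mul _ _) _.
apply: le_lt_trans xh; apply: le_trans h1.
by rewrite ler_piMr ?rnorm_ge0 // rnorm_chi.
Qed.

Section InvariantBimodule.
Variable B : set A.
Hypotheses (clB : closed B) (biB : is_bimodule iota B).
Hypothesis gaugeB : forall z : C, `|z| = 1 -> preserves iota B 1 (fun g => z ^ gdegree g).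

(** Let y be the restriction of x to U_(a,b), v the indicator function and
    z = (v - y / k) v^*. Then z is in the diagonal algebra, its norm is at most
    1/2, and v - z v is a multiple of y v^* v, so lies in B. Hence v - z^j v is in
    B for all j, and z^j v tends to 0. *)
Lemma near_chi_mem a b x (k : C) : B x -> k != 0 ->
  rnorm (mult_by iota \1_(basic_open a b) x - k *: iota (chi a b)) <= nrm k / 2 ->
  B (iota (chi a b)).
Proof.
move=> Bx k0 near; set y := mult_by _ _ _ in near; set v := iota (chi a b) in near *.
have By : B y by have [_ _] := preserves_basic hA clB biB gaugeB a b; exact.
have nk0 : 0 < nrm k by rewrite lt_def nrm_eq0 k0 nrm_ge0.
pose u := v - k^-1 *: y; pose z := u ** star v.
have nu : rnorm u <= 1 / 2.
  have -> : u = (- k^-1) *: (y - k *: v).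
    by rewrite scalerBr scalerA mulNr mulVf // scaleN1r opprK addrC scaleNr.
  rewrite rnormZ nrmN nrmV mulrC ler_pdivrMr // mul1r mulrC; exact: near.
have nz : rnorm z <= 1 / 2.
  apply: le_trans (rnorm_mul _ _) _; rewrite rnorm_star -[X in _ <= X]mulr1.
  by apply: ler_pM; rewrite ?rnorm_ge0 // rnorm_chi.
have Dz : Defs.diagonal iota z.
  move=> g nug; rewrite /z /u cmulBl cmulZl -scaleNr addrC (value_comb hA) /v star_chi.
  by rewrite (basic_mul_diagonal a b x nug) mul_chi (diagonal_chi a nug) mulr0 addr0.
have zv : v - z ** v = k^-1 *: (y ** iota (chi b b)).
  rewrite /z /u -cmulA /v star_chi mul_chi cmulBl mul_chi cmulZl.
  by rewrite opprB addrC subrK.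
pose w j := iter j (cmul z) v.
have Bw j : B (v - w j).
  elim: j => [|j IH]; first by rewrite subrr; case: biB.
  have -> : v - w j.+1 = (v - z ** v) + z ** (v - w j).
    by rewrite cmulBr addrA subrK.
  have [_ BD BZ Bl Br] := biB.
  by apply: BD; [rewrite zv; apply/BZ/Br => //; exact: diagonal_chi | exact: Bl].
have nw j : rnorm (w j) <= (1 / 2) ^+ j.
  elim: j => [|j IH]; first exact: rnorm_chi.
  rewrite exprS; apply: le_trans (rnorm_mul _ _) _.
  by apply: ler_pM; rewrite ?rnorm_ge0.
apply: (closed_rnormP B).1 clB _ _ => e e0.
have [||N HN] := @expr_small R (1 / 2) e _ _ e0; try lra.
by exists (v - w N); rewrite // opprB addrC subrK; exact: le_lt_trans (nw N) HN.
Qed.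

(** An approximation of x in C_c(G) is nearly constant on a small enough bisection
    around the given arrow. *)
Lemma chi_local_mem a b w x : B x -> value iota x (arr a b w) != 0 ->
  exists N, B (iota (chi (a ++ wtake N w) (b ++ wtake N w))).
Proof.
move=> Bx k0; set k := value _ _ _ in k0; pose e := nrm k / 8.
have nk0 : 0 < nrm k by rewrite lt_def nrm_eq0 k0 nrm_ge0.
have e0 : 0 < e by rewrite divr_gt0.
have [h ch xh] := iota_approx hA x e0; pose F w := h (arr a b w).
have cF : ccont F by case: ch => [+ _] => /continuous_arrP; apply.
have [N HN] := ccont_unif cF e0; exists N.
set a' := a ++ _; set b' := b ++ _.
apply: (near_chi_mem Bx k0).
have h1 := mult_by_le hA x ler01 (multiplier_basic hA a' b') ch.
rewrite mul1r [fmul _ _](indic_glift a' b' h) in h1.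
pose F' v := h (arr a' b' v).
have cF' : ccont F' by case: ch => [+ _] => /continuous_arrP; apply.
have F'k v : nrm (F' v - k) <= 2 * e.
  have h2 : nrm (F' v - F w) < e.
    by rewrite /F' arr_cat; apply: HN; rewrite -{1}(size_wtake N w) wtake_wcat.
  have h3 : nrm (F w - k) < e.
    by rewrite nrm_dist; apply: le_lt_trans xh; exact: (value_le hA).
  have := nrm_tri (F w) (F' v) k; lra.
have cD : ccont (fun v => F' v + (- k)) := @ccontD R n _ _ cF' (@ccont_cst R n _).
have E : glift a' b' F' - k *: chi a' b' = glift a' b' (fun v => F' v + (- k)).
  apply: glift_eq => [v|g nU].
    by rewrite -[LHS]/(_ - k * _) /chi !glift_arr mulr1.
  by rewrite -[LHS]/(_ - k * _) /chi !glift_out // mulr0 subrr.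
have cG := Cc_glift a' b' cF'.
have h2 : rnorm (iota (glift a' b' F') - k *: iota (chi a' b')) <= 2 * e.
  rewrite -(iotaZ hA _ (Cc_chi _ _ _)) -(iotaB hA cG (Cc_scale _ (Cc_chi _ _ _))) E.
  by apply: (iota_glift_le hA _ _ _ cD F'k); rewrite mulr_gt0.
apply: le_trans (rnorm_tri (iota (glift a' b' F')) _ _) _.
apply: le_trans (lerD (le_trans h1 (ltW xh)) h2) _.
by rewrite /e; lra.
Qed.

(** The prefixes e for which [chi (a ++ e) (b ++ e)] is in B form a bar by
    [chi_local_mem], and U_(ae,be) is the union of the bisections of the
    successors of e. *)
Lemma chi_mem a b : basic_open a b `<=` sigma iota B -> B (iota (chi a b)).
Proof.
move=> sB; rewrite -[a]cats0 -[b]cats0.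
apply: (@bar_induction n (fun e => B (iota (chi (a ++ e) (b ++ e)))) [::]) => [e He|w].
  rewrite chi_split (iota_sum hA); last by move=> i _; exact: Cc_chi.
  have [B0 BD _ _ _] := biB.
  by elim/big_ind: _ => // i _; rewrite !rcons_cat.
have [x Bx xg] := sB _ (basic_open_arr a b w).
exact: (chi_local_mem Bx xg).
Qed.

(** For x in A(sigma B), a bisection on which x does not vanish lies in sigma B, so
    [chi_mem] provides the hypothesis of [synthesis]. *)
Lemma invariant_reflexive (w0 : X) : reflexive_bimodule iota B.
Proof.
apply/seteqP; split=> x.
  by move=> Bx g ng; apply: contrapT => /eqP v0; apply: ng; exists x.
have [B0 BD BZ _ _] := biB.
move=> Ax; apply: (synthesis hA w0 clB B0 BD BZ) => a b nz; apply: chi_mem => g Ug.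
by apply: contrapT => ns; have := nz g Ug; rewrite Ax // eqxx.
Qed.

End InvariantBimodule.

End Local.

(** * Gauge automorphisms *)

Section Gauge.
Variables (R : realType) (n : nat).
Local Notation C := (Cplx R).
Local Notation X := (infinite_word n).
Local Notation G := (cuntz_groupoid n).
Variables (A : cstarAlgType C) (iota : (G -> C) -> A).
Hypothesis hA : is_groupoid_cstar_algebra iota.
Implicit Types (a b c d : seq 'I_n) (F : X -> C) (f h m : G -> C) (x y : A) (g : G).
Local Notation chi := (@chi R n).

(** The gauge automorphism in concrete form; [gaugeE] identifies the two. *)
Definition eta (z : C) : A -> A := mult_by iota (fun g => z ^ gdegree g).

Lemma twist_chi z a b : twist z (chi a b) = z ^ ((size a)%:Z - (size b)%:Z) *: chi a b.
Proof.
apply/funext => g; rewrite -[RHS]/(_ * chi a b g) /twist.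
have [/basic_openP[w ->]|nU] := pselect (basic_open a b g); first by rewrite gdegree_arr.
by rewrite /chi glift_out // !mulr0.
Qed.

Lemma twistV (z : C) f : z != 0 -> twist z^-1 (twist z f) = f.
Proof.
move=> z0; apply/funext => g; rewrite /twist mulrA -expfzMl mulVf // exp1rz mul1r //.
Qed.

Section Unimodular.
Variable z : C.
Hypothesis z1 : `|z| = 1.

Let mt : multiplier iota 1 (fun g => z ^ gdegree g). Proof. exact: (multiplier_twist hA). Qed.

Let z0 : z != 0. Proof. by rewrite -normr_eq0 z1 oner_eq0. Qed.

Lemma eta_iota f : Cc f -> eta z (iota f) = iota (twist z f).
Proof. by move=> cf; exact: (mult_by_iota hA ler01 mt cf). Qed.

Lemma eta_comb (k : C) x y : eta z (k *: x + y) = k *: eta z x + eta z y.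
Proof. exact: (mult_by_comb hA k x y ler01 mt). Qed.

Lemma eta0 : eta z 0 = 0.
Proof.
have := eta_comb 1 0 0; rewrite !scale1r addr0 => /eqP.
by rewrite addrC -subr_eq subrr eq_sym => /eqP.
Qed.

Lemma rnorm_eta x : rnorm (eta z x) <= rnorm x.
Proof.
have := mult_by_le hA x ler01 mt (@Cc0 R n); rewrite (_ : fmul _ 0 = 0); last first.
  by apply/funext => g; exact: mulr0.
by rewrite (iota0 hA) !subr0 mul1r.
Qed.

Lemma eta_near x y : rnorm (eta z x - eta z y) <= rnorm (x - y).
Proof.
have -> : eta z x - eta z y = eta z ((-1) *: y + x).
  by rewrite eta_comb scaleN1r addrC.
by rewrite scaleN1r addrC; exact: rnorm_eta.
Qed.

Lemma cvg_eta (u : nat -> A) x : u @ \oo --> x -> (fun k => eta z (u k)) @ \oo --> eta z x.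
Proof.
move=> /(cvg_seq_rnormP u x).1 ux; apply/(cvg_seq_rnormP (fun k => eta z (u k)) (eta z x)).
move=> e e0; have [N HN] := ux e e0; exists N => k Nk.
exact: le_lt_trans (eta_near _ _) (HN k Nk).
Qed.

Lemma iota_cvg x : exists2 f : nat -> G -> C, forall j, Cc (f j) &
  (fun j => iota (f j)) @ \oo --> x.
Proof.
have [f cf xf] := iota_seq hA x; exists f => //.
apply/(cvg_seq_rnormP (fun j => iota (f j)) x) => e e0; have [N HN] := inv_small e0.
by exists N => k Nk; exact: lt_trans (xf k) (HN k Nk).
Qed.

Lemma etaM x y : eta z (x ** y) = eta z x ** eta z y.
Proof.
have [f cf xf] := iota_cvg x; have [h ch yh] := iota_cvg y.
apply: (cvg_seq_unique (cvg_eta (cvg_mul xf yh))).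
have := cvg_mul (cvg_eta xf) (cvg_eta yh).
rewrite (_ : (fun k => _) = (fun k => eta z (iota (f k) ** iota (h k)))) //.
apply/funext => k; rewrite (eta_iota (cf k)) (eta_iota (ch k)).
rewrite -(iota_conv hA (cf k) (ch k)) -(iota_conv hA (Cc_twist z (cf k)) (Cc_twist z (ch k))).
by rewrite (twist_conv _ _ z0) eta_iota //; exact: (Cc_conv (cf k) (ch k)).
Qed.

Lemma eta_star x : eta z (star x) = star (eta z x).
Proof.
have [f cf xf] := iota_cvg x.
apply: (cvg_seq_unique (cvg_eta (cvg_star xf))).
have := cvg_star (cvg_eta xf).
rewrite (_ : (fun k => _) = (fun k => eta z (star (iota (f k))))) //.
apply/funext => k; rewrite (eta_iota (cf k)).
rewrite -(iota_star hA (cf k)) -(iota_star hA (Cc_twist z (cf k))).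
by rewrite (twist_involution _ z1) eta_iota //; exact: (Cc_involution (cf k)).
Qed.

Lemma eta_chi a b :
  eta z (iota (chi a b)) = z ^ ((size a)%:Z - (size b)%:Z) *: iota (chi a b).
Proof. by rewrite (eta_iota (Cc_chi _ _ _)) twist_chi (iotaZ hA _ (Cc_chi _ _ _)). Qed.

Lemma eta1 : eta z cunit = cunit.
Proof. by rewrite -(diag1_unit hA) (eta_chi [::] [::]) subrr expr0z scale1r. Qed.

Lemma eta_gen i : eta z (S_gen iota i) = z *: S_gen iota i.
Proof. by rewrite /S_gen chi_indic eta_chi. Qed.

Lemma eta_diagonal x : Defs.diagonal iota x -> Defs.diagonal iota (eta z x).
Proof. by move=> Dx g nu; rewrite (mult_by_value hA x g ler01 mt) Dx // mulr0. Qed.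

End Unimodular.

Lemma etaVK (z : C) : `|z| = 1 -> cancel (eta z) (eta z^-1).
Proof.
move=> z1 x; have z1V : `|z^-1| = 1 by rewrite normfV z1 invr1.
have z0 : z != 0 by rewrite -normr_eq0 z1 oner_eq0.
have [f cf xf] := iota_cvg x.
apply: (cvg_seq_unique (cvg_eta z1V (cvg_eta z1 xf))).
rewrite (_ : (fun k => _) = (fun k => iota (f k))) //.
apply/funext => k; rewrite (eta_iota z1 (cf k)) (eta_iota z1V (Cc_twist z (cf k))).
by rewrite twistV.
Qed.

Lemma eta_automorphism (z : C) : `|z| = 1 -> star_automorphism (eta z).
Proof.
move=> z1; have z1V : `|z^-1| = 1 by rewrite normfV z1 invr1.
split; [exact: (eta_comb z1) | exact: (etaM z1) | exact: (eta1 z1) | exact: (eta_star z1) |].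
exists (eta z^-1); first exact: (etaVK z1).
by move=> x; have := etaVK z1V x; rewrite invrK.
Qed.

(** The two maps agree on the partial isometries and are contractive, so the set
    where they agree is a closed subspace to which [synthesis] applies. *)
Lemma automorphism_eta (w0 : X) (z : C) (phi : A -> A) : `|z| = 1 -> star_automorphism phi ->
  (forall i, phi (S_gen iota i) = z *: S_gen iota i) -> phi = eta z.
Proof.
move=> z1 [phiL phiM phi1 phiS _] phig; apply/funext => x.
have contr := star_hom_contractive phiL phiM phi1 phiS.
have phi0 : phi 0 = 0.
  have := phiL 1 0 0; rewrite !scale1r addr0 => /eqP.
  by rewrite -[X in X == _]addr0 (inj_eq (addrI _)) eq_sym => /eqP.
have phiZ (k : C) y : phi (k *: y) = k *: phi y by rewrite -[k *: y]addr0 phiL phi0 addr0.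
have phiD y y' : phi (y + y') = phi y + phi y' by rewrite -[y]scale1r phiL !scale1r.
have phi_word a : phi (S_word iota a) = z ^+ size a *: S_word iota a.
  elim: a => [|i a IH]; first by rewrite /S_word big_nil scale1r phi1.
  rewrite /S_word big_cons -/(S_word iota a) phiM phig IH cmulZl cmulZr scalerA.
  by rewrite -exprS.
suff : [set y | phi y = eta z y] x by [].
apply: (synthesis hA w0).
- apply/closed_rnormP => y Hy; apply: (@eq_le_dist _ _ _ _ 2) => // e e0.
  have [y' /= E yy'] := Hy e e0.
  have h1 := eta_near z1 y y'; have h2 := contr (y - y').
  rewrite phiD -[- y']scaleN1r phiZ !scaleN1r E in h2.
  have := rnorm_tri (eta z y') (phi y) (eta z y); rewrite [rnorm (eta z y' - _)]rnorm_dist.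
  move=> h3; apply: le_trans h3 _.
  apply: le_trans (lerD (le_trans h2 (ltW yy')) (le_trans h1 (ltW yy'))) _.
  by rewrite mulr_natl mulr2n.
- by rewrite /= phi0 (eta0 z1).
- by move=> y y' /= E E'; rewrite phiD E E' -[y in RHS]scale1r (eta_comb z1) !scale1r.
- by move=> k y /= E; rewrite phiZ E -[k *: y]addr0 (eta_comb z1) (eta0 z1) addr0.
move=> a b _; rewrite /= -(cuntz_partial_isometryE hA) phiM phiS !phi_word starZ.
rewrite cmulZl cmulZr scalerA (cuntz_partial_isometryE hA) (eta_chi z1); congr (_ *: _).
have z0 : z \is a GRing.unit by rewrite unitfE -normr_eq0 z1 oner_eq0.
rewrite (exprzDr z0) -exprnP; congr (_ * _).
by have := conj_unimod (- (size b)%:Z) z1; rewrite opprK; exact.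
Qed.

Lemma gaugeE (w0 : X) (z : C) : `|z| = 1 -> gauge iota z = eta z.
Proof.
move=> z1.
have : [set phi : A -> A | star_automorphism phi /\
    forall i, phi (S_gen iota i) = z *: S_gen iota i] (gauge iota z).
  apply: xgetPex; exists (eta z); split; first exact: eta_automorphism.
  by move=> i; exact: (eta_gen z1).
by move=> [aut gen]; exact: (automorphism_eta w0 z1).
Qed.

End Gauge.

(** * Equivalence of the three properties *)

Section Main.
Variables (R : realType) (n : nat).
Local Notation C := (Cplx R).
Local Notation X := (infinite_word n).
Local Notation G := (cuntz_groupoid n).
Variables (A : cstarAlgType C) (iota : (G -> C) -> A).
Hypothesis hA : is_groupoid_cstar_algebra iota.
Variables (B : set A) (w0 : X).
Hypothesis hB : is_closed_bimodule iota B.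

(** Synthesis in an arbitrary closed bimodule that contains the partial isometries
    of B: if x in B does not vanish on U_(a,b), then U_(a,b) lies in sigma B and
    [chi a b] in A(sigma B) = B. *)
Lemma reflexive_generated : reflexive_bimodule iota B ->
  generated_by_cuntz_partial_isometries iota B.
Proof.
move=> rB; apply/seteqP; split=> [x Bx M [[clM [M0 MD MZ _ _]] subM]|]; last first.
  by move=> x; apply; split => // y [].
apply: (synthesis hA w0 clM M0 MD MZ) => a b nz; apply: subM; split; last first.
  by exists a, b; rewrite (cuntz_partial_isometryE hA).
rewrite rB => g ng; rewrite (value_iota hA g (Cc_chi _ _ _)) /chi glift_out // => Ug.
by apply: ng; exists x => //; exact: nz.
Qed.

(** The preimage of B under a gauge automorphism is a closed bimodule, because the
    automorphism preserves the diagonal algebra, and it contains the partial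
    isometries of B, which are multiplied by scalars. *)
Lemma generated_invariant : generated_by_cuntz_partial_isometries iota B ->
  gauge_invariant iota B.
Proof.
move=> gB z z1 x Bx; rewrite (gaugeE hA w0 z1); have [clB [B0 BD BZ Bl Br]] := hB.
have := eq_ind _ (fun S : set A => S x) Bx _ gB.
move=> /(_ (eta iota z @^-1` B)); apply; split; last first.
  move=> _ [/[swap] [[a [b ->]]]]; rewrite (cuntz_partial_isometryE hA) /= (eta_chi hA z1).
  exact: BZ.
rewrite /= -/(eta iota z); split.
  apply/closed_rnormP => y Hy; apply: (closed_rnormP B).1 clB _ _ => e e0.
  have [y' By' yy'] := Hy e e0; exists (eta iota z y') => //.
  exact: le_lt_trans (eta_near hA z1 _ _) yy'.
split => /=.
- by rewrite (eta0 hA z1).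
- by move=> y y' By By'; rewrite -[y]scale1r (eta_comb hA z1) scale1r; exact: BD.
- by move=> k y By; rewrite -[k *: y]addr0 (eta_comb hA z1) (eta0 hA z1) addr0; exact: BZ.
- by move=> d y Dd By; rewrite (etaM hA z1); apply: Bl => //; exact: (eta_diagonal hA z1).
- by move=> d y Dd By; rewrite (etaM hA z1); apply: Br => //; exact: (eta_diagonal hA z1).
Qed.

Lemma gauge_reflexive : gauge_invariant iota B -> reflexive_bimodule iota B.
Proof.
move=> gaugeB; have [clB biB] := hB; apply: (invariant_reflexive hA clB biB _ w0) => z z1.
split; [exact: ler01 | exact: (multiplier_twist hA z1) | move=> x Bx].
by rewrite -/(eta iota z) -(gaugeE hA w0 z1); exact: gaugeB.
Qed.

End Main.

Theorem theorem1 (R : realType) (n : nat) (hn : (2 <= n)%N)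
    (A : cstarAlgType (Cplx R)) (iota : (cuntz_groupoid n -> Cplx R) -> A)
    (hA : is_groupoid_cstar_algebra iota)
    (B : set A) (hB : is_closed_bimodule iota B) :
  [<-> reflexive_bimodule iota B;
       generated_by_cuntz_partial_isometries iota B;
       gauge_invariant iota B].
Proof.
have w0 : infinite_word n := fun=> Ordinal (ltnW hn).
tfae; [exact: reflexive_generated | exact: generated_invariant | exact: gauge_reflexive].
Qed.
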